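(* Let $\mu$ be a $\boxplus$-infinitely divisible probability measure on $\mathbb{R}$, and let $\phi_\mu:\mathbb{C}^+\to\mathbb{C}^-\cup\mathbb{R}$ be the analytic extension of its Voiculescu transform. Assume: 1. for every $x\in\mathbb{R}$, either the nontangential limit of $\phi_\mu$ at $x$ exists in $\mathbb{C}$ and belongs to $\mathbb{C}^-$, or $\phi_\mu$ has no nontangential limit (in $\mathbb{C}\cup\{\infty\}$) at $x$; 2. at $\infty$, one of the following holds: (i) the nontangential limit of $\phi_\mu$ at $\infty$ is $\infty$; (ii) the nontangential limit of $\phi_\mu$ at $\infty$ exists and belongs to $\mathbb{C}^-$; (iii) the nontangential cluster set $C^\Delta(\phi_\mu,\infty)$ contains more than one point. Then for every Borel probability measure $\nu$ on $\mathbb{R}$, $\mu\boxplus\nu$ is absolutely continuous with respect to Lebesgue measure, with a density that is strictly positive and real-analytic on all of $\mathbb{R}$.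
   Context: $\mathbb{C}^\pm=\{z:\pm\operatorname{Im}z>0\}$. For a Borel probability measure $\mu$ on $\mathbb{R}$, $G_\mu(z)=\int(z-t)^{-1}d\mu(t)$ and $F_\mu=1/G_\mu:\mathbb{C}^+\to\mathbb{C}^+$. $F_\mu$ is injective on a region of the form $\{z:|z|>M,\ \operatorname{Im}z>\alpha|\operatorname{Re}z|\}$ and the Voiculescu transform is $\phi_\mu(z)=F_\mu^{-1}(z)-z$ on the image of such a region. The free convolution $\mu\boxplus\nu$ is the unique probability measure with $\phi_{\mu\boxplus\nu}=\phi_\mu+\phi_\nu$ on a common region near $\infty$. $\mu$ is $\boxplus$-infinitely divisible if for every $n$ it is the $n$-fold free convolution power of some probability measure; equivalently $\phi_\mu$ extends analytically to $\mathbb{C}^+$ with values in $\mathbb{C}^-\cup\mathbb{R}$ (this extension is also denoted $\phi_\mu$). Nontangential limit of $f$ at $x\in\mathbb{R}$: the limit of $f(z)$ as $z\to x$ within every cone $\{z\in\mathbb{C}^+:|\operatorname{Re}(z-x)|<c\operatorname{Im}z\}$, $c>0$; at $\infty$: as $|z|\to\infty$ within every cone $\{z\in\mathbb{C}^+:|\operatorname{Re}z|<c\operatorname{Im}z\}$. The nontangential cluster set $C^\Delta(f,\infty)$ is the closure in $\mathbb{C}\cup\{\infty\}$ of the union over $c>0$ of the sets of limits of $f(z_n)$ for sequences $z_n\to\infty$ in such cones. *)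

(* Defs.v *)
From HB Require Import structures.
From mathcomp Require Import all_boot all_order all_algebra.
From mathcomp Require Import all_classical all_reals all_analysis.
From mathcomp Require Import complex.
Set Implicit Arguments.
Unset Strict Implicit.
Unset Printing Implicit Defensive.
Import Order.TTheory GRing.Theory Num.Theory.
Import numFieldNormedType.Exports.
Local Open Scope classical_set_scope.
Local Open Scope ring_scope.

Section FreeDefs.
Variable R : realType.
Local Notation C := R[i].

Definition ReC (z : C) : R := complex.Re z.
Definition ImC (z : C) : R := complex.Im z.
Definition ofR (x : R) : C := complex.Complex x 0.
Definition cabs (z : C) : R := Num.sqrt (ReC z ^+ 2 + ImC z ^+ 2).

Definition UHP (z : C) : Prop := 0 < ImC z.

(* Cauchy transform G_mu(z) = int (z - t)^-1 dmu(t), written via its real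
   and imaginary parts (both bounded continuous integrands for z in C^+). *)
Definition cauchy (mu : probability R R) (z : C) : C :=
  complex.Complex (Rintegral mu setT (fun t => ReC ((z - ofR t)^-1)))
                  (Rintegral mu setT (fun t => ImC ((z - ofR t)^-1))).

Definition Ftr (mu : probability R R) (z : C) : C := (cauchy mu z)^-1.

Definition Gamma (a M : R) (z : C) : Prop := M < cabs z /\ a * `|ReC z| < ImC z.

(* phi is the Voiculescu transform of mu on Gamma b N, computed via the inverse
   of F_mu restricted to Gamma a M (on which F_mu is injective):
   phi w = F_mu^{-1}(w) - w, i.e. w + phi w lies in Gamma a M and F_mu maps it to w. *)
Definition voiculescu_on (mu : probability R R) (phi : C -> C) (a M b N : R) : Prop :=
  [/\ 0 < a, 0 < M, 0 < b, 0 < N &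
      (forall z1 z2, Gamma a M z1 -> Gamma a M z2 -> Ftr mu z1 = Ftr mu z2 -> z1 = z2) /\
      (forall w, Gamma b N w -> Gamma a M (w + phi w) /\ Ftr mu (w + phi w) = w)].

Definition free_conv (mu nu rho : probability R R) : Prop :=
  exists (phm phn phr : C -> C) (b N : R),
    [/\ (exists a M, voiculescu_on mu phm a M b N),
        (exists a M, voiculescu_on nu phn a M b N),
        (exists a M, voiculescu_on rho phr a M b N)
      & forall w, Gamma b N w -> phr w = phm w + phn w].

Definition free_power (nu : probability R R) (n : nat) (rho : probability R R) : Prop :=
  exists (phn phr : C -> C) (b N : R),
    [/\ (exists a M, voiculescu_on nu phn a M b N),
        (exists a M, voiculescu_on rho phr a M b N)
      & forall w, Gamma b N w -> phr w = n%:R * phn w].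

Definition free_inf_div (mu : probability R R) : Prop :=
  forall n : nat, (0 < n)%N -> exists nu : probability R R, free_power nu n mu.

Definition holomorphic_UHP (f : C -> C) : Prop :=
  forall z, UHP z -> exists l : C, forall e : R, 0 < e ->
    exists d : R, 0 < d /\
      forall h : C, 0 < cabs h -> cabs h < d -> cabs ((f (z + h) - f z) / h - l) < e.

Definition cone_at (x c : R) (z : C) : Prop := UHP z /\ `|ReC z - x| < c * ImC z.
Definition cone_inf (c : R) (z : C) : Prop := UHP z /\ `|ReC z| < c * ImC z.

Definition ntlim_at (f : C -> C) (x : R) (L : C) : Prop :=
  forall c : R, 0 < c -> forall e : R, 0 < e -> exists d : R, 0 < d /\
    forall z, cone_at x c z -> cabs (z - ofR x) < d -> cabs (f z - L) < e.

Definition ntlim_at_infty (f : C -> C) (x : R) : Prop :=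
  forall c : R, 0 < c -> forall K : R, exists d : R, 0 < d /\
    forall z, cone_at x c z -> cabs (z - ofR x) < d -> K < cabs (f z).

Definition ntlim_inf (f : C -> C) (L : C) : Prop :=
  forall c : R, 0 < c -> forall e : R, 0 < e -> exists M : R,
    forall z, cone_inf c z -> M < cabs z -> cabs (f z - L) < e.

Definition ntlim_inf_infty (f : C -> C) : Prop :=
  forall c : R, 0 < c -> forall K : R, exists M : R,
    forall z, cone_inf c z -> M < cabs z -> K < cabs (f z).

(* points of C u {oo}: Some a = a in C, None = oo *)
Definition seq_conv_ext (u : nat -> C) (w : option C) : Prop :=
  match w with
  | Some L => forall e : R, 0 < e -> exists N, forall n, (N <= n)%N -> cabs (u n - L) < e
  | None => forall K : R, exists N, forall n, (N <= n)%N -> K < cabs (u n)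
  end.

Definition nt_limit_points_inf (f : C -> C) (w : option C) : Prop :=
  exists c : R, 0 < c /\ exists zs : nat -> C,
    [/\ forall n, cone_inf c (zs n), seq_conv_ext zs None & seq_conv_ext (f \o zs) w].

Definition sphere_closure (S : option C -> Prop) (w : option C) : Prop :=
  match w with
  | Some a => forall e : R, 0 < e -> exists b, S (Some b) /\ cabs (b - a) < e
  | None => forall K : R, S None \/ exists b, S (Some b) /\ K < cabs b
  end.

Definition nt_cluster_inf (f : C -> C) : option C -> Prop :=
  sphere_closure (nt_limit_points_inf f).

Definition real_analytic (p : R -> R) : Prop :=
  forall x0 : R, exists r : R, 0 < r /\ exists a : nat -> R,
    forall x : R, `|x - x0| < r ->
      (fun n => \sum_(0 <= k < n) a k * (x - x0) ^+ k) @ \oo --> p x.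

End FreeDefs.

(* Main.v *)
Require Import Defs.
From HB Require Import structures.
From mathcomp Require Import all_boot all_order all_algebra.
From mathcomp Require Import all_classical all_reals all_analysis.
From mathcomp Require Import complex.
From mathcomp Require Import measurable_realfun ring lra.
Set Implicit Arguments.
Unset Strict Implicit.
Unset Printing Implicit Defensive.
Import Order.TTheory GRing.Theory Num.Theory.
Import numFieldNormedType.Exports.
Local Open Scope classical_set_scope.
Local Open Scope ring_scope.

(** Write F and G for the reciprocal Cauchy and the Cauchy transforms.  Near
    infinity, and hence on the whole upper half-plane, F_rho = F_nu o omega
    with omega(z) = z - phi(F_rho(z)), so that K(q) := q + phi(F_nu(q)) is a
    left inverse of omega.

    Fix x real and let z tend to x vertically.  If F_rho(z) and omega(z) only
    accumulated at boundary points w and v of the Riemann sphere, then the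
    Schwarz-Pick inequalities for z |-> x - phi(z) (which sends F_rho(z) almost
    to omega(z)) and for F_nu (which sends omega(z) back to F_rho(z)) would
    pass to the limit as a Julia inequality, forcing x - phi to have the
    nontangential limit v at w.  This contradicts the assumptions on phi, or,
    when w = v = oo, the estimate phi(z) = o(z).  So K(q) = x for some q in
    the open half-plane.

    Schwarz-Pick also shows that K is injective on the preimage of the open
    half-plane and that K'(q) <> 0.  Hence omega, and with it
    G_rho = G_nu o omega, extends analytically across x with Im G_rho(x) < 0,
    and Stieltjes inversion identifies - Im G_rho / pi as the density of rho.

    The function theory rests on a Cauchy formula obtained by applying
    Goursat's lemma in logarithmic coordinates: circle means of functions
    holomorphic on an annulus do not depend on the radius. *)

(** * Complex numbers and complex differentiability *)

Section ComplexBasics.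
Variable R : realType.
Local Notation C := R[i].
Implicit Types (z w h : C) (f g : C -> C) (x y t e d : R).

(** The limits of F_rho and omega at x are not known to exist beforehand, so the argument follows
    sequences in the Riemann sphere and an exact fixed-point relation takes the place of boundary
    theory. Put psi(z) = x - phi(z), z_n = x + i y_n, p_n = F_rho(z_n) and q_n = omega(z_n); then
    q_n = psi(p_n) + i y_n and F_nu(q_n) = p_n. The second relation bounds the normalised ratio Im
    q_n / Im p_n; the first converts this bound into the Julia inequality for psi. Since v is real
    or infinite, phi acquires at w a limit that is real or infinite, which is what the assumptions
    exclude. Only w = v = oo escapes them, because 2(i) allows the limit oo there.

    The continuation is carried out on K rather than on omega: K is already holomorphic around the
    interior point q, so inverting it there demands no regularity of omega at the boundary. *)

Lemma normcE z : `|z| = (cabs z)%:C%C.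
Proof. by case: z. Qed.

Lemma cabs_ge0 z : 0 <= cabs z.
Proof. exact: sqrtr_ge0. Qed.

Lemma cabsM z w : cabs (z * w) = cabs z * cabs w.
Proof. by apply: complexI; rewrite -normcE normrM !normcE rmorphM. Qed.

Lemma cabsN z : cabs (- z) = cabs z.
Proof. by apply: complexI; rewrite -!normcE normrN. Qed.

Lemma cabsBC z w : cabs (z - w) = cabs (w - z).
Proof. by rewrite -cabsN opprB. Qed.

Lemma cabsD z w : cabs (z + w) <= cabs z + cabs w.
Proof. by rewrite -lecR rmorphD /= -!normcE ler_normD. Qed.

Lemma cabsB z w : cabs (z - w) <= cabs z + cabs w.
Proof. by rewrite -(cabsN w) cabsD. Qed.

Lemma cabs_tri z w u : cabs (z - u) <= cabs (z - w) + cabs (w - u).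
Proof. by rewrite -(subrKA w) cabsD. Qed.

Lemma cabs0 : cabs (0 : C) = 0.
Proof. by rewrite /cabs /= expr0n /= addr0 sqrtr0. Qed.

Lemma cabs1 : cabs (1 : C) = 1.
Proof. by rewrite /cabs /= expr0n /= addr0 expr1n sqrtr1. Qed.

Lemma cabs_eq0 z : (cabs z == 0) = (z == 0).
Proof. by rewrite -(inj_eq (@complexI R)) -normcE normr_eq0. Qed.

Lemma cabs_gt0 z : (0 < cabs z) = (z != 0).
Proof. by rewrite lt_def cabs_ge0 andbT cabs_eq0. Qed.

Lemma cabsV z : cabs z^-1 = (cabs z)^-1.
Proof. by apply: complexI; rewrite -normcE normfV !normcE fmorphV. Qed.

Lemma cabsX z n : cabs (z ^+ n) = cabs z ^+ n.
Proof. by elim: n => [|n IH]; rewrite ?expr0 ?cabs1 // !exprS cabsM IH. Qed.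

Lemma cabs_ofR x : cabs (ofR x) = `|x|.
Proof. by rewrite /cabs /= expr0n /= addr0 sqrtr_sqr. Qed.

Lemma cabs_sqr z : cabs z ^+ 2 = ReC z ^+ 2 + ImC z ^+ 2.
Proof. by rewrite sqr_sqrtr // addr_ge0 // sqr_ge0. Qed.

Lemma ReC_le z : `|ReC z| <= cabs z.
Proof. by rewrite -sqrtr_sqr ler_wsqrtr // lerDl sqr_ge0. Qed.

Lemma ImC_le z : `|ImC z| <= cabs z.
Proof. by rewrite -sqrtr_sqr ler_wsqrtr // lerDr sqr_ge0. Qed.

Lemma cabs_le z : cabs z <= `|ReC z| + `|ImC z|.
Proof.
rewrite -[leRHS]ger0_norm ?addr_ge0// -sqrtr_sqr ler_wsqrtr//.
have := real_normK (num_real (ReC z)); have := real_normK (num_real (ImC z)).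
by have := mulr_ge0 (normr_ge0 (ReC z)) (normr_ge0 (ImC z)); nra.
Qed.

Lemma cabs_dist z w : `|cabs z - cabs w| <= cabs (z - w).
Proof.
rewrite ler_norml; apply/andP; split.
  by have := cabsD (w - z) z; rewrite subrK cabsBC; lra.
by have := cabsD (z - w) w; rewrite subrK; lra.
Qed.

Lemma cle_dist z w : cabs z - cabs w <= cabs (z - w).
Proof. exact: le_trans (ler_norm _) (cabs_dist _ _). Qed.

Lemma ReCD z w : ReC (z + w) = ReC z + ReC w. Proof. by case: z w => ? ? []. Qed.
Lemma ImCD z w : ImC (z + w) = ImC z + ImC w. Proof. by case: z w => ? ? []. Qed.
Lemma ReCN z : ReC (- z) = - ReC z. Proof. by case: z. Qed.
Lemma ImCN z : ImC (- z) = - ImC z. Proof. by case: z. Qed.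
Lemma ReCB z w : ReC (z - w) = ReC z - ReC w. Proof. by rewrite ReCD ReCN. Qed.
Lemma ImCB z w : ImC (z - w) = ImC z - ImC w. Proof. by rewrite ImCD ImCN. Qed.
Lemma ReCM z w : ReC (z * w) = ReC z * ReC w - ImC z * ImC w.
Proof. by case: z w => ? ? []. Qed.
Lemma ImCM z w : ImC (z * w) = ReC z * ImC w + ImC z * ReC w.
Proof. by case: z w => ? ? []. Qed.
Lemma ImCV z : ImC z^-1 = - ImC z / cabs z ^+ 2.
Proof. by rewrite cabs_sqr; case: z => a b /=; rewrite mulNr. Qed.

Lemma complex_eqP z w : ReC z = ReC w -> ImC z = ImC w -> z = w.
Proof. by case: z w => a b [c d] /= -> ->. Qed.

Lemma Re_ofR x : ReC (ofR x) = x. Proof. by []. Qed.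
Lemma Im_ofR x : ImC (ofR x) = 0. Proof. by []. Qed.
Lemma ofRD x y : ofR (x + y) = ofR x + ofR y.
Proof. exact: (rmorphD (real_complex R)). Qed.
Lemma ofRB x y : ofR (x - y) = ofR x - ofR y.
Proof. exact: (rmorphB (real_complex R)). Qed.
Lemma ofRM x y : ofR (x * y) = ofR x * ofR y.
Proof. exact: (rmorphM (real_complex R)). Qed.
Lemma ofRX x n : ofR (x ^+ n) = ofR x ^+ n.
Proof. exact: (rmorphXn (real_complex R)). Qed.
Lemma ofR_eq0 x : (ofR x == 0) = (x == 0).
Proof. by rewrite -cabs_eq0 cabs_ofR normr_eq0. Qed.

Lemma UHP_neq0 z : UHP z -> z != 0.
Proof. by rewrite /UHP; apply: contraTneq => ->; rewrite ltxx. Qed.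

Definition ccont f z := forall e : R, 0 < e ->
  exists2 d : R, 0 < d & forall w, cabs (w - z) < d -> cabs (f w - f z) < e.

Lemma ccont_cst (c : C) z : ccont (fun=> c) z.
Proof. by move=> e e0; exists 1 => // w _; rewrite subrr cabs0. Qed.

Lemma ccont_id z : ccont id z.
Proof. by move=> e e0; exists e. Qed.

Lemma ccontD f g z : ccont f z -> ccont g z -> ccont (fun w => f w + g w) z.
Proof.
move=> fc gc e e0; have e2 : 0 < e / 2 by lra.
have [d1 d10 h1] := fc _ e2; have [d2 d20 h2] := gc _ e2.
exists (Num.min d1 d2); first by rewrite lt_min d10.
move=> w; rewrite lt_min => /andP[/h1 k1 /h2 k2].
rewrite opprD addrACA (le_lt_trans (cabsD _ _))//; lra.
Qed.

Lemma ccontN f z : ccont f z -> ccont (fun w => - f w) z.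
Proof.
move=> fc e /fc[d d0 h]; exists d => // w /h.
by rewrite -opprD cabsN.
Qed.

Lemma ccontB f g z : ccont f z -> ccont g z -> ccont (fun w => f w - g w) z.
Proof. by move=> fc gc; apply: ccontD => //; exact: ccontN. Qed.

Lemma ccontM f g z : ccont f z -> ccont g z -> ccont (fun w => f w * g w) z.
Proof.
move=> fc gc e e0.
set A := cabs (f z) + 1; set B := cabs (g z) + 1.
have A0 : 0 < A by rewrite ltr_wpDl ?cabs_ge0.
have B0 : 0 < B by rewrite ltr_wpDl ?cabs_ge0.
pose e1 := Num.min 1 (e / (2 * B)); pose e2 := e / (2 * A).
have e10 : 0 < e1 by rewrite lt_min ltr01 divr_gt0// mulr_gt0.
have e20 : 0 < e2 by rewrite divr_gt0// mulr_gt0.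
have [d1 d10 h1] := fc _ e10; have [d2 d20 h2] := gc _ e20.
exists (Num.min d1 d2); first by rewrite lt_min d10.
move=> w; rewrite lt_min => /andP[/h1 k1 /h2 k2].
rewrite (_ : _ - _ = (f w - f z) * g z + f w * (g w - g z)); last by ring.
apply: le_lt_trans (cabsD _ _) _; rewrite !cabsM.
move: k1; rewrite lt_min => /andP[k1 k1'].
have fwA : cabs (f w) <= A by have := cle_dist (f w) (f z); rewrite /A; lra.
have l1 : cabs (f w - f z) * cabs (g z) <= e / (2 * B) * cabs (g z).
  by rewrite ler_wpM2r ?cabs_ge0// ltW.
have l2 : e / (2 * B) * cabs (g z) < e / 2.
  rewrite (_ : e / 2 = e / (2 * B) * B); last by field; rewrite gt_eqF.
  by rewrite ltr_pM2l ?divr_gt0 ?mulr_gt0// /B; lra.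
have l3 : cabs (f w) * cabs (g w - g z) <= A * e2.
  by rewrite ler_pM ?cabs_ge0// ltW.
have l4 : A * e2 = e / 2 by rewrite /e2; field; rewrite gt_eqF.
lra.
Qed.

Lemma ccont_eq f g z : (exists2 d : R, 0 < d & forall w, cabs (w - z) < d -> f w = g w) ->
  ccont f z -> ccont g z.
Proof.
move=> [d d0 fg] fc e /fc[d1 d10 h].
exists (Num.min d d1); first by rewrite lt_min d0.
move=> w; rewrite lt_min => /andP[wd /h]; rewrite !fg//.
by rewrite subrr cabs0.
Qed.

Lemma ccont_neq0 f z : ccont f z -> f z != 0 ->
  exists2 d : R, 0 < d & forall w, cabs (w - z) < d -> cabs (f z) / 2 <= cabs (f w).
Proof.
move=> fc fz0; have fz : 0 < cabs (f z) / 2 by rewrite divr_gt0// cabs_gt0.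
have [d d0 h] := fc _ fz; exists d => // w /h k.
by have := cle_dist (f z) (f w); rewrite cabsBC; lra.
Qed.

Lemma ccontV f z : f z != 0 -> ccont f z -> ccont (fun w => (f w)^-1) z.
Proof.
move=> fz0 fc e e0; have [d1 d10 h1] := ccont_neq0 fc fz0.
have F0 : 0 < cabs (f z) by rewrite cabs_gt0.
have e20 : 0 < e * (cabs (f z) ^+ 2 / 2) by rewrite !mulr_gt0// invr_gt0.
have [d2 d20 h2] := fc _ e20.
exists (Num.min d1 d2); first by rewrite lt_min d10.
move=> w; rewrite lt_min => /andP[/h1 k1 /h2 k2].
have Fw0 : 0 < cabs (f w) by apply: lt_le_trans k1; lra.
have fw0 : f w != 0 by rewrite -cabs_gt0.
rewrite (_ : _ - _ = (f z - f w) / (f w * f z)); last by field; rewrite fz0.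
rewrite cabsM cabsV cabsM cabsBC ltr_pdivrMr ?mulr_gt0//.
apply: lt_le_trans k2 _; rewrite ler_wpM2l ?(ltW e0)//.
by have := ler_wpM2r (ltW F0) k1; rewrite mulrAC -expr2.
Qed.

Lemma ccont_comp f g z : ccont g z -> ccont f (g z) -> ccont (fun w => f (g w)) z.
Proof. by move=> gc fc e /fc[d /gc[d' d'0 h'] h]; exists d' => // w /h'/h. Qed.

Definition rcont (f : R -> C) t := forall e : R, 0 < e ->
  exists2 d : R, 0 < d & forall s, `|s - t| < d -> cabs (f s - f t) < e.

Lemma rcont_comp f (g : R -> C) t : rcont g t -> ccont f (g t) -> rcont (fun s => f (g s)) t.
Proof. by move=> gc fc e /fc[d /gc[d' d'0 h'] h]; exists d' => // w /h'/h. Qed.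

Lemma rcontP (f : R -> C) t : rcont f t <->
  {for t, continuous (fun s => ReC (f s))} /\ {for t, continuous (fun s => ImC (f s))}.
Proof.
split.
  move=> fc; split; apply/cvgrPdist_lt => e /fc[d d0 h];
  apply/nbhs_normP; exists d => //= s st; (have k : cabs (f s - f t) < e by apply: h; rewrite distrC).
    by rewrite distrC -ReCB; exact: le_lt_trans (ReC_le _) k.
  by rewrite distrC -ImCB; exact: le_lt_trans (ImC_le _) k.
move=> [/cvgrPdist_lt h1 /cvgrPdist_lt h2] e e0; have e2 : 0 < e / 2 by lra.
have /nbhs_normP[/= d1 d10 k1] := h1 _ e2; have /nbhs_normP[/= d2 d20 k2] := h2 _ e2.
exists (Num.min d1 d2); first by rewrite lt_min d10.
move=> s; rewrite lt_min distrC => /andP[/k1/= l1 /k2/= l2].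
apply: le_lt_trans (cabs_le _) _; rewrite ReCB ImCB distrC [X in _ + X]distrC; lra.
Qed.

Lemma rcont_ofR t : rcont (@ofR R) t.
Proof. by move=> e e0; exists e => // s; rewrite -ofRB cabs_ofR. Qed.

(* Caratheodory's form of complex differentiability: the value [g z] is the derivative. *)
Definition cdiff f z := exists g, ccont g z /\ forall w, f w = f z + g w * (w - z).

Lemma cdiff_cont f z : cdiff f z -> ccont f z.
Proof.
move=> [g [gc fE]].
have -> : f = (fun w => f z + g w * (w - z)) by apply/funext => w; exact: fE.
by apply: ccontD; [exact: ccont_cst|apply: ccontM => //; apply: ccontB; [exact: ccont_id|exact: ccont_cst]].
Qed.

Lemma cdiff_cst (c : C) z : cdiff (fun=> c) z.
Proof. by exists (fun=> 0); split; [exact: ccont_cst|move=> w; rewrite mul0r addr0]. Qed.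

Lemma cdiff_id z : cdiff id z.
Proof. by exists (fun=> 1); split; [exact: ccont_cst|move=> w; rewrite mul1r addrC subrK]. Qed.

Lemma cdiffD f g z : cdiff f z -> cdiff g z -> cdiff (fun w => f w + g w) z.
Proof.
move=> [f' [f'c fE]] [g' [g'c gE]]; exists (fun w => f' w + g' w).
split; first exact: ccontD.
by move=> w; rewrite fE gE; ring.
Qed.

Lemma cdiffN f z : cdiff f z -> cdiff (fun w => - f w) z.
Proof.
move=> [f' [f'c fE]]; exists (fun w => - f' w).
by split; [exact: ccontN|move=> w; rewrite fE; ring].
Qed.

Lemma cdiffB f g z : cdiff f z -> cdiff g z -> cdiff (fun w => f w - g w) z.
Proof. by move=> fz gz; apply: cdiffD => //; exact: cdiffN. Qed.

Lemma cdiffM f g z : cdiff f z -> cdiff g z -> cdiff (fun w => f w * g w) z.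
Proof.
move=> fz gz; have gc := cdiff_cont gz.
move: fz gz => [f' [f'c fE]] [g' [g'c gE]]; exists (fun w => f' w * g w + f z * g' w).
split; first by apply: ccontD; apply: ccontM => //; exact: ccont_cst.
by move=> w; rewrite fE [g w]gE; ring.
Qed.

Lemma cdiffV f z : f z != 0 -> cdiff f z -> cdiff (fun w => (f w)^-1) z.
Proof.
move=> fz0 fd; have fc := cdiff_cont fd; move: fd => [f' [f'c fE]].
(* Carathéodory's slope must satisfy its equation at every [w], also at zeros of [f], where
   [(f w)^-1] is [0] by convention and the slope has to be adjusted accordingly. *)
exists (fun w => if f w == 0 then (if w == z then 0 else - (f z)^-1 / (w - z)) else - f' w / (f w * f z)); split; last first.
  move=> w; case: ifPn => [/eqP fw0|fw0].
    have wz : w != z by apply: contraNneq fz0 => <-; rewrite fw0.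
    by rewrite (negbTE wz) fw0 invr0 divfK ?subr_eq0// subrr.
  have k : f' w * (w - z) = f w - f z by rewrite [f w]fE; ring.
  rewrite mulrAC mulNr k; move: (f w) (f z) fw0 fz0 => a b a0 b0.
  by field; rewrite a0 b0.
apply: (@ccont_eq (fun w => - f' w / (f w * f z))).
  have [d d0 h] := ccont_neq0 fc fz0; exists d => // w /h k.
  rewrite ifN// -cabs_gt0 (lt_le_trans _ k)// divr_gt0// cabs_gt0//.
apply: ccontM; first exact: ccontN.
by apply: ccontV; [rewrite mulf_neq0|apply: ccontM => //; exact: ccont_cst].
Qed.

Lemma cdiff_div f g z : g z != 0 -> cdiff f z -> cdiff g z -> cdiff (fun w => f w / g w) z.
Proof. by move=> g0 fz gz; apply: cdiffM => //; exact: cdiffV. Qed.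

Lemma cdiff_comp f g z : cdiff g z -> cdiff f (g z) -> cdiff (fun w => f (g w)) z.
Proof.
move=> gd; have gc := cdiff_cont gd; move: gd => [g' [g'c gE]] [f' [f'c fE]].
exists (fun w => f' (g w) * g' w); split.
  by apply: ccontM => //; apply: ccont_comp.
by move=> w; rewrite fE {2}[g w]gE; ring.
Qed.

Lemma cdiffX f n z : cdiff f z -> cdiff (fun w => f w ^+ n) z.
Proof.
move=> fz; elim: n => [|n IH]; first exact: cdiff_cst.
rewrite (_ : (fun w => f w ^+ n.+1) = (fun w => f w * f w ^+ n)).
  exact: cdiffM.
by apply/funext => w; rewrite exprS.
Qed.

(** The equation in [cdiff] is global although differentiability is local, so the slope of [g] is
    rebuilt as its difference quotient away from [z]. *)
Lemma cdiff_near f g z : (exists2 d : R, 0 < d & forall w, cabs (w - z) < d -> f w = g w) -> cdiff f z -> cdiff g z.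
Proof.
move=> fg [f' [f'c fE]]; have fgz : f z = g z by case: fg => d d0; apply; rewrite subrr cabs0.
exists (fun w => if w == z then f' z else (g w - g z) / (w - z)); split; last first.
  move=> w; case: eqVneq => [->|wz]; first by rewrite subrr mulr0 addr0.
  by rewrite divfK ?subr_eq0// addrC subrK.
apply: ccont_eq f'c; case: fg => d d0 fg; exists d => // w /fg fgw.
case: eqVneq => [->//|wz].
by rewrite -fgw -fgz fE addrAC subrr add0r mulfK ?subr_eq0.
Qed.

Lemma cdiffP f z : cdiff f z <-> exists l : C, forall e : R, 0 < e ->
    exists d : R, 0 < d /\
      forall h : C, 0 < cabs h -> cabs h < d -> cabs ((f (z + h) - f z) / h - l) < e.
Proof.
split.
  move=> [f' [f'c fE]]; exists (f' z) => e e0.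
  have [d d0 dP] := f'c _ e0; exists d; split => // h h0 hd.
  rewrite [f (z + h)]fE addrAC subrr add0r (_ : z + h - z = h); last by ring.
  by rewrite mulfK -?cabs_gt0//; apply: dP; rewrite (_ : z + h - z = h); last by ring.
move=> [l H]; exists (fun w => if w == z then l else (f w - f z) / (w - z)); split; last first.
  move=> w; case: eqVneq => [->|wz]; first by rewrite subrr mulr0 addr0.
  by rewrite divfK ?subr_eq0// addrC subrK.
move=> e e0; have [d [d0 dP]] := H _ e0; exists d => // w wd.
rewrite eqxx; case: eqVneq => [_|wz]; first by rewrite subrr cabs0.
have := dP (w - z); rewrite cabs_gt0 subr_eq0 wz (_ : z + (w - z) = w); [exact|ring].
Qed.


(** Compactness of a square in the real plane, transported to complex numbers through real and
    imaginary parts. The filter form serves both [complex_EVT] and [complex_BW]. *)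
Lemma cluster_complex (F : set_system C) (B : R) : ProperFilter F ->
  F [set z | cabs z <= B] ->
  exists l : C, forall (e : R) (A : set C), 0 < e -> F A -> exists2 z, A z & cabs (z - l) < e.
Proof.
move=> FF FB; pose G := (fun z : C => (ReC z, ImC z)) @ F.
have /(_ G) [] : compact (`[- B, B]%classic `*` `[- B, B]%classic : set (R * R)).
- by apply: compact_setX; exact: segment_compact.
- rewrite /G /=; apply: filterS FB => z /= zB; split; rewrite /= in_itv /= -ler_norml.
    exact: le_trans (ReC_le _) zB.
  exact: le_trans (ImC_le _) zB.
move=> [a b] [_ cl]; exists (complex.Complex a b) => e A e0 FA.
have e2 : 0 < e / 2 by lra.
have := cl (fun p => exists2 z, A z & p = (ReC z, ImC z))
  [set p | `|a - p.1| < e / 2 /\ `|b - p.2| < e / 2].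
case.
- by rewrite /G /=; apply: filterS FA => z Az; exists z.
- exists ([set x | `|a - x| < e / 2], [set x | `|b - x| < e / 2]) => //=.
  by split; apply/nbhs_normP; exists (e / 2).
- move=> p [[z Az ->] /= [h1 h2]]; exists z => //.
  apply: le_lt_trans (cabs_le _) _; rewrite ReCB ImCB /= distrC [X in _ + X]distrC; lra.
Qed.

Lemma complex_EVT (K : set C) (f : C -> R) (B : R) :
  K !=set0 -> (forall z, K z -> cabs z <= B) ->
  (forall z, (forall e : R, 0 < e -> exists2 w, K w & cabs (w - z) < e) -> K z) ->
  (forall z, K z -> forall e : R, 0 < e -> exists2 d : R, 0 < d &
     forall w, K w -> cabs (w - z) < d -> `|f w - f z| < e) ->
  exists2 z, K z & forall w, K w -> f w <= f z.
Proof.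
move=> [z0 Kz0] KB Kc fc.
(* The superlevel sets of [f] in [K] form a filter base, and [f] is maximal at any of its cluster
   points. *)
pose F := filter_from K (fun w => [set z | K z /\ f w <= f z]).
have FF : ProperFilter F.
  apply: filter_from_proper; last by move=> w Kw; exists w.
  apply: filter_from_filter; first by exists z0.
  move=> a b Ka Kb; exists (if f a <= f b then b else a); first by case: ifP.
  move=> z [Kz]; case: (lerP (f a) (f b)) => ab h; split; split => //; first exact: le_trans ab h.
  exact: le_trans (ltW ab) h.
have [] := @cluster_complex F B FF.
  by exists z0 => // z [Kz _]; exact: KB.
move=> l H; have Kl : K l.
  apply: Kc => e e0; have [|z [Kz _] zl] := H e [set z | K z /\ f z0 <= f z] e0; first by exists z0.
  by exists z.
exists l => // w Kw; rewrite leNgt; apply/negP => lw.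
have [d d0 dP] := fc _ Kl (f w - f l) ltac:(lra).
have [|z [Kz wz] zl] := H d [set z | K z /\ f w <= f z] d0; first by exists w.
by have := dP _ Kz zl; rewrite ltr_norml; lra.
Qed.

(** The index map only satisfies [n <= s n] instead of being increasing; this is enough to preserve
    limits. *)
Lemma complex_BW (u : nat -> C) (B : R) : (forall n, cabs (u n) <= B) ->
  exists l : C, exists2 s : nat -> nat, (forall n, (n <= s n)%N) &
    forall e : R, 0 < e -> exists N, forall n, (N <= n)%N -> cabs (u (s n) - l) < e.
Proof.
move=> uB; have [] := @cluster_complex (u @ \oo) B _.
  by exists 0%N => // n _ /=; exact: uB.
move=> l H; exists l.
have {H} H (n : nat) : exists m : nat, (n <= m)%N /\ cabs (u m - l) < n.+1%:R^-1.
  have [||_ [m nm <-] h] := H n.+1%:R^-1 (u @` [set m | (n <= m)%N]).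
  - by rewrite invr_gt0.
  - by exists n => // m nm /=; exists m.
  - by exists m.
have [s sP] := choice H; exists s => [n|e e0]; first by have [] := sP n.
exists (Num.truncn e^-1) => n nN; have [_ h] := sP n; apply: lt_trans h _.
rewrite -[ltRHS]invrK ltf_pV2 ?posrE ?invr_gt0 ?ltr0n//.
by apply: lt_le_trans (truncnS_gt _) _; rewrite ler_nat.
Qed.

End ComplexBasics.

(** * Integrals over segments *)

Section PathIntegral.
Variable R : realType.
Local Notation C := R[i].
Local Notation leb := (@lebesgue_measure R).

Definition rint (f : R -> R) (a b : R) : R := \int[leb]_(t in `[a, b]) f t.

(** Continuity is two-sided even at the end points, which lets compositions with complex functions
    be handled pointwise, without subspace topologies. *)
Definition segcont (f : R -> R) (a b : R) := forall t, a <= t <= b -> {for t, continuous f}.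

Lemma segcont_within f a b : segcont f a b -> {within `[a, b], continuous f}.
Proof. by move=> fc; apply: continuous_subspace_itv => t; rewrite in_itv; exact: fc. Qed.

Lemma segcont_integrable f a b : segcont f a b ->
  leb.-integrable `[a, b] (EFin \o f).
Proof.
move=> fc; apply: continuous_compact_integrable; first exact: segment_compact.
exact: segcont_within.
Qed.

Lemma segcontZ f k a b : segcont f a b -> segcont (fun t => k * f t) a b.
Proof. by move=> fc t tab; apply: cvgM; [exact: cvg_cst|exact: fc]. Qed.

Lemma rintD f g a b : segcont f a b -> segcont g a b ->
  rint (fun t => f t + g t) a b = rint f a b + rint g a b.
Proof. by move=> fc gc; rewrite /rint RintegralD//; exact: segcont_integrable. Qed.

Lemma rintZ f k a b : segcont f a b -> rint (fun t => k * f t) a b = k * rint f a b.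
Proof. by move=> fc; rewrite /rint RintegralZl//; exact: segcont_integrable. Qed.

Lemma rint_eq f g a b : (forall t, a <= t <= b -> f t = g t) -> rint f a b = rint g a b.
Proof. by move=> fg; apply: eq_Rintegral => t; rewrite inE /= in_itv => /fg. Qed.

Lemma rint_cst k a b : a <= b -> rint (fun=> k) a b = k * (b - a).
Proof.
move=> ab; rewrite /rint Rintegral_cst//= lebesgue_measure_itv/= lte_fin.
by move: ab; rewrite le_eqVlt => /predU1P[->|ab]; rewrite ?ltxx ?subrr// ab.
Qed.

Lemma rint_le f g a b : segcont f a b -> segcont g a b ->
  (forall t, a <= t <= b -> f t <= g t) -> rint f a b <= rint g a b.
Proof.
move=> fc gc fg; apply: le_Rintegral => //; try exact: segcont_integrable.
Qed.

Lemma rint_bound f a b B : a <= b -> segcont f a b ->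
  (forall t, a <= t <= b -> `|f t| <= B) -> `|rint f a b| <= B * (b - a).
Proof.
move=> ab fc fB; rewrite ler_norml -mulNr -!rint_cst//.
by apply/andP; split; apply: rint_le => // t; try (by move=> _; exact: cvg_cst);
  move=> /fB; rewrite ler_norml => /andP[].
Qed.

Lemma rint_split f a c b : a <= c <= b -> segcont f a b ->
  rint f a b = rint f a c + rint f c b.
Proof.
move=> /andP[ac cb] fc; rewrite /rint.
have := @Rintegral_itvB R f (BLeft a) (BRight b) c (segcont_integrable fc).
rewrite !bnd_simp => /(_ ac cb) /eqP; rewrite subr_eq addrC => /eqP ->.
congr (_ + _); rewrite Rintegral_itv_obnd_cbnd//.
apply: integrableS (segcont_integrable fc) => //.
by move=> t /=; rewrite !in_itv /= => /andP[ct ->]; rewrite (le_trans ac (ltW ct)).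
Qed.

Lemma rint_id a b : a <= b -> rint id a b = (b ^+ 2 - a ^+ 2) / 2.
Proof.
rewrite le_eqVlt => /predU1P[->|ab].
  by rewrite /rint set_itv1 Rintegral_set1 subrr mul0r.
have h := @continuous_FTC2 R id (fun t => t ^+ 2 / 2) a b ab.
rewrite /rint /Rintegral h//.
- by rewrite -EFinB /= mulrBl.
- by apply: continuous_subspaceT => x; exact: cvg_id.
- have der (x : R) : is_derive x 1 (fun t : R => t ^+ 2 / 2) x.
    by apply: is_derive_eq; rewrite /GRing.scale /=; lra.
  split.
  - by move=> x _; have [] := der x.
  - by apply: cvg_at_right_filter; apply: cvgM; [exact: exprn_continuous|exact: cvg_cst].
  - by apply: cvg_at_left_filter; apply: cvgM; [exact: exprn_continuous|exact: cvg_cst].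
- have der (x : R) : is_derive x 1 (fun t : R => t ^+ 2 / 2) x.
    by apply: is_derive_eq; rewrite /GRing.scale /=; lra.
  by move=> x _; rewrite derive1E derive_val.
Qed.

Definition cint (f : R -> C) (a b : R) : C :=
  complex.Complex (rint (fun t => ReC (f t)) a b) (rint (fun t => ImC (f t)) a b).

Definition csegcont (f : R -> C) (a b : R) := forall t, a <= t <= b -> rcont f t.

Lemma csegcont_Re f a b : csegcont f a b -> segcont (fun t => ReC (f t)) a b.
Proof. by move=> fc t /fc /rcontP[]. Qed.

Lemma csegcont_Im f a b : csegcont f a b -> segcont (fun t => ImC (f t)) a b.
Proof. by move=> fc t /fc /rcontP[]. Qed.

Lemma cint_eq f g a b : (forall t, a <= t <= b -> f t = g t) -> cint f a b = cint g a b.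
Proof. by move=> fg; congr complex.Complex; apply: rint_eq => t /fg ->. Qed.

Lemma cintD f g a b : csegcont f a b -> csegcont g a b ->
  cint (fun t => f t + g t) a b = cint f a b + cint g a b.
Proof.
move=> fc gc; apply: complex_eqP; rewrite /= -rintD ?(ReCD, ImCD);
  try exact: csegcont_Re; try exact: csegcont_Im.
  by apply: rint_eq => t _; rewrite ReCD.
by apply: rint_eq => t _; rewrite ImCD.
Qed.

Lemma cintZ f (k : C) a b : csegcont f a b -> cint (fun t => k * f t) a b = k * cint f a b.
Proof.
move=> fc; have cR := csegcont_Re fc; have cI := csegcont_Im fc.
apply: complex_eqP; [rewrite [RHS]ReCM /=|rewrite [RHS]ImCM /=].
  rewrite -!rintZ// -mulN1r -rintZ; last exact: segcontZ.
  rewrite -rintD; [|exact: segcontZ|by do 2 apply: segcontZ].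
  by apply: rint_eq => t _; rewrite ReCM mulN1r.
rewrite -!rintZ// -rintD; [|exact: segcontZ|exact: segcontZ].
by apply: rint_eq => t _; rewrite ImCM.
Qed.

Lemma csegcontD f g a b : csegcont f a b -> csegcont g a b -> csegcont (fun t => f t + g t) a b.
Proof.
move=> fc gc t tab; apply/rcontP; have /rcontP[f1 f2] := fc _ tab; have /rcontP[g1 g2] := gc _ tab.
split.
  rewrite (_ : (fun s => ReC (f s + g s)) = (fun s => ReC (f s) + ReC (g s))); first exact: cvgD.
  by apply/funext => s; rewrite ReCD.
rewrite (_ : (fun s => ImC (f s + g s)) = (fun s => ImC (f s) + ImC (g s))); first exact: cvgD.
by apply/funext => s; rewrite ImCD.
Qed.

Lemma csegcontZ f (k : C) a b : csegcont f a b -> csegcont (fun t => k * f t) a b.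
Proof.
move=> fc t /fc h; apply: (@rcont_comp _ (fun z => k * z)) => //.
by apply: ccontM; [exact: ccont_cst|exact: ccont_id].
Qed.

Lemma csegcont_cst k a b : csegcont (fun=> k) a b.
Proof. by move=> t _ e e0; exists 1 => // s _; rewrite subrr cabs0. Qed.

Lemma cintB f g a b : csegcont f a b -> csegcont g a b ->
  cint (fun t => f t - g t) a b = cint f a b - cint g a b.
Proof.
move=> fc gc; rewrite -[- cint g a b]mulN1r -cintZ// -cintD//; last exact: csegcontZ.
by apply: cint_eq => t _; rewrite mulN1r.
Qed.

Lemma cint_cst (k : C) a b : a <= b -> cint (fun=> k) a b = k * ofR (b - a).
Proof.
by move=> ab; apply: complex_eqP; [rewrite [RHS]ReCM|rewrite [RHS]ImCM]; rewrite /= rint_cst// mulr0 ?subr0 ?add0r.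
Qed.

Lemma cint_split f a c b : a <= c <= b -> csegcont f a b ->
  cint f a b = cint f a c + cint f c b.
Proof.
move=> acb fc; rewrite /cint (rint_split acb (csegcont_Re fc)).
by rewrite (rint_split acb (csegcont_Im fc)).
Qed.

(** The factor [2] comes from estimating real and imaginary parts separately; the sharp constant
    would gain nothing, since the bound only serves quantities that tend to zero or need some finite
    constant. *)
Lemma cint_bound f a b B : a <= b -> csegcont f a b ->
  (forall t, a <= t <= b -> cabs (f t) <= B) -> cabs (cint f a b) <= 2 * B * (b - a).
Proof.
move=> ab fc fB; apply: le_trans (cabs_le _) _.
rewrite (_ : 2 * B * (b - a) = B * (b - a) + B * (b - a)); last by ring.
apply: lerD; rewrite /=; apply: rint_bound => //.
- exact: csegcont_Re.
- by move=> t /fB; apply: le_trans; exact: ReC_le.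
- exact: csegcont_Im.
- by move=> t /fB; apply: le_trans; exact: ImC_le.
Qed.

Lemma cint_id a b : a <= b -> cint (@ofR R) a b = ofR ((b ^+ 2 - a ^+ 2) / 2).
Proof.
by move=> ab; apply: complex_eqP; rewrite /= ?rint_id// rint_cst// mul0r.
Qed.

Lemma cint_affine (k l : C) a b : a <= b ->
  cint (fun t => k + l * ofR t) a b = k * ofR (b - a) + l * ofR ((b ^+ 2 - a ^+ 2) / 2).
Proof.
move=> ab; have ic : csegcont (@ofR R) a b by move=> t _; exact: rcont_ofR.
rewrite cintD; [|exact: csegcont_cst|exact: csegcontZ].
by rewrite cint_cst// cintZ// cint_id.
Qed.

End PathIntegral.

(** * Goursat's lemma on rectangles *)

Section Goursat.
Variable R : realType.
Local Notation C := R[i].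
Local Notation mk := (@complex.Complex R).
Implicit Types (H : C -> C) (x y u v : R).

Definition ic : C := mk 0 1.

(** Counterclockwise contour integral of [H] over the rectangle with lower left corner [(x, y)] and
    sides [u], [v]; on the vertical sides dz = i dt. *)
Definition rectint H x y u v : C :=
  cint (fun t => H (mk t y)) x (x + u) - cint (fun t => H (mk t (y + v))) x (x + u)
  + ic * (cint (fun t => H (mk (x + u) t)) y (y + v) - cint (fun t => H (mk x t)) y (y + v)).

Definition inrect x y u v (z : C) := x <= ReC z <= x + u /\ y <= ImC z <= y + v.

Lemma mkE x y : mk x y = ofR x + ic * ofR y.
Proof. by apply: complex_eqP; rewrite /= !(mul0r, mul1r, subr0, addr0, add0r). Qed.

Lemma rcont_mkl y t : rcont (fun s => mk s y) t.
Proof.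
move=> e e0; exists e => // s se.
by rewrite (_ : mk s y - mk t y = ofR (s - t)) ?cabs_ofR// !mkE ofRB; ring.
Qed.

Lemma cabs_ic : cabs ic = 1.
Proof. by rewrite /cabs /= expr0n expr1n add0r sqrtr1. Qed.

Lemma rcont_mkr x t : rcont (fun s => mk x s) t.
Proof.
move=> e e0; exists e => // s se.
rewrite (_ : mk x s - mk x t = ic * ofR (s - t)); last by rewrite !mkE ofRB; ring.
by rewrite cabsM cabs_ic mul1r cabs_ofR.
Qed.

Lemma hcont H x y u y' v : (forall z, inrect x y u v z -> ccont H z) -> y <= y' <= y + v ->
  csegcont (fun t => H (mk t y')) x (x + u).
Proof.
move=> Hc yy t xt; apply: rcont_comp; first exact: rcont_mkl.
by apply: Hc; split.
Qed.

Lemma vcont H x y u x' v : (forall z, inrect x y u v z -> ccont H z) -> x <= x' <= x + u ->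
  csegcont (fun t => H (mk x' t)) y (y + v).
Proof.
move=> Hc yy t xt; apply: rcont_comp; first exact: rcont_mkr.
by apply: Hc; split.
Qed.

(** Each inner side is traversed twice, in opposite directions. *)
Lemma rectint_quarter H x y u v : 0 <= u -> 0 <= v ->
  (forall z, inrect x y (u + u) (v + v) z -> ccont H z) ->
  rectint H x y (u + u) (v + v) = rectint H x y u v + rectint H (x + u) y u v
    + rectint H x (y + v) u v + rectint H (x + u) (y + v) u v.
Proof.
move=> u0 v0 Hc; rewrite /rectint.
have sx y' : y <= y' <= y + (v + v) -> cint (fun t => H (mk t y')) x (x + (u + u)) =
   cint (fun t => H (mk t y')) x (x + u) + cint (fun t => H (mk t y')) (x + u) (x + u + u).
  move=> yy; rewrite (@cint_split _ _ x (x + u) (x + (u + u))) ?addrA//; first by apply/andP; split; lra.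
  by rewrite -addrA; apply: hcont Hc yy.
have sy x' : x <= x' <= x + (u + u) -> cint (fun t => H (mk x' t)) y (y + (v + v)) =
   cint (fun t => H (mk x' t)) y (y + v) + cint (fun t => H (mk x' t)) (y + v) (y + v + v).
  move=> yy; rewrite (@cint_split _ _ y (y + v) (y + (v + v))) ?addrA//; first by apply/andP; split; lra.
  by rewrite -addrA; apply: vcont Hc yy.
rewrite !sx ?sy; try (by apply/andP; split; lra).
rewrite !addrA; do ?[move: (cint _ _ _) => ?].
by ring.
Qed.

Lemma rectintD H1 H2 x y u v : 0 <= u -> 0 <= v ->
  (forall z, inrect x y u v z -> ccont H1 z) -> (forall z, inrect x y u v z -> ccont H2 z) ->
  rectint (fun z => H1 z + H2 z) x y u v = rectint H1 x y u v + rectint H2 x y u v.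
Proof.
move=> u0 v0 c1 c2; rewrite /rectint.
have b1 : y <= y <= y + v by rewrite lexx lerDl.
have b2 : y <= y + v <= y + v by rewrite lexx lerDl v0.
have b3 : x <= x <= x + u by rewrite lexx lerDl.
have b4 : x <= x + u <= x + u by rewrite lexx lerDl u0.
rewrite !cintD; first by ring.
all: solve [exact: hcont c1 b1|exact: hcont c2 b1|exact: hcont c1 b2|exact: hcont c2 b2
  |exact: vcont c1 b3|exact: vcont c2 b3|exact: vcont c1 b4|exact: vcont c2 b4].
Qed.

Lemma rectint_affine (k l : C) x y u v : 0 <= u -> 0 <= v ->
  rectint (fun z => k + l * z) x y u v = 0.
Proof.
move=> u0 v0; rewrite /rectint.
have hE y' : cint (fun t => k + l * mk t y') x (x + u) =
   (k + l * (ic * ofR y')) * ofR u + l * ofR (((x + u) ^+ 2 - x ^+ 2) / 2).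
  rewrite (_ : ofR u = ofR (x + u - x)); last by congr ofR; ring.
  rewrite -cint_affine; last by lra.
  by apply: cint_eq => t _; rewrite mkE; ring.
have vE x' : cint (fun t => k + l * mk x' t) y (y + v) =
   (k + l * ofR x') * ofR v + (l * ic) * ofR (((y + v) ^+ 2 - y ^+ 2) / 2).
  rewrite (_ : ofR v = ofR (y + v - y)); last by congr ofR; ring.
  rewrite -cint_affine; last by lra.
  by apply: cint_eq => t _; rewrite mkE; ring.
rewrite !hE !vE !ofRD.
by ring.
Qed.

Lemma rectint_bound H x y u v B : 0 <= u -> 0 <= v ->
  (forall z, inrect x y u v z -> ccont H z) ->
  (forall z, inrect x y u v z -> cabs (H z) <= B) ->
  cabs (rectint H x y u v) <= 4 * B * (u + v).
Proof.
move=> u0 v0 Hc HB; rewrite /rectint.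
have hb y' : y <= y' <= y + v -> cabs (cint (fun t => H (mk t y')) x (x + u)) <= 2 * B * u.
  move=> yy; rewrite (_ : 2 * B * u = 2 * B * (x + u - x)); last by ring.
  apply: cint_bound; [lra|exact: hcont Hc yy|by move=> t xt; apply: HB; split].
have vb x' : x <= x' <= x + u -> cabs (cint (fun t => H (mk x' t)) y (y + v)) <= 2 * B * v.
  move=> yy; rewrite (_ : 2 * B * v = 2 * B * (y + v - y)); last by ring.
  apply: cint_bound; [lra|exact: vcont Hc yy|by move=> t xt; apply: HB; split].
apply: le_trans (cabsD _ _) _; rewrite cabsM cabs_ic mul1r.
have h1 := hb y ltac:(apply/andP; split; lra); have h2 := hb (y + v) ltac:(apply/andP; split; lra).
have h3 := vb x ltac:(apply/andP; split; lra); have h4 := vb (x + u) ltac:(apply/andP; split; lra).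
have h5 := cabsB (cint (fun t => H (mk t y)) x (x + u)) (cint (fun t => H (mk t (y + v))) x (x + u)).
have h6 := cabsB (cint (fun t => H (mk (x + u) t)) y (y + v)) (cint (fun t => H (mk x t)) y (y + v)).
lra.
Qed.

Lemma nested_point (a b : nat -> R) : (forall n, a n <= a n.+1) -> (forall n, b n.+1 <= b n) ->
  (forall n, a n <= b n) -> exists l, forall n, a n <= l <= b n.
Proof.
move=> aS bS ab.
have am : {homo a : n m / (n <= m)%N >-> n <= m}.
  by apply/nondecreasing_seqP.
have bm : {homo b : n m / (n <= m)%N >-> m <= n}.
  by apply/nonincreasing_seqP.
have abm n m : a n <= b m.
  apply: (@le_trans _ _ (a (maxn n m))); first by apply: am; exact: leq_maxl.
  by apply: (le_trans (ab _)); apply: bm; exact: leq_maxr.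
exists (sup (range a)) => n; apply/andP; split.
  by apply: ub_le_sup; [exists (b 0%N) => _ [m _ <-]|exists n].
by apply: ge_sup; [exists (a 0%N), 0%N|move=> _ [m _ <-]].
Qed.

Lemma itv_dist (l u p q : R) : l <= p <= l + u -> l <= q <= l + u -> `|p - q| <= u.
Proof. by rewrite ler_norml; lra. Qed.

Lemma itv_le (l u l' u' p : R) : l <= l' -> l' + u' <= l + u -> l' <= p <= l' + u' -> l <= p <= l + u.
Proof. by move=> h1 h2 /andP[h3 h4]; rewrite (le_trans h1 h3) (le_trans h4 h2). Qed.

(** If three of the quarters are too small, the last one must carry its share. *)
Lemma cabs_sum4 (A B D F : C) : 4 * cabs A < cabs (A + B + D + F) ->
  4 * cabs B < cabs (A + B + D + F) -> 4 * cabs D < cabs (A + B + D + F) ->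
  cabs (A + B + D + F) <= 4 * cabs F.
Proof.
by have := cabsD (A + B + D) F; have := cabsD (A + B) D; have := cabsD A B; lra.
Qed.

(** Classical bisection. A nonzero integral of modulus [c] leaves at least c / 4^n on a rectangle of
    the n-th generation, whereas near the common point [H] is affine up to o(|w - z|) and affine
    functions integrate to zero, so that the integral is o(4^-n). *)
Lemma Goursat H x0 y0 u0 v0 : 0 <= u0 -> 0 <= v0 ->
  (forall z, inrect x0 y0 u0 v0 z -> cdiff H z) -> rectint H x0 y0 u0 v0 = 0.
Proof.
move=> u00 v00 Hd; apply/eqP; rewrite -cabs_eq0; apply/negPn/negP => c0.
set c := cabs _ in c0; have {c0} c0 : 0 < c by rewrite lt_def c0 cabs_ge0.
pose ri (s : R * R) (n : nat) := rectint H s.1 s.2 (u0 / 2 ^+ n) (v0 / 2 ^+ n).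
pose inr (s : R * R) n := inrect s.1 s.2 (u0 / 2 ^+ n) (v0 / 2 ^+ n).
pose un n := u0 / 2 ^+ n; pose vn n := v0 / 2 ^+ n.
(* The next rectangle is the first quarter carrying at least a quarter of the integral; [cabs_sum4]
   justifies the default choice [q4]. *)
pose nxt (n : nat) (s : R * R) : R * R :=
  let q1 := s in let q2 := (s.1 + un n.+1, s.2) in let q3 := (s.1, s.2 + vn n.+1) in
  let q4 := (s.1 + un n.+1, s.2 + vn n.+1) in
  if cabs (ri s n) <= 4 * cabs (ri q1 n.+1) then q1 else
  if cabs (ri s n) <= 4 * cabs (ri q2 n.+1) then q2 else
  if cabs (ri s n) <= 4 * cabs (ri q3 n.+1) then q3 else q4.
pose sq := fix F n := if n is m.+1 then nxt m (F m) else (x0, y0).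
have un0 n : 0 <= un n by rewrite divr_ge0 ?exprn_ge0.
have vn0 n : 0 <= vn n by rewrite divr_ge0 ?exprn_ge0.
have p2 n : (2 : R) ^+ n != 0 by rewrite expf_neq0.
have unS n : un n = un n.+1 + un n.+1 by rewrite /un exprS; move: (p2 n) => h; field.
have vnS n : vn n = vn n.+1 + vn n.+1 by rewrite /vn exprS; move: (p2 n) => h; field.
have nest n : [/\ (sq n).1 <= (sq n.+1).1, (sq n.+1).1 + un n.+1 <= (sq n).1 + un n,
     (sq n).2 <= (sq n.+1).2 & (sq n.+1).2 + vn n.+1 <= (sq n).2 + vn n].
  rewrite /= /nxt; have := un0 n.+1; have := vn0 n.+1; rewrite (unS n) (vnS n).
  by case: ifP => _; [|case: ifP => _; [|case: ifP => _]]; split => /=;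
    rewrite ?addrA ?lexx ?lerDl.
have inS n z : inr (sq n.+1) n.+1 z -> inr (sq n) n z.
  have [h1 h2 h3 h4] := nest n.
  by move=> [k1 k2]; split; [exact: itv_le h1 h2 k1|exact: itv_le h3 h4 k2].
have in0 n z : inr (sq n) n z -> inrect x0 y0 u0 v0 z.
  elim: n => [|n IH]; first by rewrite /inr /= expr0 !divr1.
  by move=> /inS /IH.
have big n : cabs (ri (sq n) n) <= 4 * cabs (ri (sq n.+1) n.+1).
  rewrite [sq n.+1]/= /nxt; case: ifPn => // k1; case: ifPn => // k2; case: ifPn => // k3.
  move: k1 k2 k3; rewrite -!ltNge => k1 k2 k3.
  have E : ri (sq n) n = ri (sq n) n.+1 + ri ((sq n).1 + un n.+1, (sq n).2) n.+1
    + ri ((sq n).1, (sq n).2 + vn n.+1) n.+1 + ri ((sq n).1 + un n.+1, (sq n).2 + vn n.+1) n.+1.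
    rewrite {1}/ri -!/(un _) -!/(vn _) (unS n) (vnS n) rectint_quarter//.
    move=> z; rewrite -unS -vnS => zz; apply: cdiff_cont; apply: Hd; exact: in0 zz.
  move: k1 k2 k3; rewrite E; set A := ri _ _; set B := ri _ _; set D := ri _ _; set F := ri _ _.
  clearbody A B D F; exact: cabs_sum4.
have ge n : c <= 4 ^+ n * cabs (ri (sq n) n).
  elim: n => [|n IH]; first by rewrite expr0 mul1r /ri /= expr0 !divr1.
  apply: le_trans IH _; rewrite exprSr -mulrA ler_wpM2l ?exprn_ge0//.
have [a aP] : exists l, forall n, (sq n).1 <= l <= (sq n).1 + un n.
  by apply: nested_point => n; [have [] := nest n|have [] := nest n|have := un0 n; lra].
have [b bP] : exists l, forall n, (sq n).2 <= l <= (sq n).2 + vn n.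
  by apply: nested_point => n; [have [] := nest n|have [] := nest n|have := vn0 n; lra].
have zin n : inr (sq n) n (mk a b) by split => /=; [exact: aP|exact: bP].
set z := mk a b in zin.
have [g [gc HE]] := Hd _ (in0 0%N _ (zin 0%N)).
(* The [+ 1] keeps [S] positive for degenerate rectangles; with the [e] below, the final estimate 4
   e S^2 equals c / 2. *)
set S := u0 + v0 + 1; have S0 : 0 < S by rewrite /S; lra.
pose e := c / (8 * S ^+ 2).
have e0 : 0 < e by rewrite divr_gt0// mulr_gt0// exprn_gt0.
have [d d0 dP] := gc _ e0.
have [n nd] : exists n, un n + vn n < d.
  have Sd : 0 < S / d by rewrite divr_gt0.
  exists (Num.truncn (S / d)).+1.
  set m := _.+1; rewrite /un /vn -mulrDl ltr_pdivrMr ?exprn_gt0//.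
  apply: (@lt_le_trans _ _ (d * (S / d))); first by rewrite mulrC divfK ?gt_eqF// /S; lra.
  rewrite ler_wpM2l ?(ltW d0)//; apply: ltW; apply: lt_trans (truncnS_gt _) _.
  by rewrite -natrX ltr_nat; exact: ltn_expl.
(* [A] is the tangent affine map of [H] at [z], [rem] the error. *)
pose A (w : C) := (H z - g z * z) + g z * w.
pose rem (w : C) := (g w - g z) * (w - z).
have HA w : H w = A w + rem w by rewrite HE /A /rem; ring.
have Ac w : ccont A w.
  apply: ccontD; [exact: ccont_cst|apply: ccontM; [exact: ccont_cst|exact: ccont_id]].
have remc w : inr (sq n) n w -> ccont rem w.
  move=> wi; have -> : rem = (fun w => H w - A w) by apply/funext => w'; rewrite HA; ring.
  by apply: ccontB => //; apply: cdiff_cont; apply: Hd; exact: in0 wi.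
have E : ri (sq n) n = rectint rem (sq n).1 (sq n).2 (un n) (vn n).
  rewrite /ri -/(un n) -/(vn n) (_ : H = fun w => A w + rem w); last exact/funext.
  by rewrite rectintD// rectint_affine// add0r.
have rb w : inr (sq n) n w -> cabs (rem w) <= e * (un n + vn n).
  move=> wi; have wz : cabs (w - z) <= un n + vn n.
    apply: le_trans (cabs_le _) _; rewrite ReCB ImCB /=.
    by move: (wi) => [k1 k2]; apply: lerD; [exact: itv_dist k1 (aP n)|exact: itv_dist k2 (bP n)].
  rewrite /rem cabsM ler_pM ?cabs_ge0//; apply: ltW; apply: dP.
  exact: le_lt_trans wz nd.
have := ge n; rewrite E leNgt => /negP; apply.
have k := rectint_bound (un0 n) (vn0 n) remc rb.
apply: (@le_lt_trans _ _ (4 ^+ n * (4 * (e * (un n + vn n)) * (un n + vn n)))).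
  by rewrite ler_wpM2l ?exprn_ge0.
have -> : 4 ^+ n * (4 * (e * (un n + vn n)) * (un n + vn n)) = 4 * e * (u0 + v0) ^+ 2.
  rewrite /un /vn -mulrDl (_ : 4 ^+ n = 2 ^+ n * 2 ^+ n :> R); last by rewrite -exprMn; congr (_ ^+ _); ring.
  by move: (p2 n); set q := 2 ^+ n => q0; field.
apply: (@le_lt_trans _ _ (4 * e * S ^+ 2)).
  have S1 : u0 + v0 <= S by rewrite /S lerDl.
  have S2 : (u0 + v0) ^+ 2 <= S ^+ 2 by apply: lerXn2r; rewrite ?nnegrE ?addr_ge0// ltW.
  by apply: ler_wpM2l S2; rewrite mulr_ge0// ltW.
rewrite /e (_ : 4 * (c / (8 * S ^+ 2)) * S ^+ 2 = c / 2); first lra.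
by field; rewrite gt_eqF.
Qed.

End Goursat.

(** * Circle means *)

Section CircleMean.
Variable R : realType.
Local Notation C := R[i].
Local Notation mk := (@complex.Complex R).
Implicit Types (f : C -> C) (a z w : C) (r t e d : R).

Lemma is_derive_o (f : R -> R) (l : R) : is_derive (0 : R) (1 : R) f l ->
  forall e, 0 < e -> exists2 d : R, 0 < d & forall t, `|t| < d -> `|f t - f 0 - l * t| <= e * `|t|.
Proof.
move=> fl e e0.
have : h^-1 *: ((f \o shift 0) (h *: (1 : R)) - f 0) @[h --> 0^'] --> l.
  by case: fl => df <-; exact: df.
move=> /cvgrPdist_lt /(_ _ e0) /nbhs_normP[/= d d0 dP]; exists d => // t td.
have [->|t0] := eqVneq t 0; first by rewrite normr0 !mulr0 !subr0 subrr normr0.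
have := dP t; rewrite /= sub0r normrN => /(_ td t0).
rewrite /shift /= addr0 /GRing.scale /= mulr1 => h.
rewrite (_ : f t - f 0 - l * t = - ((l - t^-1 * (f t - f 0)) * t)); last by field.
by rewrite normrN normrM ler_wpM2r// ltW.
Qed.

Definition cis t : C := mk (cos t) (sin t).

Definition cexp z : C := ofR (expR (ReC z)) * cis (ImC z).

Lemma cabs_cis t : cabs (cis t) = 1.
Proof. by rewrite /cabs /= cos2Dsin2 sqrtr1. Qed.

Lemma cisD s t : cis (s + t) = cis s * cis t.
Proof.
by apply: complex_eqP; rewrite ?ReCM ?ImCM /= ?cosD ?sinD//; ring.
Qed.

Lemma cis2pi : cis (0 + (pi + pi)) = cis 0.
Proof.
have := cospi R; have := sinpi R => sp cp.
by rewrite add0r /cis cosD sinD sp cp cos0 sin0; congr complex.Complex; ring.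
Qed.

Lemma cexpD z w : cexp (z + w) = cexp z * cexp w.
Proof. by rewrite /cexp ReCD ImCD expRD cisD ofRM; ring. Qed.

Lemma cabs_cexp z : cabs (cexp z) = expR (ReC z).
Proof. by rewrite cabsM cabs_ofR cabs_cis mulr1 gtr0_norm ?expR_gt0. Qed.

Lemma rcont_cis t : rcont cis t.
Proof. by apply/rcontP; split; [exact: continuous_cos|exact: continuous_sin]. Qed.

(** Real-variable core of the derivative of the exponential at 0: [E], [CC], [S] stand for e^a, cos
    b, sin b, and only their first-order expansions enter. *)
Lemma cexp_near0 (a b E CC S e : R) : 0 < e -> e < 1 ->
  `|E - 1 - a| <= e * `|a| -> `|CC - 1| <= e * `|b| -> `|S - b| <= e * `|b| ->
  `|a| <= e -> `|b| <= e ->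
  `|E * CC - 1 - a| + `|E * S - b| <= 12 * e * (`|a| + `|b|).
Proof.
move=> e0 e1 hE hC hS ha hb.
have E3 : `|E| <= 3.
  rewrite (_ : E = (E - 1 - a) + (1 + a)); last by ring.
  apply: le_trans (ler_normD _ _) _; have := ler_normD 1 a; rewrite normr1.
  by have := normr_ge0 a; nra.
have Ea : `|E - 1| <= 2 * `|a|.
  rewrite (_ : E - 1 = (E - 1 - a) + a); last by ring.
  by apply: le_trans (ler_normD _ _) _; have := normr_ge0 a; nra.
have -> : E * CC - 1 - a = E * (CC - 1) + (E - 1 - a) by ring.
have -> : E * S - b = E * (S - b) + b * (E - 1) by ring.
have h1 := ler_normD (E * (CC - 1)) (E - 1 - a).
have h2 := ler_normD (E * (S - b)) (b * (E - 1)).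
rewrite normrM in h1; rewrite !normrM in h2.
have k1 : `|E| * `|CC - 1| <= 3 * (e * `|b|) by rewrite ler_pM.
have k2 : `|E| * `|S - b| <= 3 * (e * `|b|) by rewrite ler_pM.
have k3 : `|b| * `|E - 1| <= e * (2 * `|a|) by rewrite ler_pM.
by have := mulr_ge0 (ltW e0) (normr_ge0 a); have := mulr_ge0 (ltW e0) (normr_ge0 b); lra.
Qed.

Lemma cexp0 : cexp 0 = 1.
Proof. by rewrite /cexp /= expR0; apply: complex_eqP; rewrite /= cos0 sin0; ring. Qed.

Lemma cdiff_cexp0 : cdiff cexp 0.
Proof.
apply/cdiffP; exists 1 => e e0.
(* [cexp_near0] yields 12 e1 (|Re h| + |Im h|) <= 24 e1 |h|, and 24 / 25 < 1. *)
pose e1 := Num.min (e / 25) (2^-1).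
have e10 : 0 < e1 by rewrite lt_min divr_gt0// invr_gt0 ltr0n.
have e1e : e1 <= e / 25 by rewrite ge_min lexx.
have e11 : e1 < 1 by rewrite gt_min [X in _ || X](_ : _ = true) ?orbT//; lra.
move: e1 e10 e1e e11 => e1 e10 e1e e11.
have [d1 d10 h1] := is_derive_o (is_derive_expR 0) e10.
have [d2 d20 h2] := is_derive_o (is_derive_cos 0) e10.
have [d3 d30 h3] := is_derive_o (is_derive_sin 0) e10.
exists (Num.min (Num.min d1 d2) (Num.min d3 e1)); rewrite !lt_min d10 d20 d30 e10; split => // h hp.
rewrite !lt_min => /andP[/andP[hd1 hd2] /andP[hd3 hd4]].
have ha := ReC_le h; have hb := ImC_le h.
rewrite add0r cexp0.
have h0 : h != 0 by rewrite -cabs_gt0.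
rewrite (_ : _ - 1 = (cexp h - 1 - h) / h); last by field.
rewrite cabsM cabsV ltr_pdivrMr//.
apply: le_lt_trans (cabs_le _) _.
have -> : ReC (cexp h - 1 - h) = expR (ReC h) * cos (ImC h) - 1 - ReC h.
  by rewrite !ReCB /cexp ReCM /=; ring.
have -> : ImC (cexp h - 1 - h) = expR (ReC h) * sin (ImC h) - ImC h.
  by rewrite !ImCB /cexp ImCM /=; ring.
apply: (@le_lt_trans _ _ (12 * e1 * (`|ReC h| + `|ImC h|))).
  apply: cexp_near0 => //.
  - by have := h1 (ReC h) (le_lt_trans ha hd1); rewrite expR0 mul1r.
  - by have := h2 (ImC h) (le_lt_trans hb hd2); rewrite cos0 sin0 oppr0 mul0r subr0.
  - by have := h3 (ImC h) (le_lt_trans hb hd3); rewrite cos0 sin0 subr0 mul1r.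
  - exact: le_trans ha (ltW hd4).
  - exact: le_trans hb (ltW hd4).
apply: (@le_lt_trans _ _ (24 * e1 * cabs h)); first by nra.
rewrite ltr_pM2r//; lra.
Qed.

Lemma cdiff_cexp z : cdiff cexp z.
Proof.
have -> : cexp = (fun w => cexp z * cexp (w - z)).
  by apply/funext => w; rewrite -cexpD addrC subrK.
apply: cdiffM; first exact: cdiff_cst.
apply: (@cdiff_comp _ cexp (fun w => w - z)).
  by apply: cdiffB; [exact: cdiff_id|exact: cdiff_cst].
by rewrite subrr; exact: cdiff_cexp0.
Qed.

Definition circ a r t : C := a + ofR r * cis t.

(** Not divided by 2 pi. The upper bound is written [0 + (pi + pi)] to match the vertical sides of
    [rectint] with [y = 0] and [v = pi + pi]. *)
Definition cmean f a r : C := cint (fun t => f (circ a r t)) 0 (0 + (pi + pi)).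

Lemma dbpi_gt0 : 0 < pi + pi :> R.
Proof. by rewrite addr_gt0 ?pi_gt0. Qed.

Lemma dbpi_ge0 : 0 <= 0 + (pi + pi) :> R.
Proof. by rewrite add0r ltW ?dbpi_gt0. Qed.

Lemma circB a r t : circ a r t - a = ofR r * cis t.
Proof. by rewrite /circ; ring. Qed.

Lemma cabs_circ a r t : 0 <= r -> cabs (circ a r t - a) = r.
Proof. by move=> r0; rewrite circB cabsM cabs_cis cabs_ofR ger0_norm ?mulr1. Qed.

Lemma rcont_circ a r t : rcont (circ a r) t.
Proof.
apply: (@rcont_comp _ (fun z => a + ofR r * z)); first exact: rcont_cis.
apply: ccontD; [exact: ccont_cst|apply: ccontM; [exact: ccont_cst|exact: ccont_id]].
Qed.

Lemma cmean_csegcont f a r s t : 0 <= r -> (forall z, cabs (z - a) = r -> ccont f z) ->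
  csegcont (fun t => f (circ a r t)) s t.
Proof.
move=> r0 fc x _; apply: rcont_comp; first exact: rcont_circ.
by apply: fc; rewrite cabs_circ.
Qed.

Lemma cmean_eq f g a r : 0 <= r -> (forall z, cabs (z - a) = r -> f z = g z) ->
  cmean f a r = cmean g a r.
Proof. by move=> r0 fg; apply: cint_eq => t _; apply: fg; rewrite cabs_circ. Qed.

Lemma cmeanD f g a r : 0 <= r -> (forall z, cabs (z - a) = r -> ccont f z) ->
  (forall z, cabs (z - a) = r -> ccont g z) ->
  cmean (fun z => f z + g z) a r = cmean f a r + cmean g a r.
Proof. by move=> r0 fc gc; rewrite /cmean cintD//; exact: cmean_csegcont. Qed.

Lemma cmeanZ f (k : C) a r : 0 <= r -> (forall z, cabs (z - a) = r -> ccont f z) ->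
  cmean (fun z => k * f z) a r = k * cmean f a r.
Proof. by move=> r0 fc; rewrite /cmean cintZ//; exact: cmean_csegcont. Qed.

Lemma cmean_cst (k : C) a r : cmean (fun=> k) a r = k * ofR (pi + pi).
Proof. by rewrite /cmean cint_cst ?dbpi_ge0// subr0 add0r. Qed.

Lemma cmean_bound f a r (B : R) : 0 <= r -> (forall z, cabs (z - a) = r -> ccont f z) ->
  (forall z, cabs (z - a) = r -> cabs (f z) <= B) -> cabs (cmean f a r) <= 2 * B * (pi + pi).
Proof.
move=> r0 fc fB; rewrite (_ : pi + pi = 0 + (pi + pi) - 0); last by rewrite subr0 add0r.
apply: cint_bound; [exact: dbpi_ge0|exact: cmean_csegcont|].
by move=> t _; apply: fB; rewrite cabs_circ.
Qed.

Lemma circ_cexp a (s t : R) : a + cexp (mk s t) = circ a (expR s) t.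
Proof. by []. Qed.

(** The map z -> a + e^z sends a rectangle of height 2 pi onto the annulus. In Goursat's lemma the
    horizontal sides cancel by periodicity, and the vertical sides are the two circle means; no
    winding number or general path is involved. *)
Lemma cmean_annulus f a r1 r2 : 0 < r1 -> r1 <= r2 ->
  (forall z, r1 <= cabs (z - a) <= r2 -> cdiff f z) -> cmean f a r1 = cmean f a r2.
Proof.
move=> r10 r12 fd; have r20 : 0 < r2 := lt_le_trans r10 r12.
pose H z := f (a + cexp z).
have u0 : 0 <= ln r2 - ln r1 by rewrite subr_ge0 ler_ln ?posrE.
have e1 : expR (ln r1) = r1 by apply/eqP; rewrite lnK_eq.
have e2 : expR (ln r2) = r2 by apply/eqP; rewrite lnK_eq.
have l2 : ln r1 + (ln r2 - ln r1) = ln r2 by ring.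
have := @Goursat R H (ln r1) 0 (ln r2 - ln r1) (pi + pi) u0 (ltW dbpi_gt0).
move=> Gr.
have Hd : forall z, inrect (ln r1) 0 (ln r2 - ln r1) (pi + pi) z -> cdiff H z.
  move=> z [+ _]; rewrite l2 => /andP[k1 k2].
  apply: (@cdiff_comp _ f (fun z => a + cexp z)).
    by apply: cdiffD; [exact: cdiff_cst|exact: cdiff_cexp].
  apply: fd; rewrite (_ : a + cexp z - a = cexp z); last by ring.
  by rewrite cabs_cexp -e1 -e2 !ler_expR k1.
have := Gr Hd; rewrite /rectint l2 /H (_ : cint (fun t => f (a + cexp (mk t (0 + (pi + pi))))) (ln r1) (ln r2) =
  cint (fun t => f (a + cexp (mk t 0))) (ln r1) (ln r2)); last first.
  by apply: cint_eq => t _; rewrite /cexp /= cis2pi.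
rewrite subrr add0r => /eqP; rewrite mulf_eq0 -cabs_eq0 cabs_ic oner_eq0 /= subr_eq0 => /eqP.
rewrite (_ : cint (fun t => f (a + cexp (mk (ln r2) t))) 0 (0 + (pi + pi)) = cmean f a r2); last first.
  by apply: cint_eq => t _; rewrite circ_cexp e2.
rewrite (_ : cint (fun t => f (a + cexp (mk (ln r1) t))) 0 (0 + (pi + pi)) = cmean f a r1); last first.
  by apply: cint_eq => t _; rewrite circ_cexp e1.
by [].
Qed.

(** The angle [t] ranges over the whole line, so compactness is used for the points on the circle
    and not for the parameters: a sequence of counterexamples accumulates at a point of the circle,
    where continuity of [f] is contradicted. *)
Lemma circle_unif_cont f a r0 : 0 <= r0 -> (forall z, cabs (z - a) = r0 -> ccont f z) ->
  forall e, 0 < e -> exists2 d : R, 0 < d &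
    forall r t, `|r - r0| < d -> cabs (f (circ a r t) - f (circ a r0 t)) < e.
Proof.
move=> r00 fc e e0; apply: contrapT => H.
have {H} H (n : nat) : exists p : R * R, `|p.1 - r0| < n.+1%:R^-1 /\
    e <= cabs (f (circ a p.1 p.2) - f (circ a r0 p.2)).
  apply: contrapT => K; apply: H; exists n.+1%:R^-1; first by rewrite invr_gt0.
  by move=> r t rd; rewrite ltNge; apply/negP => k; apply: K; exists (r, t).
have [p pP] := choice H.
have [] := @complex_BW _ (fun n => circ a r0 (p n).2) (cabs a + r0).
  by move=> n; apply: le_trans (cabsD _ _) _; rewrite lerD2l cabsM cabs_cis cabs_ofR ger0_norm ?mulr1.
move=> l [s sn sP].
have la : cabs (l - a) = r0.
  apply/eqP/negPn/negP => h; have d0 : 0 < `|cabs (l - a) - r0| by rewrite normr_gt0 subr_eq0.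
  have [N NP] := sP _ d0; have := NP _ (leqnn N); rewrite ltNge => /negP; apply.
  rewrite -[X in `|_ - X|](cabs_circ a (p (s N)).2 r00) distrC; apply: le_trans (cabs_dist _ _) _.
  by rewrite (_ : _ - a - (l - a) = circ a r0 (p (s N)).2 - l)//; ring.
have [d d0 dP] := fc _ la (e / 2) ltac:(lra).
have [N NP] := sP (d / 2) ltac:(lra).
pose n := maxn N (Num.truncn (2 / d)).
have k1 : cabs (circ a r0 (p (s n)).2 - l) < d / 2 by apply: NP; exact: leq_maxl.
have [k2 k3] := pP (s n).
have k4 : (s n).+1%:R^-1 < d / 2.
  rewrite -[ltRHS]invrK ltf_pV2 ?posrE ?invr_gt0 ?ltr0n ?divr_gt0// invf_div.
  apply: lt_le_trans (truncnS_gt _) _; rewrite ler_nat ltnS.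
  by apply: leq_trans (sn _); exact: leq_maxr.
have k5 : cabs (circ a (p (s n)).1 (p (s n)).2 - l) < d.
  rewrite (_ : _ - l = ofR ((p (s n)).1 - r0) * cis (p (s n)).2 + (circ a r0 (p (s n)).2 - l)); last first.
    by rewrite /circ ofRB; ring.
  have k5 := lt_trans k2 k4.
  apply: le_lt_trans (cabsD _ _) _; rewrite cabsM cabs_ofR cabs_cis mulr1; lra.
have h1 := dP _ k5; have h2 := dP (circ a r0 (p (s n)).2) ltac:(lra).
have := cabs_tri (f (circ a (p (s n)).1 (p (s n)).2)) (f l) (f (circ a r0 (p (s n)).2)).
rewrite [cabs (f l - _)]cabsBC; lra.
Qed.

Lemma cmean_cont f a r0 rho : 0 <= r0 < rho -> (forall z, cabs (z - a) < rho -> ccont f z) ->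
  forall e, 0 < e -> exists2 d : R, 0 < d &
    forall r, 0 <= r < rho -> `|r - r0| < d -> cabs (cmean f a r - cmean f a r0) <= e.
Proof.
move=> /andP[r00 r0rho] fc e e0.
(* 4 pi is the factor 2 of [cint_bound] times the length 2 pi. *)
have e1 : 0 < e / (4 * pi) by rewrite divr_gt0// mulr_gt0 ?pi_gt0.
have [] := @circle_unif_cont f a r0 r00 _ _ e1.
  by move=> z za; apply: fc; rewrite za.
move=> d d0 dP; exists d => // r /andP[r0' rrho] rd.
have c1 : csegcont (fun t => f (circ a r t)) 0 (0 + (pi + pi)).
  by apply: cmean_csegcont => // z za; apply: fc; rewrite za.
have c2 : csegcont (fun t => f (circ a r0 t)) 0 (0 + (pi + pi)).
  by apply: cmean_csegcont => // z za; apply: fc; rewrite za.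
rewrite /cmean -cintB//; apply: le_trans (cint_bound (B := e / (4 * pi)) dbpi_ge0 _ _) _.
- move=> t tt; rewrite (_ : (fun t => _ - _) = (fun t => f (circ a r t) + (-1) * f (circ a r0 t))).
    by apply: csegcontD tt => //; exact: csegcontZ.
  by apply/funext => s; rewrite mulN1r.
- by move=> t _; apply/ltW/dP.
- rewrite subr0 add0r le_eqVlt; apply/orP; left; apply/eqP.
  by have := pi_gt0 R; move: (pi : R) => p p0; field; rewrite gt_eqF.
Qed.

End CircleMean.

(** * Cauchy's formula and Taylor expansion *)

Section Taylor.
Variable R : realType.
Local Notation C := R[i].
Implicit Types (f g : C -> C) (a z w : C) (r t e d rho : R).

Lemma cabs_le_eps z : (forall e, 0 < e -> cabs z <= e) -> z = 0.
Proof.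
move=> H; apply/eqP; rewrite -cabs_eq0 eq_le cabs_ge0 andbT.
by rewrite leNgt; apply/negP => h; have := H (cabs z / 2); lra.
Qed.

Lemma cmean0 g a : cmean g a 0 = g a * ofR (pi + pi).
Proof.
rewrite -(cmean_cst _ a 0); apply: cint_eq => t _.
by rewrite /circ (_ : ofR 0 = 0)// mul0r addr0.
Qed.

(** Means are constant for positive radii by [cmean_annulus]; continuity in the radius extends this
    to radius 0, so [g] need only be continuous at the centre. *)
Lemma cmean_inner g a rho s r : s <= rho -> 0 < r < s ->
  (forall z, cabs (z - a) < rho -> ccont g z) ->
  (forall z, 0 < cabs (z - a) < s -> cdiff g z) ->
  cmean g a r = cmean g a 0.
Proof.
move=> srho /andP[r0 rs] gc gd; apply/eqP; rewrite -subr_eq0; apply/eqP/cabs_le_eps => e e0.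
have rho0 : 0 <= (0 : R) < rho by rewrite lexx /= (lt_le_trans (lt_trans r0 rs)).
have [d d0 dP] := cmean_cont rho0 gc e0.
pose r' := Num.min r (d / 2).
have r'0 : 0 < r' by rewrite lt_min r0 divr_gt0.
have r'r : r' <= r by rewrite ge_min lexx.
have r'd : r' <= d / 2 by rewrite ge_min lexx orbT.
rewrite -(@cmean_annulus _ g a r' r)//; last first.
  by move=> z /andP[k1 k2]; apply: gd; rewrite (lt_le_trans r'0)//= (le_lt_trans k2).
apply: dP; first by rewrite (ltW r'0) (le_lt_trans r'r)// (lt_le_trans rs).
rewrite subr0 gtr0_norm//; lra.
Qed.

(** The circle through [w] separates two annuli on each of which the mean is constant; continuity in
    the radius glues them across the exceptional circle. *)
Lemma cmean_two_points g a w rho r : cabs (w - a) < r < rho -> w != a ->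
  (forall z, cabs (z - a) < rho -> ccont g z) ->
  (forall z, cabs (z - a) < rho -> z != a -> z != w -> cdiff g z) ->
  cmean g a r = cmean g a 0.
Proof.
move=> /andP[sr rrho] wa gc gd; set s := cabs (w - a) in sr.
have s0 : 0 < s by rewrite cabs_gt0 subr_eq0.
have srho : s < rho := lt_trans sr rrho.
have inn r' : 0 < r' < s -> cmean g a r' = cmean g a 0.
  move=> r's; apply: cmean_inner (ltW srho) r's gc _ => z /andP[z0 zs].
  apply: gd; first exact: lt_trans zs srho.
    by rewrite -subr_eq0 -cabs_gt0.
  by apply: contraTneq zs => ->; rewrite ltxx.
have srho' : 0 <= s < rho by rewrite cabs_ge0.
have Es : cmean g a s = cmean g a 0.
  apply/eqP; rewrite -subr_eq0; apply/eqP/cabs_le_eps => e e0.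
  have [d d0 dP] := cmean_cont srho' gc e0.
  pose r' := Num.max (s / 2) (s - d / 2).
  have h1 : s / 2 <= r' by rewrite le_max lexx.
  have h2 : s - d / 2 <= r' by rewrite le_max lexx orbT.
  have h3 : r' < s by rewrite gt_max; apply/andP; split; lra.
  rewrite -(inn r'); last by apply/andP; split; lra.
  rewrite cabsBC; apply: dP; first by apply/andP; split; lra.
  by rewrite ltr_norml; apply/andP; split; lra.
rewrite -Es; apply/eqP; rewrite -subr_eq0; apply/eqP/cabs_le_eps => e e0.
have [d d0 dP] := cmean_cont srho' gc e0.
pose r' := Num.min r (s + d / 2).
have h1 : r' <= r by rewrite ge_min lexx.
have h2 : r' <= s + d / 2 by rewrite ge_min lexx orbT.
have h3 : s < r' by rewrite lt_min; apply/andP; split; lra.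
rewrite -(@cmean_annulus _ g a r' r)//; [|lra|]; last first.
  move=> z /andP[k1 k2]; apply: gd; first lra.
    by rewrite -subr_eq0 -cabs_gt0; lra.
  by apply: contraTneq k1 => ->; rewrite -ltNge.
apply: dP; first by apply/andP; split; lra.
by rewrite ltr_norml; apply/andP; split; lra.
Qed.

Lemma cdiff_sub w z : cdiff (fun x => x - w) z.
Proof. by apply: cdiffB; [exact: cdiff_id|exact: cdiff_cst]. Qed.

(** The mean does not change when the radius grows, while the integrand decays. *)
Lemma cmean_inv a w r : cabs (w - a) < r -> cmean (fun z => (z - w)^-1) a r = 0.
Proof.
move=> sr; set s := cabs (w - a) in sr; have s0 : 0 <= s by exact: cabs_ge0.
have zw z r' : s < r' -> r' <= cabs (z - a) -> r' - s <= cabs (z - w).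
  move=> sr' zr; have := cabs_tri z w a; rewrite -/s; lra.
apply: cabs_le_eps => e e0.
(* On this circle [cmean_bound] gives 4 pi / (r' - s), which is below [e] because r' - s > 4 pi /
   e. *)
pose r' := r + 4 * pi / e.
have p0 : 0 < 4 * pi / e by rewrite divr_gt0// mulr_gt0// pi_gt0.
have rr' : r <= r' by rewrite /r' lerDl ltW.
have d z : r <= cabs (z - a) -> cdiff (fun z => (z - w)^-1) z.
  move=> zr; apply: cdiffV; last exact: cdiff_sub.
  by rewrite -cabs_gt0; have := zw z r sr zr; lra.
rewrite (@cmean_annulus _ _ a r r')//; [|lra|]; last by move=> z /andP[k _]; exact: d.
apply: le_trans (cmean_bound (B := (r' - s)^-1) _ _ _) _.
- lra.
- by move=> z za; apply: cdiff_cont; apply: d; rewrite za.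
- move=> z za; rewrite cabsV lef_pV2 ?posrE; [|have := zw z r'; lra|lra].
  by apply: zw; lra.
rewrite mulrAC ler_pdivrMr; last by lra.
have -> : 2 * (pi + pi) = e * (4 * pi / e) :> R.
  by move: (pi : R) => p; field; rewrite gt_eqF.
by rewrite ler_pM2l// /r'; lra.
Qed.

(** On the circle dz / (z - w) = i (z - a) / (z - w) dt, whence the kernel. Writing f(z) = f(w) +
    h(z)(z - w), the integrand becomes h(z)(z - a) + f(w)(1 + (w - a) / (z - w)); the first term
    vanishes at the centre, so its mean is zero, and [cmean_inv] disposes of the last. *)
Lemma Cauchy_formula f a rho w r : cabs (w - a) < r < rho ->
  (forall z, cabs (z - a) < rho -> ccont f z) ->
  (forall z, 0 < cabs (z - a) < rho -> cdiff f z) ->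
  cmean (fun z => f z * ((z - a) / (z - w))) a r = f w * ofR (pi + pi).
Proof.
move=> sr fc fd; have [sr1 sr2] := andP sr; have r0 : 0 < r := le_lt_trans (cabs_ge0 _) sr1.
have zn0 z : cabs (z - a) = r -> z - a != 0 by move=> za; rewrite -cabs_gt0 za.
have zw0 z : cabs (z - a) = r -> z - w != 0.
  move=> za; rewrite subr_eq0; apply: contraTneq sr1 => <-; by rewrite za ltxx.
have [wa|wa] := eqVneq w a.
  rewrite wa (@cmean_eq _ _ f) ?(ltW r0)//; last first.
    by move=> z /zn0 za; rewrite divff// mulr1.
  by rewrite (@cmean_inner f a rho rho r) ?cmean0// r0.
have wd : cdiff f w by apply: fd; rewrite cabs_gt0 subr_eq0 wa (lt_trans sr1).
have [h [hc hE]] := wd.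
have hz z : z != w -> h z = (f z - f w) / (z - w).
  by move=> zw; rewrite [f z]hE [X in X / _](_ : _ = h z * (z - w)) ?mulfK ?subr_eq0//; ring.
have hnear z : z != w -> exists2 d : R, 0 < d & forall z', cabs (z' - z) < d -> (f z' - f w) / (z' - w) = h z'.
  move=> zw; exists (cabs (z - w)); first by rewrite cabs_gt0 subr_eq0.
  by move=> z' k; rewrite hz//; apply: contraTneq k => ->; rewrite cabsBC ltxx.
have hcont z : cabs (z - a) < rho -> ccont h z.
  move=> za; have [->//|zw] := eqVneq z w.
  apply: ccont_eq (hnear _ zw) _; apply: ccontM.
    by apply: ccontB; [exact: fc|exact: ccont_cst].
  by apply: ccontV; [rewrite subr_eq0|apply: cdiff_cont; exact: cdiff_sub].
have hdiff z : cabs (z - a) < rho -> z != a -> z != w -> cdiff h z.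
  move=> za zna zw; apply: cdiff_near (hnear _ zw) _; apply: cdiff_div; rewrite ?subr_eq0//.
    apply: cdiffB; last exact: cdiff_cst.
    by apply: fd; rewrite cabs_gt0 subr_eq0 zna.
  exact: cdiff_sub.
pose g z := h z * (z - a).
have gc z : cabs (z - a) < rho -> ccont g z.
  by move=> za; apply: ccontM; [exact: hcont|apply: cdiff_cont; exact: cdiff_sub].
have gd z : cabs (z - a) < rho -> z != a -> z != w -> cdiff g z.
  by move=> za zna zw; apply: cdiffM; [exact: hdiff|exact: cdiff_sub].
have ci z : cabs (z - a) = r -> ccont (fun z => (z - w)^-1) z.
  by move=> /zw0 zw; apply: cdiff_cont; apply: cdiffV => //; exact: cdiff_sub.
have c1 z : cabs (z - a) = r -> ccont (fun z => 1 + (w - a) * (z - w)^-1) z.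
  by move=> za; apply: ccontD; [exact: ccont_cst|apply: ccontM; [exact: ccont_cst|exact: ci]].
rewrite (@cmean_eq _ _ (fun z => g z + f w * (1 + (w - a) * (z - w)^-1))) ?(ltW r0)//; last first.
  move=> z za; rewrite [f z]hE /g; move: (zw0 _ za); move: (h z) (f w) => A B zw; field.
  exact: zw.
rewrite cmeanD ?(ltW r0)//; [|by move=> z za; apply: gc; rewrite za|]; last first.
  by move=> z za; apply: ccontM; [exact: ccont_cst|exact: c1].
rewrite (cmean_two_points sr wa gc gd) cmean0 /g subrr mulr0 mul0r add0r.
rewrite cmeanZ ?(ltW r0)// cmeanD ?(ltW r0)//; [|by move=> z _; exact: ccont_cst|]; last first.
  by move=> z za; apply: ccontM; [exact: ccont_cst|exact: ci].
by rewrite cmean_cst cmeanZ ?(ltW r0)// cmean_inv// mulr0 addr0 mul1r.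
Qed.

Lemma circle_bounded f a r : 0 < r -> (forall z, cabs (z - a) = r -> ccont f z) ->
  exists2 B : R, 0 <= B & forall z, cabs (z - a) = r -> cabs (f z) <= B.
Proof.
move=> r0 fc.
have [||||z0 z0a zM] := @complex_EVT _ [set z | cabs (z - a) = r] (fun z => cabs (f z)) (cabs a + r).
- by exists (circ a r 0); rewrite /= cabs_circ// ltW.
- by move=> z /= za; have := cabsD (z - a) a; rewrite subrK za addrC.
- move=> z H /=; apply/eqP/negPn/negP => h.
  have d0 : 0 < `|cabs (z - a) - r| by rewrite normr_gt0 subr_eq0.
  have [w /= wa] := H _ d0; rewrite ltNge => /negP; apply; rewrite -wa distrC.
  by apply: le_trans (cabs_dist _ _) _; rewrite (_ : w - a - (z - a) = w - z)//; ring.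
- move=> z /fc zc e /zc[d d0 dP]; exists d => // w _ /dP; exact/le_lt_trans/cabs_dist.
by exists (cabs (f z0)) => [|z /zM//]; exact: cabs_ge0.
Qed.

(** The Cauchy kernel is expanded as a finite geometric sum in (w - a) / (z - a), so that the
    remainder is again a circle mean and no interchange of series and integral occurs. *)
Lemma Taylor f a rho r : 0 < r < rho ->
  (forall z, cabs (z - a) < rho -> ccont f z) ->
  (forall z, 0 < cabs (z - a) < rho -> cdiff f z) ->
  exists c : nat -> C, exists2 B : R, 0 <= B & forall w (n : nat), cabs (w - a) < r ->
   cabs (f w - \sum_(k < n) c k * (w - a) ^+ k) <=
     B * (cabs (w - a) / r) ^+ n * (r / (r - cabs (w - a))).
Proof.
move=> /andP[r0 rrho] fc fd; have r0' := ltW r0.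
have fcr z : cabs (z - a) = r -> ccont f z by move=> za; apply: fc; rewrite za.
have zn0 z : cabs (z - a) = r -> z - a != 0 by move=> za; rewrite -cabs_gt0 za.
pose P := ofR (pi + pi) : C; have P0 : P != 0 by rewrite ofR_eq0 gt_eqF// dbpi_gt0.
exists (fun k => cmean (fun z => f z * (z - a) ^- k) a r / P).
have [B B0 fB] := circle_bounded r0 fcr; exists (2 * B); first by rewrite mulr_ge0.
move=> w n wr; set s := cabs (w - a).
have zw0 z : cabs (z - a) = r -> z - w != 0.
  move=> za; rewrite subr_eq0; apply: contraTneq wr => <-; by rewrite za ltxx.
(* Integrand left over after [n] terms of the geometric sum. *)
pose q z n := f z * ((w - a) ^+ n * (z - a) ^- n * ((z - a) / (z - w))).
have cX m z : cabs (z - a) = r -> ccont (fun z => (z - a) ^- m) z.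
  move=> /zn0 za; apply: cdiff_cont; apply: cdiffV; first by rewrite expf_neq0.
  by apply: cdiffX; exact: cdiff_sub.
have cq m z : cabs (z - a) = r -> ccont (q^~ m) z.
  move=> za; apply: ccontM; first exact: fcr.
  apply: ccontM; first by apply: ccontM; [exact: ccont_cst|exact: cX].
  apply: cdiff_cont; apply: cdiff_div; [exact: zw0|exact: cdiff_sub|exact: cdiff_sub].
have E m : f w * P = \sum_(k < m) cmean (fun z => f z * (z - a) ^- k) a r * (w - a) ^+ k + cmean (q^~ m) a r.
  elim: m => [|m IH].
    rewrite big_ord0 add0r -(@Cauchy_formula f a rho w r) ?wr//.
    by apply: cmean_eq => // z za; rewrite /q !expr0 invr1 !mul1r.
  rewrite IH big_ord_recr /= -addrA; congr (_ + _).
  have c1 z : cabs (z - a) = r -> ccont (fun z => f z * (z - a) ^- m) z.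
    by move=> za; apply: ccontM; [exact: fcr|exact: cX].
  rewrite mulrC -cmeanZ// -cmeanD//; last first.
  - by move=> z za; apply: cq.
  - by move=> z za; apply: ccontM; [exact: ccont_cst|exact: c1].
  apply: cmean_eq => // z za; rewrite /q !exprS.
  have za0 := zn0 _ za; have zw := zw0 _ za.
  have zm0 : (z - a) ^+ m != 0 by rewrite expf_neq0.
  move: (f z) ((w - a) ^+ m) ((z - a) ^+ m) zm0 => A D F F0.
  by field; rewrite za0 zw F0.
have Eq : f w - \sum_(k < n) cmean (fun z => f z * (z - a) ^- k) a r / P * (w - a) ^+ k = cmean (q^~ n) a r / P.
  apply: (mulIf P0); rewrite mulrBl (E n) divfK// mulr_suml.
  rewrite [X in _ - X](eq_bigr (fun k : 'I_n => cmean (fun z => f z * (z - a) ^- k) a r * (w - a) ^+ k)).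
    by rewrite addrAC subrr add0r.
  by move=> k _; rewrite mulrAC divfK.
rewrite Eq cabsM cabsV.
have PE : cabs P = pi + pi by rewrite cabs_ofR gtr0_norm// dbpi_gt0.
rewrite PE ler_pdivrMr ?dbpi_gt0//.
rewrite (_ : 2 * B * (s / r) ^+ n * (r / (r - s)) = 2 * (B * ((s / r) ^+ n * (r / (r - s))))); last by ring.
apply: cmean_bound => //; first by move=> z; exact: cq.
move=> z za; rewrite /q !cabsM !cabsV !cabsX za -expr_div_n -/s.
have zwr : r - s <= cabs (z - w) by have := cabs_tri z w a; rewrite za -/s; lra.
have rs : 0 < r - s by rewrite subr_gt0.
have e0 : 0 <= (s / r) ^+ n by rewrite exprn_ge0// divr_ge0// cabs_ge0.
apply: ler_pM; rewrite ?cabs_ge0//; first by rewrite mulr_ge0// divr_ge0// cabs_ge0.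
  exact: fB.
apply: ler_wpM2l => //; apply: ler_wpM2l => //.
by rewrite lef_pV2 ?posrE//; exact: lt_le_trans rs zwr.
Qed.

End Taylor.

(** * Maximum principle and identity theorem *)

Section Analytic.
Variable R : realType.
Local Notation C := R[i].
Local Notation mk := (@complex.Complex R).
Implicit Types (f g : C -> C) (a b z w u : C) (r t e d rho : R).

(* The centre is exempted from differentiability, so that a continuous extension
   across an isolated singularity qualifies. *)
Definition holo_at f a rho := (forall z, cabs (z - a) < rho -> ccont f z) /\
  (forall z, 0 < cabs (z - a) < rho -> cdiff f z).

Lemma holo_cdiff f a rho : (forall z, cabs (z - a) < rho -> cdiff f z) -> holo_at f a rho.
Proof. by move=> fd; split => [z /fd/cdiff_cont|z /andP[_ /fd]]. Qed.

Definition leading f a := exists (k : nat) (c : C) (d B : R), [/\ (0 < k)%N, c != 0, 0 < d, 0 <= B &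
  forall w, cabs (w - a) < d -> cabs (f w - f a - c * (w - a) ^+ k) <= B * cabs (w - a) ^+ k.+1].

Lemma exprn_small (q : R) e : 0 <= q < 1 -> 0 < e -> exists n : nat, q ^+ n < e.
Proof.
move=> /andP[q0 q1] e0; have /cvgrPdist_lt /(_ _ e0)[n _ nP] : (fun n => q ^+ n) @ \oo --> (0 : R).
  by apply: cvg_expr; rewrite ger0_norm.
by exists n; have := nP n (leqnn n); rewrite /= sub0r normrN ger0_norm// exprn_ge0.
Qed.

(** Either some Taylor coefficient of positive index is nonzero and the first such one leads, or
    every partial sum is [f a] and the remainder tends to zero. *)
Lemma const_or_leading_r f a rho r : 0 < r < rho -> holo_at f a rho ->
  (forall w, cabs (w - a) < r -> f w = f a) \/ leading f a.
Proof.
move=> rr [fc fd]; have [r0 _] := andP rr.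
have [c [B B0 cP]] := Taylor rr fc fd.
have c0 : c 0%N = f a.
  have := cP a 1%N; rewrite subrr cabs0 big_ord1 expr0 mulr1 mul0r expr1 mulr0 mul0r => /(_ r0) h.
  by apply/esym/eqP; rewrite -subr_eq0 -cabs_eq0 eq_le h cabs_ge0.
have [h|h] := pselect (exists k, (0 < k)%N && (c k != 0)).
  right; pose k := ex_minn h.
  have [k0 ck kmin] : [/\ (0 < k)%N, c k != 0 & forall j, (0 < j < k)%N -> c j = 0].
    rewrite /k; case: ex_minnP => m /andP[m0 cm] mm; split => // j /andP[j0 jm].
    apply/eqP; apply: contraLR jm => cj; rewrite -leqNgt; apply: mm; by rewrite j0.
  (* On the half disc the factor [r / (r - cabs (w - a))] of [Taylor] is at most 2. *)
  exists k, (c k), (r / 2), (2 * B / r ^+ k.+1); split => //.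
  - by rewrite divr_gt0.
  - by rewrite divr_ge0 ?mulr_ge0 ?exprn_ge0// ltW.
  move=> w wr; have wr' : cabs (w - a) < r by lra.
  have := cP w k.+1 wr'.
  have -> : \sum_(j < k.+1) c j * (w - a) ^+ j = f a + c k * (w - a) ^+ k.
    rewrite big_ord_recr /=; congr (_ + _); case: k k0 kmin {ck} => // k _ kmin.
    rewrite big_ord_recl /= expr0 mulr1 c0 big1 ?addr0// => j _.
    by rewrite kmin ?mul0r//= /bump /= add1n ltnS ltn_ord.
  rewrite opprD addrA => /le_trans; apply.
  rewrite expr_div_n [leRHS](_ : _ = B * (cabs (w - a) ^+ k.+1 / r ^+ k.+1) * 2); last by ring.
  apply: ler_wpM2l.
    by rewrite mulr_ge0// divr_ge0// exprn_ge0 ?cabs_ge0// ltW.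
  by rewrite ler_pdivrMr; lra.
left => w wr; apply/eqP; rewrite -subr_eq0; apply/eqP/cabs_le_eps => e e0.
pose M := r / (r - cabs (w - a)).
have M0 : 0 < M by rewrite divr_gt0// subr_gt0.
have [||n nP] := @exprn_small (cabs (w - a) / r) (e / (B * M + 1)).
- by rewrite divr_ge0 ?cabs_ge0 ?(ltW r0)//= ltr_pdivrMr ?mul1r.
- by rewrite divr_gt0// ltr_wpDl// mulr_ge0// ltW.
have := cP w n.+1 wr.
have -> : \sum_(j < n.+1) c j * (w - a) ^+ j = f a.
  rewrite big_ord_recl /= expr0 mulr1 c0 big1 ?addr0// => j _.
  have -> : c (bump 0 j) = 0; last by rewrite mul0r.
  by apply/eqP/negPn/negP => cj; apply: h; exists (bump 0 j); rewrite cj.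
move=> /le_trans; apply; rewrite -/M.
have q0 : 0 <= cabs (w - a) / r by rewrite divr_ge0 ?cabs_ge0// ltW.
have q1 : cabs (w - a) / r <= 1 by rewrite ler_pdivrMr// mul1r ltW.
have BM : 0 <= B * M by rewrite mulr_ge0// ltW.
rewrite mulrAC; apply: (@le_trans _ _ (B * M * (e / (B * M + 1)))).
  apply: ler_wpM2l => //; apply: le_trans (ltW nP).
  by rewrite exprS ler_piMl// exprn_ge0.
by rewrite mulrA ler_pdivrMr; nra.
Qed.

Lemma const_or_leading f a rho : 0 < rho -> holo_at f a rho ->
  (forall w, cabs (w - a) < rho -> f w = f a) \/ leading f a.
Proof.
move=> rho0 fh; have [h|h] := pselect (leading f a); [by right|left => w wr].
have [|H|//] := @const_or_leading_r f a rho ((cabs (w - a) + rho) / 2) _ fh.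
  by have := cabs_ge0 (w - a) => k; apply/andP; split; lra.
by apply: H; lra.
Qed.

(** Weak open mapping property: from [f a], the values of [f] can be moved in any prescribed
    direction [u]. Solving c s0^k = u by a k-th root, the step w = a + t s0 displaces the value by
    t^k u up to a term of higher order, so t^k is the parameter returned. *)
Lemma leading_move f a : leading f a -> forall u (del eta : R), u != 0 -> 0 < del -> 0 < eta ->
  exists w t, [/\ cabs (w - a) < del, 0 < t, t <= 1, w != a & cabs (f w - f a - ofR t * u) <= eta * t].
Proof.
move=> [k [c [d [B [k0 c0 d0 B0 H]]]]] u del eta u0 del0 eta0.
pose s0 := k.-root (u / c).
have s0k : c * s0 ^+ k = u by rewrite rootCK// mulrC divfK.
have s0n : s0 != 0 by apply: contraNneq u0 => h; rewrite -s0k h expr0n gtn_eqF// mulr0.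
pose m := cabs s0; have m0 : 0 < m by rewrite cabs_gt0.
pose K := B * m ^+ k.+1.
have K0 : 0 <= K by rewrite mulr_ge0// exprn_ge0// ltW.
have [t [t0 t1 t2 t3 t4]] : exists t : R, [/\ 0 < t, t <= 1, t <= d / 2 / m, t <= del / 2 / m & t <= eta / (K + 1)].
  exists (Num.min (Num.min 1 (d / 2 / m)) (Num.min (del / 2 / m) (eta / (K + 1)))); split.
  - by rewrite !lt_min ltr01 !divr_gt0// ltr_wpDl.
  - by rewrite !ge_min lexx.
  - by rewrite !ge_min lexx orbT.
  - by rewrite !ge_min lexx orbT.
  - by rewrite !ge_min lexx !orbT.
have tm1 : t * m <= d / 2 by rewrite -ler_pdivlMr.
have tm2 : t * m <= del / 2 by rewrite -ler_pdivlMr.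
have wa : cabs (a + ofR t * s0 - a) = t * m.
  by rewrite (_ : a + ofR t * s0 - a = ofR t * s0) ?cabsM ?cabs_ofR ?gtr0_norm//; ring.
have tk0 : 0 < t ^+ k by rewrite exprn_gt0.
have tk1 : t ^+ k <= t by rewrite -[X in _ <= X]expr1; apply: ler_wiXn2l => //; exact: ltW.
exists (a + ofR t * s0), (t ^+ k); split => //.
- by rewrite wa; lra.
- exact: le_trans tk1 t1.
- by rewrite -subr_eq0 -cabs_gt0 wa mulr_gt0.
have := H (a + ofR t * s0); rewrite wa => /(_ ltac:(lra)).
rewrite (_ : a + ofR t * s0 - a = ofR t * s0); last by ring.
rewrite exprMn -s0k ofRX (_ : c * (ofR t ^+ k * s0 ^+ k) = ofR t ^+ k * (c * s0 ^+ k)); last by ring.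
move=> /le_trans; apply; rewrite exprMn exprSr.
rewrite (_ : B * (t ^+ k * t * m ^+ k.+1) = K * t * t ^+ k); last by rewrite /K; ring.
apply: ler_wpM2r; first exact: ltW.
have : (K + 1) * t <= eta by rewrite mulrC -ler_pdivlMr// ltr_wpDl.
by move: t0; lra.
Qed.

(** Connectedness is avoided by choosing, among the points where [cabs (f z)] is maximal, one with
    the largest real part. If it lies in [U], either [f] is constant nearby and a shift to the right
    contradicts this choice, or [leading_move] increases the modulus. Isolated removable
    singularities are tolerated through [holo_at]. *)
Lemma max_principle f (K U : set C) (B M : R) :
  (forall z, K z -> cabs z <= B) ->
  (forall z, (forall e : R, 0 < e -> exists2 w, K w & cabs (w - z) < e) -> K z) ->
  (forall z, K z -> ccont f z) ->
  (forall z, U z -> exists2 rho : R, 0 < rho & holo_at f z rho /\ forall w, cabs (w - z) < rho -> K w) ->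
  (forall z, K z -> ~ U z -> cabs (f z) <= M) ->
  forall z, K z -> cabs (f z) <= M.
Proof.
move=> KB Kc fc Uh fM z Kz.
have cabsf z' : K z' -> forall e : R, 0 < e -> exists2 d : R, 0 < d &
    forall w, cabs (w - z') < d -> `|cabs (f w) - cabs (f z')| < e.
  move=> Kz' e /(fc _ Kz')[d d0 dP]; exists d => // w /dP; exact/le_lt_trans/cabs_dist.
have [||||z0 Kz0 z0M] := @complex_EVT _ K (fun z => cabs (f z)) B.
- by exists z.
- by [].
- by [].
- by move=> z' Kz' e e0; have [d d0 dP] := cabsf _ Kz' _ e0; exists d => // w _ /dP.
apply: le_trans (z0M _ Kz) _; rewrite leNgt; apply/negP => Mz0.
have [||||z1 [Kz1 z1E] z1M] := @complex_EVT _ [set z | K z /\ cabs (f z) = cabs (f z0)] (@ReC R) B.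
- by exists z0.
- by move=> w [/KB].
- move=> w H; have Kw : K w by apply: Kc => e /H[x [Kx _] xw]; exists x.
  split => //; apply/eqP/negPn/negP => h.
  have d0 : 0 < `|cabs (f w) - cabs (f z0)| by rewrite normr_gt0 subr_eq0.
  have [d dd dP] := cabsf _ Kw _ d0; have [x [Kx xE] xw] := H _ dd.
  by have := dP _ xw; rewrite xE distrC ltxx.
- move=> w _ e e0; exists e => // x _ xw; rewrite -ReCB.
  exact: le_lt_trans (ReC_le _) xw.
have Uz1 : U z1 by apply: contrapT => /(fM _ Kz1); rewrite z1E leNgt Mz0.
have [rho rho0 [fh rhoK]] := Uh _ Uz1.
case: (const_or_leading rho0 fh) => [cst|/leading_move mv].
  pose w := z1 + ofR (rho / 2).
  have wz : cabs (w - z1) < rho.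
    rewrite (_ : w - z1 = ofR (rho / 2)); last by rewrite /w; ring.
    by rewrite cabs_ofR gtr0_norm; lra.
  have fw := cst _ wz; have := z1M w; rewrite /= fw => /(_ (conj (rhoK _ wz) z1E)).
  by rewrite /w ReCD Re_ofR; lra.
have [f0|f0] := eqVneq (f z1) 0.
  have [w [t [wr t0 _ _]]] := mv 1 rho 2^-1 (oner_neq0 _) rho0 ltac:(lra).
  rewrite f0 subr0 mulr1 => h.
  have := z0M _ (rhoK _ wr); rewrite -z1E f0 cabs0.
  by have := cle_dist (ofR t) (f w); rewrite cabsBC cabs_ofR gtr0_norm//; lra.
have F0 : 0 < cabs (f z1) / 2 by rewrite divr_gt0// cabs_gt0.
have [w [t [wr t0 _ _ h]]] := mv (f z1) rho _ f0 rho0 F0.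
have := z0M _ (rhoK _ wr); rewrite -z1E.
have k : cabs (f z1 + ofR t * f z1) = (1 + t) * cabs (f z1).
  rewrite (_ : f z1 + ofR t * f z1 = ofR (1 + t) * f z1); last by rewrite ofRD (_ : ofR 1 = 1)//; ring.
  by rewrite cabsM cabs_ofR gtr0_norm//; lra.
have := cle_dist (f z1 + ofR t * f z1) (f w); rewrite cabsBC opprD addrA k.
by nra.
Qed.

Lemma UHP_disc z w : UHP z -> cabs (w - z) < ImC z -> UHP w.
Proof.
rewrite /UHP => z0 h; have := le_lt_trans (ImC_le _) h.
by rewrite ImCB ltr_norml; lra.
Qed.

Lemma holo_UHP f z : (forall z, UHP z -> cdiff f z) -> UHP z -> holo_at f z (ImC z).
Proof. by move=> fd z0; apply: holo_cdiff => w wz; apply: fd; exact: UHP_disc wz. Qed.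

Lemma identity_disc f z (d : R) : (forall z, UHP z -> cdiff f z) -> UHP z -> 0 < d ->
  (forall w, cabs (w - z) < d -> f w = 0) -> forall w, cabs (w - z) < ImC z -> f w = 0.
Proof.
move=> fd z0 d0 H; have fz : f z = 0 by apply: H; rewrite subrr cabs0.
have [h|/leading_move mv] := const_or_leading z0 (holo_UHP fd z0).
  by move=> w /h ->.
have [w [t [wr t0 _ _]]] := mv 1 d 2^-1 (oner_neq0 _) d0 ltac:(lra).
by rewrite fz (H _ wr) subrr sub0r mulr1 cabsN cabs_ofR gtr0_norm//; lra.
Qed.

(** Zeros propagate up the vertical line through [b] by discs whose centres rise by Im b / 2. The
    disc of radius Y about a point at height Y contains any given point of the half-plane once Y is
    large, so a final disc reaches [z]. *)
Lemma identity_UHP f b (d : R) : (forall z, UHP z -> cdiff f z) -> UHP b -> 0 < d ->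
  (forall w, cabs (w - b) < d -> f w = 0) -> forall z, UHP z -> f z = 0.
Proof.
move=> fd b0 d0 H z z0; move: (b0) (z0); rewrite /UHP => b0' z0'.
pose Y (n : nat) := ImC b + n%:R * (ImC b / 2).
have Y0 n : 0 < Y n by rewrite ltr_wpDr// mulr_ge0// divr_ge0// ltW.
have near0 n : exists2 d : R, 0 < d & forall w, cabs (w - mk (ReC b) (Y n)) < d -> f w = 0.
  elim: n => [|n [dn dn0 IH]].
    exists d => // w; rewrite /Y mul0r addr0 (_ : mk _ _ = b); [exact: H|exact: complex_eqP].
  have st := @identity_disc f (mk (ReC b) (Y n)) dn fd (Y0 n) dn0 IH.
  have YS : Y n.+1 = Y n + ImC b / 2 by rewrite /Y -natr1; ring.
  have Yb : ImC b <= Y n by rewrite /Y lerDl mulr_ge0// divr_ge0// ltW.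
  exists (Y n - ImC b / 2); first lra.
  move=> w wd; apply: st; apply: le_lt_trans (cabs_tri _ (mk (ReC b) (Y n.+1)) _) _.
  have -> : cabs (mk (ReC b) (Y n.+1) - mk (ReC b) (Y n)) = ImC b / 2.
    rewrite YS (_ : _ - _ = ic R * ofR (ImC b / 2)); last first.
      by rewrite !mkE ofRD; ring.
    by rewrite cabsM cabs_ic mul1r cabs_ofR gtr0_norm; lra.
  by move: wd => /=; lra.
(* With x the difference of real parts, [z] lies in the disc of radius Y iff x^2 + (Im z)^2 < 2 Y Im
   z; [Q] is the number of steps ensuring this. *)
pose Q := ((ReC z - ReC b) ^+ 2 + ImC z ^+ 2) / ImC z / (ImC b / 2).
have [n nQ] : exists n : nat, Q < n%:R.
  by exists (Num.truncn Q).+1; exact: truncnS_gt.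
have [dn dn0 hn] := near0 n.
apply: (@identity_disc f (mk (ReC b) (Y n)) dn fd (Y0 n) dn0 hn).
have bh : 0 < ImC b / 2 by lra.
move: nQ; rewrite /Q ltr_pdivrMr// ltr_pdivrMr// => nQ.
rewrite -(@ltr_pXn2r _ 2%N)// ?nnegrE ?cabs_ge0 ?(ltW (Y0 n))//.
rewrite cabs_sqr ReCB ImCB /=.
have k : n%:R * (ImC b / 2) < Y n by rewrite /Y; lra.
have k2 : n%:R * (ImC b / 2) * ImC z < Y n * ImC z by rewrite ltr_pM2r.
move: (Y n) (Y0 n) k2 => y y0 k2; nra.
Qed.

End Analytic.

(** * The Schwarz-Pick inequality *)

Section SchwarzPick.
Variable R : realType.
Local Notation C := R[i].
Local Notation mk := (@complex.Complex R).
Implicit Types (f g : C -> C) (a b z w : C) (r e d : R).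

Definition cj z : C := mk (ReC z) (- ImC z).

Lemma Re_cj z : ReC (cj z) = ReC z. Proof. by []. Qed.
Lemma Im_cj z : ImC (cj z) = - ImC z. Proof. by []. Qed.

(** This identity removes the conjugate from the pseudo-hyperbolic distance |a - b| / |a - cj b| and
    is why Schwarz-Pick is later stated with imaginary parts only. *)
Lemma cabs_cj_sqr a b : cabs (a - cj b) ^+ 2 = cabs (a - b) ^+ 2 + 4 * (ImC a * ImC b).
Proof. by rewrite !cabs_sqr !ReCB !ImCB Re_cj Im_cj; ring. Qed.

Lemma le_cabs_cj a b : 0 <= ImC a -> 0 <= ImC b -> cabs (a - b) <= cabs (a - cj b).
Proof.
move=> a0 b0; rewrite -(@ler_pXn2r _ 2%N)// ?nnegrE ?cabs_ge0// cabs_cj_sqr lerDl.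
by rewrite mulr_ge0// mulr_ge0.
Qed.

Lemma sub_cj_neq0 a b : 0 <= ImC a -> 0 < ImC b -> a - cj b != 0.
Proof.
move=> a0 b0; apply/eqP => /(congr1 (@ImC R)); rewrite ImCB Im_cj /= => h.
by move: h; rewrite opprK; lra.
Qed.

(** Closed pseudo-hyperbolic discs are bounded and lie inside the half-plane, as the maximum
    principle requires; [a] is not assumed to lie there. *)
Lemma pseudo_disc a b r : 0 < ImC b -> 0 < r < 1 -> cabs (a - b) <= r * cabs (a - cj b) ->
  0 < ImC a /\ cabs a <= cabs b + 4 * ImC b / (1 - r ^+ 2).
Proof.
move=> b0 /andP[r0 r1] h.
have r2 : 0 < 1 - r ^+ 2 by rewrite subr_gt0 exprn_ilt1// ltW.
set D := cabs (a - cj b) in h *; have D0 : 0 <= D by exact: cabs_ge0.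
have h2 : (1 - r ^+ 2) * D ^+ 2 <= 4 * (ImC a * ImC b).
  have := lerXn2r 2 (cabs_ge0 (a - b) : _ \is Num.nneg) (mulr_ge0 (ltW r0) D0 : _ \is Num.nneg) h.
  by have := cabs_cj_sqr a b; rewrite -/D exprMn; lra.
have D2 : 0 <= (1 - r ^+ 2) * D ^+ 2 by rewrite mulr_ge0 ?exprn_ge0// ltW.
have a0 : 0 <= ImC a by rewrite -(pmulr_lge0 _ b0); lra.
have DI : ImC a + ImC b <= D.
  have := ImC_le (a - cj b); rewrite -/D ImCB Im_cj opprK; apply: le_trans; exact: ler_norm.
have Dp : 0 < D by lra.
split.
  have : 0 < (1 - r ^+ 2) * D ^+ 2 by rewrite mulr_gt0// exprn_gt0.
  by move=> k; rewrite -(pmulr_lgt0 _ b0); lra.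
have k : (1 - r ^+ 2) * D <= 4 * ImC b.
  rewrite -(ler_pM2r Dp); apply: (@le_trans _ _ (4 * (ImC a * ImC b))).
    by apply: le_trans h2; rewrite -mulrA -expr2.
  by rewrite (_ : 4 * ImC b * D = 4 * (D * ImC b)); [rewrite ler_pM2l// ler_pM2r//; lra|ring].
have kD : D <= 4 * ImC b / (1 - r ^+ 2) by rewrite ler_pdivlMr// mulrC.
have := cabsD (a - cj b) (cj b); rewrite subrK -/D.
have -> : cabs (cj b) = cabs b by rewrite /cabs /= sqrrN.
lra.
Qed.

(** Maximum principle on the pseudo-hyperbolic disc of radius [r] for the quotient of (f z - f b) /
    (f z - cj (f b)) by (z - b) / (z - cj b). On its boundary the numerator has modulus at most 1
    and the denominator modulus [r]. The factor [r] is removed afterwards by letting it tend to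
    1. *)
Lemma Schwarz_Pick_disc f a b r : (forall z, UHP z -> cdiff f z) -> (forall z, UHP z -> UHP (f z)) ->
  UHP b -> 0 < r < 1 -> cabs (a - b) <= r * cabs (a - cj b) ->
  r * (cabs (f a - f b) * cabs (a - cj b)) <= cabs (f a - cj (f b)) * cabs (a - b).
Proof.
move=> fd fU b0 /[dup] r01 /andP[r0 r1] ha.
have [g [gc gE]] := fd _ b0.
have Fb0 := fU _ b0.
pose K := [set z | cabs (z - b) <= r * cabs (z - cj b)].
pose U := [set z | cabs (z - b) < r * cabs (z - cj b)].
have KU z : K z -> UHP z by move=> Kz; have [] := pseudo_disc b0 r01 Kz.
(* Using the slope [g] in place of the quotient fills the singularity at [b]. *)
pose Q z := g z * (z - cj b) / (f z - cj (f b)).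
have den z : UHP z -> f z - cj (f b) != 0.
  by move=> z0; apply: sub_cj_neq0 => //; exact/ltW/fU.
have gz z : z != b -> g z = (f z - f b) / (z - b).
  by move=> zw; rewrite [f z]gE [X in X / _](_ : _ = g z * (z - b)) ?mulfK ?subr_eq0//; ring.
have gnear z : z != b -> exists2 d : R, 0 < d & forall z', cabs (z' - z) < d -> (f z' - f b) / (z' - b) = g z'.
  move=> zw; exists (cabs (z - b)); first by rewrite cabs_gt0 subr_eq0.
  by move=> z' k; rewrite gz//; apply: contraTneq k => ->; rewrite cabsBC ltxx.
have gd z : UHP z -> z != b -> cdiff g z.
  move=> z0 zb; apply: cdiff_near (gnear _ zb) _; apply: cdiff_div; rewrite ?subr_eq0//.
    by apply: cdiffB; [exact: fd|exact: cdiff_cst].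
  exact: cdiff_sub.
have gcz z : UHP z -> ccont g z.
  move=> z0; have [->//|zb] := eqVneq z b; apply: cdiff_cont; exact: gd.
have Qc z : UHP z -> ccont Q z.
  move=> z0; apply: ccontM; first by apply: ccontM; [exact: gcz|apply: cdiff_cont; exact: cdiff_sub].
  apply: ccontV; first exact: den.
  by apply: ccontB; [apply: cdiff_cont; exact: fd|exact: ccont_cst].
have Qd z : UHP z -> z != b -> cdiff Q z.
  move=> z0 zb; apply: cdiff_div; first exact: den.
    by apply: cdiffM; [exact: gd|exact: cdiff_sub].
  by apply: cdiffB; [exact: fd|exact: cdiff_cst].
have Qabs z : K z -> ~ U z -> cabs (Q z) <= r^-1.
  move=> Kz Uz; have zU := KU _ Kz.
  have zE : cabs (z - b) = r * cabs (z - cj b).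
    by apply/eqP; rewrite eq_le Kz /= leNgt; apply/negP.
  have zc : 0 < cabs (z - cj b) by rewrite cabs_gt0; apply: sub_cj_neq0 => //; exact: ltW.
  have zb : z != b by rewrite -subr_eq0 -cabs_gt0 zE mulr_gt0.
  rewrite /Q gz// !cabsM !cabsV zE.
  have dp : 0 < cabs (f z - cj (f b)) by rewrite cabs_gt0 den.
  have k := le_cabs_cj (ltW (fU _ zU)) (ltW Fb0).
  rewrite ler_pdivrMr// invfM mulrA -mulrA mulVf ?gt_eqF// mulr1 mulrC.
  by apply: ler_wpM2l => //; rewrite invr_ge0 ltW.
have Ka : K a by [].
have QA : cabs (Q a) <= r^-1.
  apply: (@max_principle _ Q K U (cabs b + 4 * ImC b / (1 - r ^+ 2)) r^-1) => //.
  - by move=> z Kz; have [] := pseudo_disc b0 r01 Kz.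
  - move=> z H; rewrite /K /= leNgt; apply/negP => h.
    have e0 : 0 < (cabs (z - b) - r * cabs (z - cj b)) / 2 by lra.
    have [w Kw wz] := H _ e0; rewrite /K /= in Kw.
    have k1 := cabs_tri z w b; have k2 := cabs_tri w z (cj b).
    move: wz; rewrite cabsBC => wz; rewrite [cabs (w - z)]cabsBC in k2.
    have : r * cabs (w - cj b) <= r * cabs (z - cj b) + cabs (z - w).
      have := ler_wpM2l (ltW r0) k2; rewrite mulrDr.
      have : r * cabs (z - w) <= cabs (z - w) by apply: ler_piMl; [exact: cabs_ge0|exact: ltW].
      lra.
    lra.
  - by move=> z /KU /Qc.
  - move=> z Uz; rewrite /U /= in Uz; have zU : UHP z by apply: KU; exact: ltW.
    pose dl := (r * cabs (z - cj b) - cabs (z - b)) / 2.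
    have dl0 : 0 < dl by rewrite /dl; lra.
    have inK (d : R) : d <= dl -> forall w, cabs (w - z) < d -> K w.
      move=> ddl w wz; rewrite /K /=; have k1 := cabs_tri w z b; have k2 := cabs_tri z w (cj b).
      rewrite [cabs (z - w)]cabsBC in k2.
      have : r * cabs (z - cj b) <= r * cabs (w - cj b) + cabs (w - z).
        have := ler_wpM2l (ltW r0) k2; rewrite mulrDr.
        have : r * cabs (w - z) <= cabs (w - z) by apply: ler_piMl; [exact: cabs_ge0|exact: ltW].
        lra.
      by rewrite /dl in ddl; lra.
    have [zb|zb] := eqVneq z b.
      exists dl => //; split; last exact: inK.
      split => w; first by move=> /(inK _ (lexx _)) /KU /Qc.
      move=> /andP[w0 /(inK _ (lexx _)) /KU wU]; apply: Qd => //.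
      by rewrite -zb -subr_eq0 -cabs_gt0.
    exists (Num.min dl (cabs (z - b))); first by rewrite lt_min dl0 cabs_gt0 subr_eq0.
    have mdl : Num.min dl (cabs (z - b)) <= dl by rewrite ge_min lexx.
    split; last exact: inK.
    apply: holo_cdiff => w wz; apply: Qd; first by apply: KU; exact: inK wz.
    by apply: contraTneq wz => ->; rewrite lt_min negb_and -!leNgt [cabs (b - z)]cabsBC lexx orbT.
have aU := KU _ Ka.
have [->|ab] := eqVneq a b; first by rewrite subrr cabs0 mul0r !mulr0 subrr cabs0 mulr0.
have abp : 0 < cabs (a - b) by rewrite cabs_gt0 subr_eq0.
have dp : 0 < cabs (f a - cj (f b)) by rewrite cabs_gt0 den.
move: QA; rewrite /Q gz// !cabsM !cabsV ler_pdivrMr// mulrAC ler_pdivrMr// => QA.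
rewrite -(@ler_pM2l _ r) // !mulrA mulfV ?gt_eqF// mul1r -!mulrA in QA.
exact: QA.
Qed.

(** After squaring, [cabs_cj_sqr] produces the same product of |f a - f b|^2 and |a - b|^2 on both
    sides, which cancels. *)
Lemma Schwarz_Pick_pos f a b : (forall z, UHP z -> cdiff f z) -> (forall z, UHP z -> UHP (f z)) ->
  UHP a -> UHP b ->
  cabs (f a - f b) ^+ 2 * (ImC a * ImC b) <= cabs (a - b) ^+ 2 * (ImC (f a) * ImC (f b)).
Proof.
move=> fd fU a0 b0.
have ap : 0 < cabs (a - cj b) by rewrite cabs_gt0; apply: sub_cj_neq0 => //; exact: ltW.
have abI : 0 < ImC a * ImC b by rewrite mulr_gt0.
have lt1 : cabs (a - b) / cabs (a - cj b) < 1.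
  rewrite ltr_pdivrMr// mul1r -(@ltr_pXn2r _ 2%N)// ?nnegrE ?cabs_ge0// cabs_cj_sqr; lra.
have ge0 : 0 <= cabs (a - b) / cabs (a - cj b) by rewrite divr_ge0// cabs_ge0.
set q := _ / _ in lt1 ge0.
have main : cabs (f a - f b) * cabs (a - cj b) <= cabs (f a - cj (f b)) * cabs (a - b).
  set A := _ * _; set B := _ * _; have A0 : 0 <= A by rewrite mulr_ge0// cabs_ge0.
  rewrite leNgt; apply/negP => BA.
  have B0 : 0 <= B by rewrite mulr_ge0// cabs_ge0.
  have Ap : 0 < A by exact: le_lt_trans B0 BA.
  have BA1 : B / A < 1 by rewrite ltr_pdivrMr// mul1r.
  have BA0 : 0 <= B / A by rewrite divr_ge0.
  have [r [r0 r1 rq rB]] : exists r : R, [/\ 0 < r, r < 1, q <= r & B / A < r].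
    exists ((Num.max q (B / A) + 1) / 2).
    have h1 : q <= Num.max q (B / A) by rewrite le_max lexx.
    have h2 : B / A <= Num.max q (B / A) by rewrite le_max lexx orbT.
    have h3 : Num.max q (B / A) < 1 by rewrite gt_max lt1.
    by split; lra.
  (* A failure of [main] would survive for this [r] close to 1. *)
  have := @Schwarz_Pick_disc f a b r fd fU b0; rewrite r0 r1 => /(_ isT).
  rewrite -ler_pdivrMr// => /(_ rq); rewrite -/A -/B.
  by move: rB; rewrite ltr_pdivrMr//; lra.
have : (cabs (f a - f b) * cabs (a - cj b)) ^+ 2 <= (cabs (f a - cj (f b)) * cabs (a - b)) ^+ 2.
  by apply: lerXn2r main; rewrite nnegrE mulr_ge0// cabs_ge0.
rewrite !exprMn !cabs_cj_sqr.
move: (cabs (f a - f b) ^+ 2) (cabs (a - b) ^+ 2) (ImC a * ImC b) (ImC (f a) * ImC (f b)) => F X P Q.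
by clear; rewrite mulrDr mulrDl; lra.
Qed.

(** The positive case is applied to f + i e and [e] tends to 0. *)
Lemma Schwarz_Pick f a b : (forall z, UHP z -> cdiff f z) -> (forall z, UHP z -> 0 <= ImC (f z)) ->
  UHP a -> UHP b ->
  cabs (f a - f b) ^+ 2 * (ImC a * ImC b) <= cabs (a - b) ^+ 2 * (ImC (f a) * ImC (f b)).
Proof.
move=> fd fU a0 b0.
set X := cabs (a - b) ^+ 2; set p := ImC (f a); set q := ImC (f b); set L := _ * _.
have p0 : 0 <= p by exact: fU. have q0 : 0 <= q by exact: fU.
have X0 : 0 <= X by rewrite exprn_ge0// cabs_ge0.
have H e : 0 < e -> L <= X * ((p + e) * (q + e)).
  move=> e0; pose g z := f z + mk 0 e.
  have := @Schwarz_Pick_pos g a b; rewrite /g /UHP !ImCD /= -/p -/q.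
  rewrite (_ : f a + mk 0 e - (f b + mk 0 e) = f a - f b); last by ring.
  apply => //.
  - by move=> z z0; apply: cdiffD; [exact: fd|exact: cdiff_cst].
  - by move=> z z0; rewrite ImCD /=; have := fU _ z0; lra.
rewrite leNgt; apply/negP => h.
(* For e <= 1, X (p + e)(q + e) exceeds X p q by at most e X (p + q + 1), here at most half of the
   supposed gap. *)
pose e := Num.min 1 ((L - X * (p * q)) / (2 * (X * (p + q + 1) + 1))).
have den : 0 < X * (p + q + 1) + 1 by rewrite ltr_wpDl// mulr_ge0//; lra.
have e0 : 0 < e by rewrite lt_min ltr01 divr_gt0 ?mulr_gt0//; lra.
have e1 : e <= 1 by rewrite ge_min lexx.
have e2 : e * (2 * (X * (p + q + 1) + 1)) <= L - X * (p * q).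
  by rewrite -ler_pdivlMr ?mulr_gt0// ge_min lexx orbT.
have := H _ e0; move: e e0 e1 e2 => e e0 e1 e2.
have : X * (e * e) <= X * e by apply: ler_wpM2l => //; rewrite -[leRHS]mulr1 ler_pM2l.
by have := mulr_ge0 X0 p0; have := mulr_ge0 X0 q0; nra.
Qed.

End SchwarzPick.

(** * Cauchy transforms *)

Section CauchyTransform.
Variable R : realType.
Local Notation C := R[i].
Local Notation mk := (@complex.Complex R).
Variable nu : probability R R.
Implicit Types (f g : R -> C) (z w u : C) (h : R -> R) (t e d : R).

Definition mexp h : R := Rintegral nu setT h.

Definition bmeas h := measurable_fun setT h /\ exists B : R, forall t, `|h t| <= B.

Lemma bmeas_integrable h : bmeas h -> nu.-integrable setT (EFin \o h).
Proof.
move=> [hm [B hB]]; apply: measurable_bounded_integrable => //.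
  by rewrite -ge0_fin_numE ?measure_ge0//; exact: fin_num_measure.
by exists B; split; [exact: num_real|move=> x Bx t _; apply: le_trans (hB t) (ltW Bx)].
Qed.

Lemma bmeas_cont h : continuous h -> (exists B : R, forall t, `|h t| <= B) -> bmeas h.
Proof. by move=> hc hB; split => //; exact: continuous_measurable_fun. Qed.

Lemma bmeasD h k : bmeas h -> bmeas k -> bmeas (fun t => h t + k t).
Proof.
move=> [hm [A hA]] [km [B kB]]; split; first exact: measurable_funD.
by exists (A + B) => t; apply: le_trans (ler_normD _ _) _; exact: lerD.
Qed.

Lemma bmeasZ (c : R) h : bmeas h -> bmeas (fun t => c * h t).
Proof.
move=> [hm [A hA]]; split; first by apply: measurable_funM => //; exact: measurable_cst.
by exists (`|c| * A) => t; rewrite normrM ler_wpM2l.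
Qed.

Lemma bmeas_cst (c : R) : bmeas (fun=> c).
Proof. by split; [exact: measurable_cst|exists `|c|]. Qed.

Lemma mexpD h k : bmeas h -> bmeas k -> mexp (fun t => h t + k t) = mexp h + mexp k.
Proof. by move=> hb kb; rewrite /mexp RintegralD//; exact: bmeas_integrable. Qed.

Lemma mexpZ (c : R) h : bmeas h -> mexp (fun t => c * h t) = c * mexp h.
Proof. by move=> hb; rewrite /mexp RintegralZl//; exact: bmeas_integrable. Qed.

Lemma mexp_cst (c : R) : mexp (fun=> c) = c.
Proof. by rewrite /mexp Rintegral_cst//= probability_setT /= mulr1. Qed.

Lemma mexp_le h k : bmeas h -> bmeas k -> (forall t, h t <= k t) -> mexp h <= mexp k.
Proof. by move=> hb kb hk; apply: le_Rintegral => //; exact: bmeas_integrable. Qed.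

Lemma mexp_bound h k : bmeas h -> bmeas k -> (forall t, `|h t| <= k t) -> `|mexp h| <= mexp k.
Proof.
move=> hb kb hk; rewrite ler_norml -mulN1r -mexpZ//; apply/andP; split; apply: mexp_le => //.
- exact: bmeasZ.
- by move=> t; have := hk t; rewrite ler_norml mulN1r => /andP[].
- by move=> t; exact: le_trans (ler_norm _) (hk t).
Qed.

(** A zero integral would make [h] vanish almost everywhere, hence the whole line negligible. *)
Lemma mexp_gt0 h : bmeas h -> (forall t, 0 < h t) -> 0 < mexp h.
Proof.
move=> hb h0; have mh0 : 0 <= mexp h by apply: Rintegral_ge0 => t _; exact: ltW.
rewrite lt_def mh0 andbT.
apply/eqP => E.
have := bmeas_integrable hb => hi.
have int0 : (\int[nu]_(t in setT) (h t)%:E = 0)%E.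
  have fin : (\int[nu]_(t in setT) (h t)%:E)%E \is a fin_num by exact: integrable_fin_num hi.
  by rewrite -(fineK fin) -[fine _]/(mexp h) E.
have : (\int[nu]_(t in setT) `|(h t)%:E| = 0)%E.
  by rewrite -int0; apply: eq_integral => t _; rewrite gee0_abs// lee_fin ltW.
move=> E0; have := (ae_eq_integral_abs nu measurableT (measurable_int _ hi)).1 E0.
move=> [A [mA A0 sA]]; have : A = setT.
  apply/seteqP; split => // t _; apply: sA => /= /(_ I) [] k.
  by have := h0 t; rewrite k ltxx.
by move=> AT; have := probability_setT nu; rewrite -AT A0 => /eqP; rewrite eqe eq_sym oner_eq0.
Qed.

Definition cexpect f : C := mk (mexp (fun t => ReC (f t))) (mexp (fun t => ImC (f t))).

Definition cbmeas f := bmeas (fun t => ReC (f t)) /\ bmeas (fun t => ImC (f t)).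

Lemma cbmeas_cont f : (forall t, rcont f t) -> (exists B : R, forall t, cabs (f t) <= B) -> cbmeas f.
Proof.
move=> fc [B fB]; split; apply: bmeas_cont.
- by move=> t; have /rcontP[] := fc t.
- by exists B => t; apply: le_trans (fB t); exact: ReC_le.
- by move=> t; have /rcontP[] := fc t.
- by exists B => t; apply: le_trans (fB t); exact: ImC_le.
Qed.

Lemma cbmeasD f g : cbmeas f -> cbmeas g -> cbmeas (fun t => f t + g t).
Proof.
move=> [f1 f2] [g1 g2]; split.
  by under [X in bmeas X]eq_fun do rewrite ReCD; exact: bmeasD.
by under [X in bmeas X]eq_fun do rewrite ImCD; exact: bmeasD.
Qed.

Lemma bmeas_eq h k : h =1 k -> bmeas h -> bmeas k.
Proof. by move=> /funext ->. Qed.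

Lemma cbmeasZ (c : C) f : cbmeas f -> cbmeas (fun t => c * f t).
Proof.
move=> [f1 f2]; split.
  apply: (@bmeas_eq (fun t => ReC c * ReC (f t) + (- ImC c) * ImC (f t))).
    by move=> t; rewrite ReCM mulNr.
  by apply: bmeasD; exact: bmeasZ.
apply: (@bmeas_eq (fun t => ReC c * ImC (f t) + ImC c * ReC (f t))).
  by move=> t; rewrite ImCM.
by apply: bmeasD; exact: bmeasZ.
Qed.

Lemma cexpectD f g : cbmeas f -> cbmeas g -> cexpect (fun t => f t + g t) = cexpect f + cexpect g.
Proof.
move=> [f1 f2] [g1 g2]; apply: complex_eqP; rewrite ?ReCD ?ImCD /= -mexpD//.
  by congr mexp; apply/funext => t; rewrite ReCD.
by congr mexp; apply/funext => t; rewrite ImCD.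
Qed.

Lemma cexpectZ (c : C) f : cbmeas f -> cexpect (fun t => c * f t) = c * cexpect f.
Proof.
move=> [f1 f2]; apply: complex_eqP.
  rewrite ReCM /= -!mexpZ// -mulN1r -mexpZ; last exact: bmeasZ.
  rewrite -mexpD; [|exact: bmeasZ|by do 2 apply: bmeasZ].
  by congr mexp; apply/funext => t; rewrite ReCM mulN1r.
rewrite ImCM /= -!mexpZ// -mexpD; [|exact: bmeasZ|exact: bmeasZ].
by congr mexp; apply/funext => t; rewrite ImCM.
Qed.

Lemma cexpect_cst (c : C) : cexpect (fun=> c) = c.
Proof. by apply: complex_eqP; rewrite /= mexp_cst. Qed.

Lemma cexpect_bound f k : cbmeas f -> bmeas k -> (forall t, cabs (f t) <= k t) ->
  cabs (cexpect f) <= 2 * mexp k.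
Proof.
move=> [f1 f2] kb fk; apply: le_trans (cabs_le _) _ => /=.
have h1 : `|mexp (fun t => ReC (f t))| <= mexp k.
  by apply: mexp_bound => // t; exact: le_trans (ReC_le _) (fk t).
have h2 : `|mexp (fun t => ImC (f t))| <= mexp k.
  by apply: mexp_bound => // t; exact: le_trans (ImC_le _) (fk t).
lra.
Qed.

Lemma cabs_subR z t : `|ImC z| <= cabs (z - ofR t).
Proof. by have := ImC_le (z - ofR t); rewrite ImCB Im_ofR subr0. Qed.

Lemma UHP_subR z t : UHP z -> z - ofR t != 0.
Proof.
move=> z0; rewrite -cabs_gt0; apply: lt_le_trans (cabs_subR z t).
by rewrite gtr0_norm.
Qed.

Lemma kernel_rcont z t : UHP z -> rcont (fun t => (z - ofR t)^-1) t.
Proof.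
move=> z0; apply: (@rcont_comp _ (fun w => (z - w)^-1)); first exact: rcont_ofR.
apply: ccontV; first exact: UHP_subR.
by apply: ccontB; [exact: ccont_cst|exact: ccont_id].
Qed.

Lemma kernel_bound z t : UHP z -> cabs (z - ofR t)^-1 <= (ImC z)^-1.
Proof.
move=> z0; rewrite cabsV lef_pV2 ?posrE ?cabs_gt0 ?UHP_subR//.
by apply: le_trans (cabs_subR z t); exact: ler_norm.
Qed.

Lemma cbmeas_kernel z : UHP z -> cbmeas (fun t => (z - ofR t)^-1).
Proof.
move=> z0; apply: cbmeas_cont => [t|]; first exact: kernel_rcont.
by exists (ImC z)^-1 => t; exact: kernel_bound.
Qed.

Lemma cauchyE z : Defs.cauchy nu z = cexpect (fun t => (z - ofR t)^-1).
Proof. by []. Qed.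

Lemma cbmeasM f g (A B : R) : (forall t, rcont f t) -> (forall t, rcont g t) ->
  (forall t, cabs (f t) <= A) -> (forall t, cabs (g t) <= B) -> cbmeas (fun t => f t * g t).
Proof.
move=> fc gc fA gB; apply: cbmeas_cont.
  move=> t; have /rcontP[f1 f2] := fc t; have /rcontP[g1 g2] := gc t; apply/rcontP; split.
    rewrite (_ : (fun s => ReC (f s * g s)) = (fun s => ReC (f s) * ReC (g s) - ImC (f s) * ImC (g s))).
      by apply: cvgB; apply: cvgM.
    by apply/funext => s; rewrite ReCM.
  rewrite (_ : (fun s => ImC (f s * g s)) = (fun s => ReC (f s) * ImC (g s) + ImC (f s) * ReC (g s))).
    by apply: cvgD; apply: cvgM.
  by apply/funext => s; rewrite ImCM.
by exists (A * B) => t; rewrite cabsM ler_pM ?cabs_ge0.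
Qed.

Lemma cdiff_cauchy z : UHP z -> cdiff (Defs.cauchy nu) z.
Proof.
move=> z0; have y0 : 0 < ImC z by [].
pose D t := (z - ofR t)^-1 * (z - ofR t)^-1.
have Db : cbmeas D.
  apply: (@cbmeasM _ _ (ImC z)^-1 (ImC z)^-1) => t; try exact: kernel_rcont; exact: kernel_bound.
apply/cdiffP; exists (- cexpect D) => e e0.
pose y := ImC z.
(* The first bound keeps Im (z + h) above y / 2. The error h / ((z + h - t)(z - t)^2) then
   contributes at most 4 |h| / y^3, which the second bound makes less than e / 2. *)
exists (Num.min (y / 2) (e * y ^+ 3 / 8)); split.
  by rewrite lt_min !divr_gt0// mulr_gt0// exprn_gt0.
move=> h h0; rewrite lt_min => /andP[hy he].
have zh : y / 2 <= ImC (z + h).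
  by have := ImC_le h; rewrite ImCD -/y ler_norml => /andP[k _]; lra.
have zhU : UHP (z + h) by rewrite /UHP; lra.
have hn0 : h != 0 by rewrite -cabs_gt0.
pose A t := (z + h - ofR t)^-1; pose B t := (z - ofR t)^-1.
have Ab : cbmeas A by exact: cbmeas_kernel.
have Bb : cbmeas B by exact: cbmeas_kernel.
have E : (Defs.cauchy nu (z + h) - Defs.cauchy nu z) / h - - cexpect D =
    cexpect (fun t => h^-1 * A t + ((- h^-1) * B t + D t)).
  rewrite cexpectD; [|exact: cbmeasZ|apply: cbmeasD => //; exact: cbmeasZ].
  rewrite cexpectD//; last exact: cbmeasZ.
  by rewrite !cexpectZ// !cauchyE -/(A) -/(B) opprK; ring.
rewrite E.
have K0 : 0 <= cabs h * (2 / y * (y^-1 * y^-1)).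
  by rewrite !mulr_ge0 ?cabs_ge0 ?invr_ge0 ?ltW.
apply: le_lt_trans (cexpect_bound (k := fun=> cabs h * (2 / y * (y^-1 * y^-1))) _ (bmeas_cst _) _) _.
- by apply: cbmeasD; [exact: cbmeasZ|apply: cbmeasD => //; exact: cbmeasZ].
- move=> t; have n1 := UHP_subR t zhU; have n2 := UHP_subR t z0.
  rewrite (_ : _ + _ = h * ((z + h - ofR t)^-1 * ((z - ofR t)^-1 * (z - ofR t)^-1))); last first.
    rewrite /A /B /D; move: (ofR t) n1 n2 => s n1 n2; field.
    by rewrite n1 n2 hn0.
  rewrite !cabsM; apply: ler_wpM2l; first exact: cabs_ge0.
  have b1 := kernel_bound t z0; have b2 := kernel_bound t zhU.
  apply: ler_pM; rewrite ?mulr_ge0 ?cabs_ge0//; last by apply: ler_pM; rewrite ?cabs_ge0.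
  apply: le_trans b2 _; rewrite -[leRHS]invrK lef_pV2 ?posrE ?invf_div ?divr_gt0//.
rewrite mexp_cst.
have -> : 2 * (cabs h * (2 / y * (y^-1 * y^-1))) = cabs h * (4 / y ^+ 3) by field; rewrite gt_eqF.
apply: (@lt_trans _ _ (e * y ^+ 3 / 8 * (4 / y ^+ 3))).
  by rewrite ltr_pM2r// divr_gt0// exprn_gt0.
rewrite (_ : _ * (4 / _) = e / 2); first lra.
by field; rewrite gt_eqF.
Qed.

(** A bound uniform in [u]: the integrand - Im (u - t)^-1 dominates one fixed positive function of
    [t]. Besides the sign of Im G, it keeps [cauchy] away from zero on bounded parts of the
    half-plane in [voiculescu_small]. *)
Lemma Im_cauchy_le (del K : R) : 0 < del -> exists2 c : R, 0 < c &
  forall u, del <= ImC u -> cabs u <= K -> ImC (Defs.cauchy nu u) <= - c.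
Proof.
move=> del0; pose k t := del / (`|K| + 1 + `|t|) ^+ 2.
have den t : 0 < `|K| + 1 + `|t| by rewrite ltr_wpDr// ltr_wpDl.
have kb : bmeas k.
  apply: bmeas_cont.
    move=> t; apply: cvgM; first exact: cvg_cst.
    apply: cvgV; first by rewrite expf_neq0// gt_eqF.
    apply: (@continuous_comp _ _ _ (fun t => `|K| + 1 + `|t|) (fun x => x ^+ 2)); last exact: exprn_continuous.
    by apply: cvgD; [exact: cvg_cst|exact: norm_continuous].
  exists del => t; rewrite ger0_norm; last by rewrite divr_ge0 ?exprn_ge0 ?ltW.
  rewrite ler_pdivrMr ?exprn_gt0//; apply: ler_peMr; first exact: ltW.
  apply: exprn_ege1.
  by have := normr_ge0 K; have := normr_ge0 t; lra.
exists (mexp k); first by apply: mexp_gt0 => // t; rewrite divr_gt0// exprn_gt0.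
move=> u du uK; have u0 : UHP u by rewrite /UHP; lra.
have [_ ub] := cbmeas_kernel u0.
rewrite cauchyE /= lerNr -mulN1r -mexpZ//; apply: mexp_le => //; first exact: bmeasZ.
move=> t; rewrite ImCV ImCB Im_ofR subr0 mulN1r mulNr opprK /k.
have c0 : 0 < cabs (u - ofR t) by rewrite cabs_gt0 UHP_subR.
have cu : cabs (u - ofR t) <= `|K| + 1 + `|t|.
  by have := cabsB u (ofR t); rewrite cabs_ofR; have := ler_norm K; lra.
apply: ler_pM; [exact: ltW|by rewrite invr_ge0 exprn_ge0// ltW|by []|].
rewrite lef_pV2 ?posrE ?exprn_gt0//.
by apply: lerXn2r cu; rewrite nnegrE ltW.
Qed.

Lemma Im_cauchy_lt0 z : UHP z -> ImC (Defs.cauchy nu z) < 0.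
Proof.
move=> z0; have [c c0 H] := Im_cauchy_le (cabs z) z0.
by have := H z (lexx _) (lexx _); lra.
Qed.

Lemma cauchy_neq0 z : UHP z -> Defs.cauchy nu z != 0.
Proof. by move=> /Im_cauchy_lt0; apply: contraTneq => ->; rewrite ltxx. Qed.

Lemma Ftr_UHP z : UHP z -> UHP (Ftr nu z).
Proof.
move=> z0; rewrite /UHP /Ftr ImCV divr_gt0//; first by rewrite oppr_gt0 Im_cauchy_lt0.
by rewrite exprn_gt0// cabs_gt0 cauchy_neq0.
Qed.

Lemma cdiff_Ftr z : UHP z -> cdiff (Ftr nu) z.
Proof. by move=> z0; apply: cdiffV; [exact: cauchy_neq0|exact: cdiff_cauchy]. Qed.

Lemma bmeas_min (s : R) : 0 < s -> bmeas (fun t => Num.min 1 (`|t| / s)).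
Proof.
move=> s0; apply: bmeas_cont.
  move=> t; apply: (@continuous_min _ _ (fun=> 1) (fun t => `|t| / s)); first exact: cvg_cst.
  by apply: cvgM; [exact: norm_continuous|exact: cvg_cst].
exists 1 => t; rewrite ger0_norm; first by rewrite ge_min lexx.
by rewrite le_min ler01 divr_ge0// ltW.
Qed.

(** Dominated convergence; the truncation at 1 dispenses with moments of [nu]. *)
Lemma tail_small e : 0 < e -> exists2 N : R, 0 < N & forall s : R, N <= s ->
  mexp (fun t => Num.min 1 (`|t| / s)) <= e.
Proof.
move=> e0; pose h (s t : R) := Num.min 1 (`|t| / s).
have hm (s : R) : 0 < s -> bmeas (h s) by exact: bmeas_min.
have : (\int[nu]_(t in setT) (h n.+1%:R t)%:E)%E @[n --> \oo] --> (\int[nu]_(t in setT) (cst 0%:E) t)%E.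
  apply: (@dominated_cvg _ _ _ nu setT measurableT _ _ (fun=> 1%:E)) => //.
  - by move=> n; apply/measurable_EFinP; have [] := hm n.+1%:R (ltr0Sn _ _).
  - move=> t _; apply: cvg_EFin; first by apply: nearW.
    apply: (@squeeze_cvgr _ _ _ _ (fun=> 0) (fun n : nat => `|t| * n.+1%:R^-1)); last 2 first.
    + exact: cvg_cst.
    + rewrite -[X in _ --> X](mulr0 `|t|); apply: cvgM; [exact: cvg_cst|exact: cvg_harmonic].
    by apply: nearW => n; rewrite /= le_min ler01 divr_ge0//= ge_min lexx orbT.
  - exact: (bmeas_integrable (bmeas_cst 1)).
  - move=> n t _; rewrite lee_fin ger0_norm; first by rewrite ge_min lexx.
    by rewrite le_min ler01 divr_ge0.
rewrite integral0 => /fine_cvgP[_ /cvgrPdist_lt /(_ _ e0)[N _ NP]].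
exists N.+1%:R => // s sN; have s0 : 0 < s by apply: lt_le_trans sN.
have := NP N (leqnn N); rewrite /= sub0r normrN => /ltW /(le_trans (ler_norm _)); apply: le_trans.
apply: mexp_le; [exact: hm|exact: hm|move=> t].
rewrite /h le_min ge_min lexx /= ge_min; apply/orP; right.
by apply: ler_wpM2l => //; rewrite lef_pV2 ?posrE.
Qed.

(** u G(u) - 1 is the integral of t / (u - t). On the cone |u| <= (1 + 1/a) |u - t|, hence |t| <= Ca
    |u - t|, and the integrand is at most Ca min(1, |t| / |u|). *)
Lemma cauchy_cone (a e : R) : 0 < a -> 0 < e -> exists2 M : R, 0 < M &
  forall u, a * `|ReC u| < ImC u -> M < cabs u -> cabs (u * Defs.cauchy nu u - 1) < e.
Proof.
move=> a0 e0; pose Ca := 2 + a^-1; have Ca0 : 0 < Ca by rewrite /Ca ltr_wpDr// invr_ge0 ltW.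
have e1 : 0 < e / (4 * Ca) by rewrite divr_gt0// mulr_gt0.
have [N N0 NP] := tail_small e1; exists N => // u ua uN.
have u0 : UHP u by rewrite /UHP; apply: le_lt_trans ua; rewrite mulr_ge0// ltW.
have up : 0 < cabs u by exact: lt_trans uN.
have uI : cabs u <= (1 + a^-1) * ImC u.
  apply: le_trans (cabs_le _) _; rewrite (gtr0_norm u0) mulrDl mul1r addrC lerD2l.
  by rewrite mulrC ler_pdivlMr// mulrC ltW.
have kb : bmeas (fun t => Ca * Num.min 1 (`|t| / cabs u)) by apply: bmeasZ; exact: bmeas_min.
have ub := cbmeas_kernel u0.
have -> : u * Defs.cauchy nu u - 1 = cexpect (fun t => u * (u - ofR t)^-1 + (-1)).
  rewrite cexpectD; [|exact: cbmeasZ|by split; exact: bmeas_cst].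
  by rewrite cexpectZ// cexpect_cst.
apply: le_lt_trans (cexpect_bound _ kb _) _.
- by apply: cbmeasD; [exact: cbmeasZ|split; exact: bmeas_cst].
- move=> t; have n0 := UHP_subR t u0; have np : 0 < cabs (u - ofR t) by rewrite cabs_gt0.
  rewrite (_ : _ + _ = ofR t / (u - ofR t)); last by field.
  rewrite cabsM cabsV cabs_ofR ler_pdivrMr//.
  have I1 : ImC u <= cabs (u - ofR t) by apply: le_trans (cabs_subR u t); exact: ler_norm.
  have I2 : cabs u <= (1 + a^-1) * cabs (u - ofR t).
    by apply: le_trans uI _; rewrite ler_pM2l// ltr_wpDr// invr_ge0 ltW.
  have I3 : `|t| <= Ca * cabs (u - ofR t).
    have := cabs_tri (ofR t) u 0; rewrite !subr0 cabs_ofR cabsBC /Ca.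
    by rewrite (_ : 2 + a^-1 = 1 + a^-1 + 1); [rewrite mulrDl mul1r; lra|ring].
  case: (lerP 1 (`|t| / cabs u)) => _; first by rewrite mulr1.
  rewrite (_ : Ca * (`|t| / cabs u) * cabs (u - ofR t) = `|t| * (Ca * cabs (u - ofR t) / cabs u)); last by ring.
  apply: ler_peMr => //; rewrite ler_pdivlMr// mul1r.
  apply: le_trans I2 _; apply: ler_wpM2r; first exact: ltW.
  by rewrite /Ca; lra.
- rewrite mexpZ; last exact: bmeas_min.
  have := NP _ (ltW uN); rewrite ler_pdivlMr ?mulr_gt0//; lra.
Qed.

End CauchyTransform.

(** * Subordination *)

Section Subordination.
Variable R : realType.
Local Notation C := R[i].
Local Notation mk := (@complex.Complex R).
Implicit Types (mu nu rho : probability R R) (phi : C -> C) (z w u : C) (a b e d M N B : R).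

Lemma GammaW a M b N z : a <= b -> M <= N -> Gamma b N z -> Gamma a M z.
Proof.
move=> ab MN [h1 h2]; split; first exact: le_lt_trans h1.
by apply: le_lt_trans h2; exact: ler_wpM2r.
Qed.

Lemma cone_cabs a z : 0 < a -> a * `|ReC z| < ImC z -> cabs z <= (1 + a^-1) * ImC z.
Proof.
move=> a0 za; have z0 : 0 < ImC z by apply: le_lt_trans za; rewrite mulr_ge0// ltW.
apply: le_trans (cabs_le _) _; rewrite (gtr0_norm z0) mulrDl mul1r addrC lerD2l.
by rewrite mulrC ler_pdivlMr// mulrC ltW.
Qed.

(** A larger slope means a narrower cone: points of a narrow cone stay in the wide one after a small
    relative perturbation. *)
Lemma cone_perturb a M B N w u : 0 < a -> 0 < M -> 4 * (1 + a) <= B -> 2 * M <= N ->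
  Gamma B N w -> cabs (u - w) <= (8 * (1 + a))^-1 * cabs w -> Gamma a M u.
Proof.
move=> a0 M0 aB MN [h1 h2] h3.
have x0 := normr_ge0 (ReC w); set x := `|ReC w| in x0 h2.
have y0 : 0 < ImC w by apply: le_lt_trans h2; rewrite mulr_ge0//; lra.
have k1 : 4 * ((1 + a) * x) < ImC w.
  by apply: le_lt_trans h2; rewrite mulrA; exact: ler_wpM2r.
have k2 : 8 * ((1 + a) * cabs (u - w)) <= cabs w.
  have p : 0 < 8 * (1 + a) by lra.
  by rewrite mulrA -ler_pdivlMl// mulrC [leRHS]mulrC.
have k3 : cabs w <= x + ImC w by have := cabs_le w; rewrite (gtr0_norm y0).
have d0 := cabs_ge0 (u - w).
have ax := mulr_ge0 (ltW a0) x0; have ad := mulr_ge0 (ltW a0) d0.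
rewrite !mulrDl !mul1r in k1 k2.
split.
  have := cle_dist w u; rewrite cabsBC; lra.
have r1 : `|ReC u| <= x + cabs (u - w).
  rewrite (_ : ReC u = ReC w + ReC (u - w)); last by rewrite ReCB; ring.
  by apply: le_trans (ler_normD _ _) _; rewrite lerD2l ReC_le.
have r2 : ImC w - cabs (u - w) <= ImC u.
  by have := ImC_le (u - w); rewrite ImCB ler_norml => /andP[k _]; lra.
have := ler_wpM2l (ltW a0) r1; rewrite mulrDr; lra.
Qed.

(** phi(w) = o(w). With u = w + phi(w) one has G(u) = 1/w and u G(u) - 1 = phi(w) / w, so
    [cauchy_cone] applies as soon as [u] is large; a bounded [u] would keep |G(u)| above a positive
    constant, by [Im_cauchy_le]. *)
Lemma voiculescu_small mu phi a M b N : voiculescu_on mu phi a M b N ->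
  forall e, 0 < e -> exists2 N' : R, N <= N' & forall w, Gamma b N' w -> cabs (phi w) <= e * cabs w.
Proof.
move=> [a0 M0 b0 N0 [_ H]] e e0.
have [M1 M10 M1P] := cauchy_cone mu a0 e0.
pose del := M / (1 + a^-1).
have ap : 0 < 1 + a^-1 by rewrite ltr_wpDr// invr_ge0 ltW.
have del0 : 0 < del by rewrite divr_gt0.
have [c c0 cP] := Im_cauchy_le mu M1 del0.
exists (Num.max N c^-1); first by rewrite le_max lexx.
move=> w [wN wb]; move: wN; rewrite gt_max => /andP[wN wc].
have [[uM ua] uF] := H w (conj wN wb); set u := w + phi w in uM ua uF.
have w0 : w != 0 by rewrite -cabs_gt0; apply: lt_trans wN.
have GE : Defs.cauchy mu u = w^-1 by rewrite -uF /Ftr invrK.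
have uM1 : M1 < cabs u.
  rewrite ltNge; apply/negP => uM1.
  have du : del <= ImC u.
    by rewrite ler_pdivrMr// mulrC; apply: le_trans (ltW uM) (cone_cabs a0 ua).
  have := cP u du uM1; rewrite GE => h.
  have : c <= (cabs w)^-1.
    by rewrite -cabsV; apply: le_trans (ImC_le _); rewrite ler0_norm; lra.
  rewrite leNgt => /negP; apply; rewrite -[ltRHS]invrK ltf_pV2 ?posrE ?invr_gt0//.
  by rewrite cabs_gt0.
have := M1P u ua uM1; rewrite GE (_ : u / w - 1 = phi w / w); last by rewrite /u; field.
by rewrite cabsM cabsV ltr_pdivrMr ?cabs_gt0// => /ltW.
Qed.

(** [free_conv] supplies its own transform of mu, possibly inverting F_mu on another region. By
    smallness w + psi(w) also enters the region where F_mu is injective, which identifies the two on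
    a narrower cone. *)
Lemma voiculescu_unique mu phi psi a M b N a' M' b' N' :
  voiculescu_on mu phi a M b N -> voiculescu_on mu psi a' M' b' N' ->
  exists B N1 : R, [/\ b <= B, N <= N1 & forall w, Gamma B N1 w -> phi w = psi w].
Proof.
move=> v1 v2; have [a0 M0 b0 N0 [inj H]] := v1; have [a'0 M'0 b'0 N'0 [_ H']] := v2.
have ep : 0 < (8 * (1 + a))^-1 by rewrite invr_gt0; lra.
have [N2 N2N N2P] := voiculescu_small v2 ep.
exists (Num.max b (Num.max b' (4 * (1 + a)))), (Num.max N (Num.max N2 (2 * M))).
split; rewrite ?le_max ?lexx// => w wG.
have w1 : Gamma b N w by apply: GammaW wG; rewrite le_max lexx.
have w2 : Gamma b' N2 w by apply: GammaW wG; rewrite !le_max lexx orbT.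
have w3 : Gamma (4 * (1 + a)) (2 * M) w by apply: GammaW wG; rewrite !le_max lexx !orbT.
have [u1 F1] := H _ w1; have [_ F2] := H' _ (GammaW (lexx _) N2N w2).
have u2 : Gamma a M (w + psi w).
  apply: (cone_perturb a0 M0 (lexx _) (lexx _) w3).
  by rewrite addrC addKr; exact: N2P.
have := inj _ _ u1 u2; rewrite F1 F2 => /(_ erefl) /addrI; exact.
Qed.

Lemma Ftr_cone rho e : 0 < e -> e <= 2^-1 -> exists2 M : R, 0 < M &
  forall z, `|ReC z| < ImC z -> M < cabs z -> cabs (Ftr rho z - z) <= 2 * e * cabs z.
Proof.
move=> e0 e1; have [M M0 MP] := cauchy_cone rho ltr01 e0; exists M => // z zc zM.
have := MP z; rewrite mul1r => /(_ zc zM).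
have z0 : UHP z by exact: le_lt_trans zc.
have G0 := cauchy_neq0 rho z0; set G := Defs.cauchy rho z in G0 *.
have zn := UHP_neq0 z0; set q := z * G => q1.
have q0 : q != 0 by rewrite mulf_neq0.
have qh : 2^-1 <= cabs q by have := cle_dist 1 q; rewrite cabs1 cabsBC; lra.
have -> : Ftr rho z - z = z * ((1 - q) / q).
  by rewrite /Ftr -/G /q; field; rewrite G0 zn.
rewrite cabsM mulrC; apply: ler_wpM2r; first exact: cabs_ge0.
rewrite cabsM cabsV cabsBC ler_pdivrMr ?cabs_gt0//; nra.
Qed.

Lemma subordination_near mu nu rho phi : (exists a M b N : R, voiculescu_on mu phi a M b N) ->
  free_conv mu nu rho -> exists B N : R, [/\ 0 < B, 0 < N & forall z, Gamma B N z ->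
    Ftr nu (z - phi (Ftr rho z)) = Ftr rho z].
Proof.
move=> [a [M [b [N v]]]] [phm [phn [phr [b0 [N0 [[am [Mm vm]] [an [Mn vn]] [ar [Mr vr]] E]]]]]].
have [B1 [N1 [bB NN uq]]] := voiculescu_unique vm v.
have [ar0 Mr0 b00 N00 [injr Hr]] := vr; have [_ _ _ _ [_ Hn]] := vn.
have B10 : 0 < B1 by lra. have N10 : 0 < N1 by lra.
(* [Ftr_cone] doubles this constant to the 1 / (8 (1 + B1)) expected by [cone_perturb]. *)
have ep : 0 < (16 * (1 + B1))^-1 by rewrite invr_gt0; lra.
have ep2 : (16 * (1 + B1))^-1 <= 2^-1 by rewrite lef_pV2 ?posrE; lra.
have [M2 M20 M2P] := Ftr_cone rho ep ep2.
exists (Num.max ar (4 * (1 + B1))), (Num.max Mr (Num.max M2 (2 * N1))).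
split; rewrite ?lt_max ?ar0 ?Mr0// => z zG.
have z1 : Gamma ar Mr z by apply: GammaW zG; rewrite le_max lexx.
have z2 : Gamma (4 * (1 + B1)) (2 * N1) z by apply: GammaW zG; rewrite !le_max lexx !orbT.
have [z3 _] : Gamma ar M2 z by apply: GammaW zG; rewrite !le_max lexx ?orbT.
have [_ z4] : Gamma 1 Mr z.
  by apply: GammaW zG; rewrite !le_max ?lexx//; apply/orP; right; lra.
rewrite mul1r in z4.
set p := Ftr rho z.
have pz : cabs (p - z) <= (8 * (1 + B1))^-1 * cabs z.
  have := M2P z z4 z3; rewrite (_ : 2 * _ = (8 * (1 + B1))^-1)//.
  by field; lra.
have pG : Gamma B1 N1 p by exact: (cone_perturb B10 N10 (lexx _) (lexx _) z2 pz).
have pG0 : Gamma b0 N0 p by exact: GammaW pG.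
have [u1 F1] := Hr _ pG0; have [_ F2] := Hn _ pG0.
have := injr _ _ z1 u1; rewrite F1 => /(_ erefl) zE.
rewrite -(uq _ pG) {1}zE E// (_ : p + (phm p + phn p) - phm p = p + phn p)//.
by ring.
Qed.

Lemma subordination mu nu rho phi : (exists a M b N : R, voiculescu_on mu phi a M b N) ->
  free_conv mu nu rho -> (forall z, UHP z -> cdiff phi z) -> (forall z, UHP z -> ImC (phi z) <= 0) ->
  forall z, UHP z -> Ftr nu (z - phi (Ftr rho z)) = Ftr rho z.
Proof.
move=> hv hf phd phv z z0.
have [B [N [B0 N0 H]]] := subordination_near hv hf.
pose f z := Ftr nu (z - phi (Ftr rho z)) - Ftr rho z.
have omU w : UHP w -> UHP (w - phi (Ftr rho w)).
  by move=> w0; rewrite /UHP ImCB; have := phv _ (Ftr_UHP rho w0); move: w0; rewrite /UHP; lra.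
have fd w : UHP w -> cdiff f w.
  move=> w0; apply: cdiffB; last exact: cdiff_Ftr.
  apply: (@cdiff_comp _ (Ftr nu) (fun w => w - phi (Ftr rho w))); last exact/cdiff_Ftr/omU.
  apply: cdiffB; first exact: cdiff_id.
  by apply: cdiff_comp; [exact: cdiff_Ftr|apply: phd; exact: Ftr_UHP].
apply/eqP; rewrite -subr_eq0 -/(f z); apply/eqP.
(* Chosen with (1 + B) d = 1/2, so that the disc of radius [d] about i (N + 1) lies in
   [Gamma B N]. *)
pose d := (2 * (1 + B))^-1.
have d0 : 0 < d by rewrite invr_gt0; lra.
have dB : (1 + B) * d = 2^-1 by rewrite /d; field; lra.
have Bd := mulr_gt0 B0 d0.
rewrite mulrDl mul1r in dB.
apply: (@identity_UHP _ f (mk 0 (N + 1)) d) => //; first by rewrite /UHP /=; lra.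
move=> w wd; rewrite /f H ?subrr//.
have := le_lt_trans (ReC_le _) wd; rewrite ReCB /= subr0 => wr.
have := le_lt_trans (ImC_le _) wd; rewrite ImCB /= ltr_norml => /andP[wi _].
split.
  by apply: lt_le_trans (ImC_le w); apply: lt_le_trans (ler_norm _); lra.
have : B * `|ReC w| <= B * d by rewrite ler_pM2l// ltW.
lra.
Qed.

End Subordination.

(** * A Julia inequality for limits of fixed points *)

Section Julia.
Variable R : realType.
Local Notation C := R[i].
Local Notation mk := (@complex.Complex R).
Implicit Types (f g psi phi : C -> C) (z w u L : C) (e d c x y K : R) (p q : nat -> C).

(** Sequential compactness of the sphere: either infinitely many terms are bounded by a common
    constant, or the sequence itself tends to infinity. *)
Lemma subseq_ext (u : nat -> C) : exists2 s : nat -> nat, (forall n, (n <= s n)%N) &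
  exists w : option C, seq_conv_ext (u \o s) w.
Proof.
have [[B H]|H] := pselect (exists B : R, forall N, exists n, (N <= n)%N /\ cabs (u n) <= B).
  have [s0 s0P] := choice H.
  have [l [s sn sP]] := @complex_BW _ (u \o s0) B (fun n => (s0P n).2).
  exists (s0 \o s); last by exists (Some l).
  by move=> n; apply: leq_trans (sn n) (s0P _).1.
exists id => //; exists None => K.
apply: contrapT => h; apply: H; exists K => N.
apply: contrapT => h2; apply: h; exists N => n Nn.
by rewrite ltNge; apply/negP => k; apply: h2; exists n.
Qed.

Lemma seq_conv_sub (u : nat -> C) (s : nat -> nat) (w : option C) : (forall n, (n <= s n)%N) ->
  seq_conv_ext u w -> seq_conv_ext (u \o s) w.
Proof.
case: w => [L|] sn H => [e e0|K].
  by have [N NP] := H _ e0; exists N => n Nn; apply: NP; exact: leq_trans (sn n).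
by have [N NP] := H K; exists N => n Nn; apply: NP; exact: leq_trans (sn n).
Qed.

Lemma seq_conv_unique (u : nat -> C) L L' : seq_conv_ext u (Some L) -> seq_conv_ext u (Some L') -> L = L'.
Proof.
move=> h h'; apply/eqP; rewrite -subr_eq0; apply/eqP/cabs_le_eps => e e0.
have [N NP] := h (e / 2) ltac:(lra); have [N' NP'] := h' (e / 2) ltac:(lra).
have k1 := NP _ (leq_maxl N N'); have k2 := NP' _ (leq_maxr N N').
by have := cabs_tri L (u (maxn N N')) L'; rewrite [cabs (L - u _)]cabsBC; lra.
Qed.

Lemma seq_conv_comp f (u : nat -> C) L : ccont f L -> seq_conv_ext u (Some L) ->
  seq_conv_ext (f \o u) (Some (f L)).
Proof. by move=> fc h e /fc[d /h[N NP] dP]; exists N => n /NP /dP. Qed.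

Lemma seq_convD (u v : nat -> C) L L' : seq_conv_ext u (Some L) -> seq_conv_ext v (Some L') ->
  seq_conv_ext (fun n => u n + v n) (Some (L + L')).
Proof.
move=> h h' e e0; have [N NP] := h (e / 2) ltac:(lra); have [N' NP'] := h' (e / 2) ltac:(lra).
exists (maxn N N') => n; rewrite geq_max => /andP[/NP k1 /NP' k2].
by rewrite opprD addrACA; apply: le_lt_trans (cabsD _ _) _; lra.
Qed.

Lemma seq_conv_cst L : seq_conv_ext (fun=> L) (Some L).
Proof. by move=> e e0; exists 0%N => n _; rewrite subrr cabs0. Qed.

Lemma seq_conv_Im_ge0 (u : nat -> C) L : (forall n, UHP (u n)) -> seq_conv_ext u (Some L) -> 0 <= ImC L.
Proof.
move=> uU h; rewrite leNgt; apply/negP => L0.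
have [N NP] := h (- ImC L) ltac:(lra); have := le_lt_trans (ImC_le _) (NP N (leqnn N)).
rewrite ImCB ltr_norml => /andP[_]; have := uU N; rewrite /UHP; lra.
Qed.

(* Normalised squared distance to a point of the Riemann sphere: the common
   limit of [cabs (z - p n) ^+ 2 / kweight w (p n)] as [p n] tends to [w]. *)
Definition kdist (w : option C) z : R := if w is Some l then cabs (z - l) ^+ 2 else 1.
Definition kweight (w : option C) z : R := if w is Some _ then 1 else cabs z ^+ 2.

(** The first point moves with [n] because it will be [psi z + mk 0 (y n)]. *)
Lemma kdist_cvg p (zs : nat -> C) (w : option C) z : (forall n, UHP (p n)) ->
  seq_conv_ext p w -> seq_conv_ext zs (Some z) ->
  (fun n => cabs (zs n - p n) ^+ 2 / kweight w (p n)) @ \oo --> kdist w z.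
Proof.
move=> pU; case: w => [l|] pw zz /=.
  rewrite (_ : (fun n => _) = (fun n => cabs (zs n - p n) ^+ 2)); last first.
    by apply/funext => n; rewrite divr1.
  apply: (@continuous_cvg _ _ _ _ _ _ (fun x : R => x ^+ 2)); first exact: exprn_continuous.
  apply/cvgrPdist_lt => e e0.
  have [N NP] := pw (e / 2) ltac:(lra); have [N' NP'] := zz (e / 2) ltac:(lra).
  exists (maxn N N') => // n /=; rewrite geq_max => /andP[/NP k1 /NP' k2].
  apply: le_lt_trans (cabs_dist _ _) _; rewrite (_ : _ - _ = (p n - l) - (zs n - z)); last by ring.
  by apply: le_lt_trans (cabsB _ _) _; lra.
rewrite (_ : (fun n => _) = (fun n => (cabs (zs n - p n) / cabs (p n)) ^+ 2)); last first.
  by apply/funext => n; rewrite expr_div_n.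
rewrite -[X in _ --> X](expr1n _ 2).
apply: (@continuous_cvg _ _ _ _ _ _ (fun x : R => x ^+ 2)); first exact: exprn_continuous.
apply/cvgrPdist_lt => e e0.
have [N NP] := zz 1 ltr01; have [N' NP'] := pw ((cabs z + 1) / e).
exists (maxn N N') => // n /=; rewrite geq_max => /andP[/NP k1 /NP' k2].
have pn0 : 0 < cabs (p n) by rewrite cabs_gt0 UHP_neq0.
rewrite -{1}(divff (lt0r_neq0 pn0)) -mulrBl normrM normfV (gtr0_norm pn0) ltr_pdivrMr//.
apply: le_lt_trans (_ : cabs (zs n) < _).
  rewrite -(cabsN (zs n)) -cabsN (_ : - zs n = - (zs n - p n) - p n); last by ring.
  by rewrite -(cabsN (zs n - p n)) cabsN distrC; exact: cabs_dist.
have k3 : cabs (zs n) < cabs z + 1 by have := cle_dist (zs n) z; lra.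
by apply: lt_trans k3 _; rewrite mulrC -ltr_pdivrMr.
Qed.

Lemma kweight_gt0 (w : option C) z : UHP z -> 0 < kweight w z.
Proof. by move=> z0; case: w => [l|] //=; rewrite exprn_gt0// cabs_gt0 UHP_neq0. Qed.

Lemma seq_conv_Im (u : nat -> C) L : seq_conv_ext u (Some L) -> (fun n => ImC (u n)) @ \oo --> ImC L.
Proof.
move=> h; apply/cvgrPdist_lt => e /h[N NP]; exists N => // n /= /NP k.
by rewrite distrC -ImCB; exact: le_lt_trans (ImC_le _) k.
Qed.

Definition bdry (w : option C) : Prop := if w is Some l then ImC l = 0 else True.

(** Keeping [w] and [v] on the sphere treats the four finite and infinite combinations at once:
    dividing Schwarz-Pick by the weights makes every term converge except Im p and Im q, whose
    normalised ratio only has to stay bounded. *)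
Lemma Julia psi g p q (y : nat -> R) (w v : option C) :
  (forall z, UHP z -> cdiff psi z) -> (forall z, UHP z -> UHP (psi z)) ->
  (forall z, UHP z -> cdiff g z) -> (forall z, UHP z -> UHP (g z)) ->
  (forall n, UHP (p n)) -> (forall n, UHP (q n)) -> (forall n, 0 < y n) ->
  seq_conv_ext (fun n => mk 0 (y n)) (Some 0) ->
  (forall n, q n = psi (p n) + mk 0 (y n)) -> (forall n, g (q n) = p n) ->
  seq_conv_ext p w -> seq_conv_ext q v ->
  (exists2 z, UHP z & psi (g z) = z) \/
  [/\ bdry w, bdry v &
   exists2 K : R, 0 < K & forall z, UHP z -> kdist v (psi z) * ImC z <= K * kdist w z * ImC (psi z)].
Proof.
move=> psd psU gd gU pU qU y0 yz qE gE pw qv.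
have [[z zU zE]|noint] := pselect (exists2 z, UHP z & psi (g z) = z); first by left; exists z.
right.
have wR : bdry w.
  case: w pw => // l pl; apply/eqP; rewrite eq_le (seq_conv_Im_ge0 pU pl) andbT leNgt.
  (* If [p n] tends to an interior [l], then [q n] tends to [psi l] and g (psi l) = l, so [psi l] is
     fixed by psi o g. *)
  apply/negP => lU; apply: noint; exists (psi l); first exact: psU.
  have ql : seq_conv_ext q (Some (psi l + 0)).
    have -> : q = (fun n => (psi \o p) n + mk 0 (y n)) by apply/funext => n; rewrite qE.
    by apply: seq_convD => //; apply: seq_conv_comp => //; apply: cdiff_cont; exact: psd.
  rewrite addr0 in ql.
  have gl : seq_conv_ext (g \o q) (Some (g (psi l))).
    by apply: seq_conv_comp => //; apply: cdiff_cont; apply: gd; exact: psU.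
  have gp : g \o q = p by apply/funext => n; rewrite /= gE.
  by rewrite gp in gl; rewrite (seq_conv_unique gl pl).
have vR : bdry v.
  case: v qv => // l ql; apply/eqP; rewrite eq_le (seq_conv_Im_ge0 qU ql) andbT leNgt.
  apply/negP => lU; apply: noint; exists l => //.
  have gl : seq_conv_ext (g \o q) (Some (g l)).
    by apply: seq_conv_comp => //; apply: cdiff_cont; apply: gd.
  have gp : g \o q = p by apply/funext => n; rewrite /= gE.
  rewrite gp in gl.
  have ql' : seq_conv_ext q (Some (psi (g l) + 0)).
    have -> : q = (fun n => (psi \o p) n + mk 0 (y n)) by apply/funext => n; rewrite qE.
    by apply: seq_convD => //; apply: seq_conv_comp => //; apply: cdiff_cont; apply: psd; exact: gU.
  by rewrite addr0 in ql'; rewrite (seq_conv_unique ql' ql).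
split; [exact: wR|exact: vR|].
have kpos (o : option C) z : UHP z -> bdry o -> 0 < kdist o z.
  case: o => [l|] //= zU l0; rewrite exprn_gt0// cabs_gt0 subr_eq0.
  by apply: contraTneq zU => ->; rewrite /UHP l0 ltxx.
have iU : UHP (ic R) by rewrite /UHP /= ltr01.
pose a n := ImC (p n) / kweight w (p n); pose b n := ImC (q n) / kweight v (q n).
have a0 n : 0 < a n by apply: divr_gt0; [exact: pU|exact: kweight_gt0].
have b0 n : 0 < b n by apply: divr_gt0; [exact: qU|exact: kweight_gt0].
pose kp z n := cabs (z - p n) ^+ 2 / kweight w (p n).
pose kq (zs : nat -> C) n := cabs (zs n - q n) ^+ 2 / kweight v (q n).
(* Schwarz-Pick for [g] between i and [q n] bounds Im (q n) by a multiple of Im (p n), both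
   normalised. *)
have S2 n : kp (g (ic R)) n * b n <= kq (fun=> ic R) n * ImC (g (ic R)) * a n.
  have := Schwarz_Pick gd (fun z zU => ltW (gU z zU)) iU (qU n).
  rewrite gE /= mul1r => h.
  have w0 := kweight_gt0 w (pU n); have v0 := kweight_gt0 v (qU n).
  rewrite /kp /kq /a /b.
  move: (kweight w (p n)) (kweight v (q n)) w0 v0 h => W V W0 V0 h.
  rewrite (_ : _ / W * (_ / V) = (cabs (g (ic R) - p n) ^+ 2 * ImC (q n)) / (W * V)); last by field; rewrite !gt_eqF.
  rewrite (_ : _ / V * _ * (_ / W) = (cabs (ic R - q n) ^+ 2 * (ImC (g (ic R)) * ImC (p n))) / (W * V)); last by field; rewrite !gt_eqF.
  by apply: ler_wpM2r h; rewrite invr_ge0 mulr_ge0// ltW.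
have c1 := kdist_cvg pU pw (seq_conv_cst (g (ic R))).
have c2 := kdist_cvg qU qv (seq_conv_cst (ic R)).
set k1 := kdist w (g (ic R)) in c1; set k2 := kdist v (ic R) in c2.
have k10 : 0 < k1 by apply: kpos => //; exact: gU.
have k20 : 0 < k2 by exact: kpos.
have gi0 : 0 < ImC (g (ic R)) by exact: gU.
pose K := 2 * (k2 + 1) * ImC (g (ic R)) / k1.
have K0 : 0 < K by rewrite divr_gt0// !mulr_gt0//; lra.
have bK : \forall n \near \oo, b n <= K * a n.
  move/cvgrPdist_lt: c1 => /(_ (k1 / 2) ltac:(lra)) c1.
  move/cvgrPdist_lt: c2 => /(_ 1 ltr01) c2.
  near=> n.
  have h1 : `|k1 - kp (g (ic R)) n| < k1 / 2 by near: n.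
  have h2 : `|k2 - kq (fun=> ic R) n| < 1 by near: n.
  move: h1 h2; rewrite !ltr_norml => /andP[_ h1] /andP[h2 _].
  have h3 := S2 n; have ha := a0 n; have hb := b0 n.
  have e1 : k1 / 2 * b n <= kp (g (ic R)) n * b n by rewrite ler_pM2r//; lra.
  have e2 : kq (fun=> ic R) n * ImC (g (ic R)) * a n <= (k2 + 1) * ImC (g (ic R)) * a n.
    by rewrite ler_pM2r// ler_pM2r//; lra.
  rewrite /K (_ : _ / k1 * a n = 2 * ((k2 + 1) * ImC (g (ic R)) * a n) / k1); last by ring.
  by rewrite ler_pdivlMr//; lra.
exists K => // z zU.
pose zs n := psi z + mk 0 (y n).
have zsc : seq_conv_ext zs (Some (psi z)).
  by rewrite -[psi z]addr0; apply: seq_convD => //; exact: seq_conv_cst.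
have d1 := kdist_cvg qU qv zsc; have d2 := kdist_cvg pU pw (seq_conv_cst z).
have d3 := seq_conv_Im zsc.
(* Schwarz-Pick for psi + i y_n, which sends [p n] exactly to [q n], with the ratio bound inserted
   before passing to the limit. *)
have S1 : \forall n \near \oo, kq zs n * ImC z <= K * kp z n * ImC (zs n).
  near=> n.
  have bn : b n <= K * a n by near: n.
  have psnd z' : UHP z' -> cdiff (fun z => psi z + mk 0 (y n)) z'.
    by move=> ?; apply: cdiffD; [exact: psd|exact: cdiff_cst].
  have zn0 z' : UHP z' -> 0 < ImC (psi z' + mk 0 (y n)).
    by move=> /psU; rewrite /UHP ImCD /=; have := y0 n; lra.
  have := Schwarz_Pick psnd (fun z' zU' => ltW (zn0 z' zU')) zU (pU n).
  rewrite -qE -/(zs n) => h.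
  have w0 := kweight_gt0 w (pU n); have v0 := kweight_gt0 v (qU n).
  have A0 := a0 n.
  have zs0 : 0 < ImC (zs n) by exact: zn0.
  have kp0 : 0 <= kp z n by rewrite divr_ge0 ?exprn_ge0 ?cabs_ge0// ltW.
  rewrite -(ler_pM2r A0); apply: (@le_trans _ _ (kp z n * ImC (zs n) * b n)); last first.
    rewrite (_ : K * kp z n * ImC (zs n) * a n = kp z n * ImC (zs n) * (K * a n)); last by ring.
    by apply: ler_wpM2l => //; rewrite mulr_ge0// ltW.
  rewrite /kp /kq /a /b.
  move: (kweight w (p n)) (kweight v (q n)) w0 v0 h => W V W0 V0 h.
  rewrite (_ : _ / V * _ * (_ / W) = (cabs (zs n - q n) ^+ 2 * (ImC z * ImC (p n))) / (W * V)); last by field; rewrite !gt_eqF.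
  rewrite (_ : _ / W * _ * (_ / V) = (cabs (z - p n) ^+ 2 * (ImC (zs n) * ImC (q n))) / (W * V)); last by field; rewrite !gt_eqF.
  by apply: ler_wpM2r h; rewrite invr_ge0 mulr_ge0// ltW.
have l1 : (fun n => kq zs n * ImC z) @ \oo --> kdist v (psi z) * ImC z.
  by apply: cvgM; [exact: d1|exact: cvg_cst].
have l2 : (fun n => K * kp z n * ImC (zs n)) @ \oo --> K * kdist w z * ImC (psi z).
  by apply: cvgM; [apply: cvgM; [exact: cvg_cst|exact: d2]|exact: d3].
exact: ler_cvg_to l1 l2 S1.
Unshelve. all: by end_near.
Qed.

End Julia.

(** * Boundary values *)

Section Nontangential.
Variable R : realType.
Local Notation C := R[i].
Local Notation mk := (@complex.Complex R).
Implicit Types (f phi : C -> C) (z w u L : C) (e d c x y K : R).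

Lemma vertical_cone x t : 0 < t -> cone_at x 1 (mk x t) /\ cabs (mk x t - ofR x) = t.
Proof.
move=> t0; split; first by split => //=; rewrite subrr normr0 mul1r.
rewrite (_ : _ - _ = ic R * ofR t); last by rewrite mkE; ring.
by rewrite cabsM cabs_ic mul1r cabs_ofR gtr0_norm.
Qed.

Lemma ntlim_at_unique f x L L' : ntlim_at f x L -> ntlim_at f x L' -> L = L'.
Proof.
move=> h h'; apply/eqP; rewrite -subr_eq0; apply/eqP/cabs_le_eps => e e0.
have [d [d0 dP]] := h 1 ltr01 (e / 2) ltac:(lra).
have [d' [d'0 dP']] := h' 1 ltr01 (e / 2) ltac:(lra).
pose t := Num.min d d' / 2.
have m0 : 0 < Num.min d d' by rewrite lt_min d0.
have [zc zd] := @vertical_cone x t ltac:(rewrite /t; lra).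
have m1 : Num.min d d' <= d by rewrite ge_min lexx.
have m2 : Num.min d d' <= d' by rewrite ge_min lexx orbT.
have k1 := dP _ zc ltac:(rewrite zd /t; lra); have k2 := dP' _ zc ltac:(rewrite zd /t; lra).
by have := cabs_tri L (f (mk x t)) L'; rewrite [cabs (L - f _)]cabsBC; lra.
Qed.

Lemma ntlim_at_not_infty f x L : ntlim_at f x L -> ~ ntlim_at_infty f x.
Proof.
move=> h h'; have [d [d0 dP]] := h 1 ltr01 1 ltr01.
have [d' [d'0 dP']] := h' 1 ltr01 (cabs L + 1).
pose t := Num.min d d' / 2.
have m0 : 0 < Num.min d d' by rewrite lt_min d0.
have [zc zd] := @vertical_cone x t ltac:(rewrite /t; lra).
have m1 : Num.min d d' <= d by rewrite ge_min lexx.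
have m2 : Num.min d d' <= d' by rewrite ge_min lexx orbT.
have k1 := dP _ zc ltac:(rewrite zd /t; lra); have k2 := dP' _ zc ltac:(rewrite zd /t; lra).
by have := cle_dist (f (mk x t)) L; lra.
Qed.

Lemma vertical_cone_inf t : 0 < t -> cone_inf 1 (mk 0 t) /\ cabs (mk 0 t) = t.
Proof.
move=> t0; have [_] := vertical_cone 0 t0; rewrite subr0; split => //.
by split => //=; rewrite normr0 mul1r.
Qed.

Lemma ntlim_inf_unique f L L' : ntlim_inf f L -> ntlim_inf f L' -> L = L'.
Proof.
move=> h h'; apply/eqP; rewrite -subr_eq0; apply/eqP/cabs_le_eps => e e0.
have [d dP] := h 1 ltr01 (e / 2) ltac:(lra); have [d' dP'] := h' 1 ltr01 (e / 2) ltac:(lra).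
pose t := `|d| + `|d'| + 1; have t0 : 0 < t by rewrite /t ltr_wpDl// addr_ge0.
have [zc zd] := vertical_cone_inf t0.
have n1 := ler_norm d; have n2 := ler_norm d'; have n3 := normr_ge0 d; have n4 := normr_ge0 d'.
have k1 := dP _ zc ltac:(rewrite zd /t; lra); have k2 := dP' _ zc ltac:(rewrite zd /t; lra).
by have := cabs_tri L (f (mk 0 t)) L'; rewrite [cabs (L - f _)]cabsBC; lra.
Qed.

Lemma ntlim_inf_not_infty f L : ntlim_inf f L -> ~ ntlim_inf_infty f.
Proof.
move=> h h'; have [d dP] := h 1 ltr01 1 ltr01; have [d' dP'] := h' 1 ltr01 (cabs L + 1).
pose t := `|d| + `|d'| + 1; have t0 : 0 < t by rewrite /t ltr_wpDl// addr_ge0.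
have [zc zd] := vertical_cone_inf t0.
have n1 := ler_norm d; have n2 := ler_norm d'; have n3 := normr_ge0 d; have n4 := normr_ge0 d'.
have k1 := dP _ zc ltac:(rewrite zd /t; lra); have k2 := dP' _ zc ltac:(rewrite zd /t; lra).
by have := cle_dist (f (mk 0 t)) L; lra.
Qed.

Lemma nt_cluster_inf_lim f L (w : option C) : ntlim_inf f L -> nt_cluster_inf f w -> w = Some L.
Proof.
move=> h.
have lp v : nt_limit_points_inf f v -> v = Some L.
  move=> [c [c0 [zs [zc zi fz]]]].
  have fL : seq_conv_ext (f \o zs) (Some L).
    move=> e e0; have [M MP] := h c c0 e e0; have [N NP] := zi M.
    by exists N => n /NP k; apply: MP.
  case: v fz => [l|] fz; first by rewrite (seq_conv_unique fz fL).
  have [N NP] := fz (cabs L + 1); have [N' NP'] := fL 1 ltr01.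
  have k1 := NP _ (leq_maxl N N'); have k2 := NP' _ (leq_maxr N N').
  by exfalso; have := cle_dist ((f \o zs) (maxn N N')) L; lra.
case: w => [a|] /= H.
  congr Some; apply/eqP; rewrite -subr_eq0; apply/eqP; rewrite -[LHS]opprK opprB.
  rewrite [X in - X](_ : _ = 0) ?oppr0//; apply: cabs_le_eps => e /H[b [/lp[->]] /ltW].
  by [].
have [/lp//|[b [/lp[->]]]] := H (cabs L); by rewrite ltxx.
Qed.

(** In a cone |z - w0|^2 <= (c^2 + 1) (Im z)^2, and since v0 is real Im (x - phi z) is at most A =
    |x - phi z - v0|. One factor A cancels and A = O(Im z). *)
Lemma Julia_ntlim_at phi x w0 v0 K : 0 < K -> ImC w0 = 0 -> ImC v0 = 0 ->
  (forall z, UHP z -> ImC (phi z) < 0) ->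
  (forall z, UHP z -> cabs (ofR x - phi z - v0) ^+ 2 * ImC z <=
     K * cabs (z - w0) ^+ 2 * ImC (ofR x - phi z)) ->
  ntlim_at phi (ReC w0) (ofR x - v0).
Proof.
move=> K0 w0R v0R phU H c c0 e e0.
pose D := K * (c ^+ 2 + 1); have D0 : 0 < D by rewrite mulr_gt0// ltr_wpDl// exprn_ge0// ltW.
exists (e / D); split; first by rewrite divr_gt0.
move=> z [zU zc] zd; have := H z zU; have y0 : 0 < ImC z by [].
set A := cabs _; have AE : cabs (phi z - (ofR x - v0)) = A.
  by rewrite cabsBC; congr cabs; ring.
rewrite AE => HA.
have BA : ImC (ofR x - phi z) <= A.
  apply: le_trans (ler_norm _) _; rewrite (_ : ImC (ofR x - phi z) = ImC (ofR x - phi z - v0)); first exact: ImC_le.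
  by rewrite [RHS]ImCB v0R subr0.
have B0 : 0 < ImC (ofR x - phi z) by rewrite ImCB Im_ofR sub0r oppr_gt0 phU.
have A0 : 0 < A by exact: lt_le_trans BA.
have zw : cabs (z - w0) ^+ 2 <= (c ^+ 2 + 1) * ImC z ^+ 2.
  rewrite cabs_sqr ReCB ImCB w0R subr0 mulrDl mul1r lerD2r -exprMn -real_normK ?num_real//.
  by apply: lerXn2r (ltW zc); rewrite nnegrE// mulr_ge0 ?ltW.
have h1 : A ^+ 2 * ImC z <= K * ((c ^+ 2 + 1) * ImC z ^+ 2) * A.
  apply: le_trans HA _; apply: ler_pM => //; last by apply: ler_wpM2l zw; exact: ltW.
    by rewrite mulr_ge0 ?exprn_ge0 ?cabs_ge0// ltW.
  exact: ltW.
have h2 : A <= D * ImC z.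
  rewrite -(ler_pM2r (mulr_gt0 A0 y0)); apply: le_trans (le_trans _ h1) _.
    by rewrite expr2 mulrA.
  by rewrite /D (_ : K * ((c ^+ 2 + 1) * ImC z ^+ 2) * A = K * (c ^+ 2 + 1) * ImC z * (A * ImC z))//; ring.
apply: le_lt_trans h2 _; rewrite mulrC -ltr_pdivlMr//; apply: le_lt_trans zd.
by apply: le_trans (ler_norm _) _; have := ImC_le (z - ofR (ReC w0)); rewrite ImCB Im_ofR subr0.
Qed.

(** In a cone the hypothesis becomes 1 <= D (Im z) |phi z|. *)
Lemma Julia_ntlim_at_infty phi x w0 K : 0 < K -> ImC w0 = 0 ->
  (forall z, UHP z -> ImC (phi z) < 0) ->
  (forall z, UHP z -> ImC z <= K * cabs (z - w0) ^+ 2 * ImC (ofR x - phi z)) ->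
  ntlim_at_infty phi (ReC w0).
Proof.
move=> K0 w0R phU H c c0 e.
pose D := K * (c ^+ 2 + 1); have D0 : 0 < D by rewrite mulr_gt0// ltr_wpDl// exprn_ge0// ltW.
have ep : 0 < `|e| + 1 by rewrite ltr_wpDl.
exists (D * (`|e| + 1))^-1; split; first by rewrite invr_gt0 mulr_gt0.
move=> z [zU zc] zd; have := H z zU; have y0 : 0 < ImC z by [].
rewrite ImCB Im_ofR sub0r.
have B0 : 0 < - ImC (phi z) by rewrite oppr_gt0 phU.
have BA : - ImC (phi z) <= cabs (phi z) by apply: le_trans (ImC_le _); rewrite -normrN ler_norm.
have zw : cabs (z - w0) ^+ 2 <= (c ^+ 2 + 1) * ImC z ^+ 2.
  rewrite cabs_sqr ReCB ImCB w0R subr0 mulrDl mul1r lerD2r -exprMn -real_normK ?num_real//.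
  by apply: lerXn2r (ltW zc); rewrite nnegrE// mulr_ge0 ?ltW.
move=> h.
have h1 : ImC z <= K * ((c ^+ 2 + 1) * ImC z ^+ 2) * (- ImC (phi z)).
  by apply: le_trans h _; rewrite ler_pM2r// ler_pM2l.
have h2 : 1 <= D * ImC z * (- ImC (phi z)).
  rewrite -(ler_pM2r y0) mul1r; apply: le_trans h1 _.
  by rewrite /D (_ : K * ((c ^+ 2 + 1) * ImC z ^+ 2) * _ = K * (c ^+ 2 + 1) * ImC z * (- ImC (phi z)) * ImC z)//; ring.
have yd : ImC z < (D * (`|e| + 1))^-1.
  apply: le_lt_trans zd; apply: le_trans (ler_norm _) _.
  by have := ImC_le (z - ofR (ReC w0)); rewrite ImCB Im_ofR subr0.
have yD : D * ImC z < (`|e| + 1)^-1.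
  rewrite mulrC -ltr_pdivlMr//; apply: lt_le_trans yd _; rewrite invfM mulrC//.
apply: lt_le_trans BA; apply: le_lt_trans (ler_norm e) _.
have Dy : 0 < D * ImC z by rewrite mulr_gt0.
apply: (@lt_le_trans _ _ (D * ImC z)^-1); last by rewrite -(ler_pM2l Dy) divff ?gt_eqF.
apply: (@lt_trans _ _ (`|e| + 1)); first by rewrite ltrDl.
by rewrite -[ltLHS]invrK ltf_pV2 ?posrE ?invr_gt0.
Qed.

(** As at a finite point, one factor |x - phi z - v0| cancels, leaving its product with Im z bounded
    by [K]; in a cone Im z grows like |z|. *)
Lemma Julia_ntlim_inf phi x v0 K : 0 < K -> ImC v0 = 0 ->
  (forall z, UHP z -> ImC (phi z) < 0) ->
  (forall z, UHP z -> cabs (ofR x - phi z - v0) ^+ 2 * ImC z <= K * ImC (ofR x - phi z)) ->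
  ntlim_inf phi (ofR x - v0).
Proof.
move=> K0 v0R phU H c c0 e e0.
exists ((c + 1) * (K / e)) => z [zU zc] zM; have := H z zU; have y0 : 0 < ImC z by [].
set A := cabs _; have AE : cabs (phi z - (ofR x - v0)) = A.
  by rewrite cabsBC; congr cabs; ring.
rewrite AE => HA.
have BA : ImC (ofR x - phi z) <= A.
  apply: le_trans (ler_norm _) _; rewrite (_ : ImC (ofR x - phi z) = ImC (ofR x - phi z - v0)); first exact: ImC_le.
  by rewrite [RHS]ImCB v0R subr0.
have B0 : 0 < ImC (ofR x - phi z) by rewrite ImCB Im_ofR sub0r oppr_gt0 phU.
have A0 : 0 < A by exact: lt_le_trans BA.
have h1 : A * ImC z <= K.
  rewrite -(ler_pM2r A0); apply: (@le_trans _ _ (A ^+ 2 * ImC z)); first by rewrite expr2 mulrAC.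
  by apply: le_trans HA _; rewrite ler_pM2l.
have zy : K / e < ImC z.
  have cz : cabs z <= (c + 1) * ImC z.
    by apply: le_trans (cabs_le _) _; rewrite (gtr0_norm y0) mulrDl mul1r lerD2r ltW.
  by have := lt_le_trans zM cz; rewrite ltr_pM2l//; lra.
rewrite ltr_pdivrMr// in zy.
by rewrite -(ltr_pM2r y0); apply: le_lt_trans h1 _; rewrite mulrC.
Qed.

(** If Im phi vanishes at one point, Schwarz-Pick makes phi a real constant, which is then its
    nontangential limit at 0. *)
Lemma Im_lt0_of_ntlim phi : (forall z, UHP z -> cdiff phi z) -> (forall z, UHP z -> ImC (phi z) <= 0) ->
  ~ (exists L, ImC L = 0 /\ ntlim_at phi 0 L) -> forall z, UHP z -> ImC (phi z) < 0.
Proof.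
move=> phd phv nl z zU; rewrite lt_neqAle phv// andbT; apply/eqP => p0.
apply: nl; exists (phi z); split => // c c0 e e0; exists 1; split => // w [wU _] _.
have := @Schwarz_Pick _ (fun z => - phi z) w z.
have fd z' : UHP z' -> cdiff (fun z => - phi z) z' by move=> /phd; exact: cdiffN.
have fU z' : UHP z' -> 0 <= ImC (- phi z') by move=> /phv; rewrite ImCN oppr_ge0.
move=> /(_ fd fU wU zU); rewrite -opprD cabsN !ImCN p0 oppr0 mulr0 mulr0.
rewrite pmulr_lle0; last by rewrite mulr_gt0.
rewrite le_eqVlt ltNge exprn_ge0 ?cabs_ge0// orbF expf_eq0 /= => /eqP ->.
exact: e0.
Qed.

End Nontangential.

(** * Every real point is a value of K in the open half-plane *)

Section BoundaryPoint.
Variables (R : realType) (mu nu rho : probability R R) (phi : R[i] -> R[i]).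
Local Notation C := R[i].
Local Notation mk := (@complex.Complex R).
Implicit Types (z u : C) (x : R).
Hypothesis (Hv : exists a M b N : R, voiculescu_on mu phi a M b N).
Hypothesis (phd : forall z, UHP z -> cdiff phi z).
Hypothesis (phU : forall z, UHP z -> ImC (phi z) < 0).
Hypothesis (H1 : forall x : R,
      (exists L, ntlim_at phi x L /\ ImC L < 0) \/
      ((~ exists L, ntlim_at phi x L) /\ ~ ntlim_at_infty phi x)).
Hypothesis (H2 : ntlim_inf_infty phi \/
        (exists L, ntlim_inf phi L /\ ImC L < 0) \/
        (exists w1 w2, w1 <> w2 /\ nt_cluster_inf phi w1 /\ nt_cluster_inf phi w2)).
Hypothesis (sub : forall z, UHP z -> Ftr nu (z - phi (Ftr rho z)) = Ftr rho z).

(** The alternatives of [Julia], applied along x + i / (n + 1), are an interior fixed point of z ->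
    x - phi(F_nu(z)), which is the desired [q], or a boundary pair (w, v), contradictory in all four
    cases. *)
Lemma boundary_fixpoint x : exists2 q : C, UHP q & q + phi (Ftr nu q) = ofR x.
Proof.
pose psi z := ofR x - phi z.
pose y (n : nat) : R := n.+1%:R^-1.
have y0 n : 0 < y n by rewrite invr_gt0.
pose z n := mk x (y n); have zU n : UHP (z n) by exact: y0.
pose p n := Ftr rho (z n); have pU n : UHP (p n) by exact: Ftr_UHP.
pose q n := psi (p n) + mk 0 (y n).
have qE n : q n = z n - phi (p n) by rewrite /q /psi /z !mkE (_ : ofR 0 = 0)//; ring.
have qU n : UHP (q n).
  rewrite /UHP qE ImCB /=; have := phU (pU n); have := y0 n; lra.
have psd w : UHP w -> cdiff psi w by move=> wU; apply: cdiffB; [exact: cdiff_cst|exact: phd].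
have psU w : UHP w -> UHP (psi w) by move=> wU; rewrite /UHP ImCB Im_ofR sub0r oppr_gt0 phU.
have gE n : Ftr nu (q n) = p n by rewrite qE sub.
have yc : seq_conv_ext (fun n => mk 0 (y n)) (Some 0).
  move=> e e0; exists (Num.truncn e^-1) => n Nn; rewrite subr0.
  have [_ ->] := vertical_cone_inf (y0 n).
  rewrite -[ltRHS]invrK ltf_pV2 ?posrE ?invr_gt0 ?ltr0n//.
  by apply: lt_le_trans (truncnS_gt _) _; rewrite ler_nat.
have [s1 s1n [w pw]] := subseq_ext p.
have [s2 s2n [v qv]] := subseq_ext (q \o s1).
have pw' := seq_conv_sub s2n pw.
have sn n : (n <= s1 (s2 n))%N by exact: leq_trans (s1n _).
have := @Julia _ psi (Ftr nu) (p \o s1 \o s2) (q \o s1 \o s2) (y \o s1 \o s2) w v psd psU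
  (fun z => @cdiff_Ftr _ nu z) (fun z => @Ftr_UHP _ nu z) (fun n => pU _) (fun n => qU _) (fun n => y0 _)
  (seq_conv_sub (s := s1 \o s2) sn yc) (fun n => erefl) (fun n => gE _) pw' qv.
case=> [[u uU uE]|[wb vb [K K0 H]]].
  by exists u => //; rewrite -[X in X + _]uE /psi; ring.
exfalso; case: w wb H {pw pw'} => [w0|] wb; case: v vb {qv} => [v0|] vb H; rewrite /= in wb vb H.
(* w and v finite: phi would have the real limit x - v at w. *)
- have nt := Julia_ntlim_at K0 wb vb phU H.
  have [[L [Ll L0]]|[no _]] := H1 (ReC w0); last by apply: no; eexists; exact: nt.
  by move: L0; rewrite (ntlim_at_unique Ll nt) ImCB Im_ofR vb subrr ltxx.
- have nt : ntlim_at_infty phi (ReC w0).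
    by apply: (Julia_ntlim_at_infty K0 wb phU (x := x)) => z' z'U; have := H _ z'U; rewrite mul1r.
  have [[L [Ll _]]|[_ no]] := H1 (ReC w0); last exact: no.
  exact: ntlim_at_not_infty Ll nt.
(* w infinite, v finite: a finite real limit at infinity contradicts each of (i), (ii), (iii). *)
- have nt : ntlim_inf phi (ofR x - v0).
    by apply: (Julia_ntlim_inf K0 vb phU) => z' z'U; have := H _ z'U; rewrite mulr1.
  case: H2 => [i|[[L [Ll L0]]|[w1 [w2 [w12 [c1 c2]]]]]].
  + exact: ntlim_inf_not_infty nt i.
  + by move: L0; rewrite (ntlim_inf_unique Ll nt) ImCB Im_ofR vb subrr ltxx.
  + by apply: w12; rewrite (nt_cluster_inf_lim nt c1) (nt_cluster_inf_lim nt c2).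
(* Both infinite: the inequality reads Im z <= K Im (- phi z), while |phi(i t)| <= t / (2 K) for
   some large t. *)
- have [a [M [b [N vv]]]] := Hv; have [_ _ b0 N0 _] := vv.
  have e0 : 0 < (2 * K)^-1 by rewrite invr_gt0 mulr_gt0.
  have [N' NN' N'P] := voiculescu_small vv e0.
  pose t := N' + 1; have t0 : 0 < t by rewrite /t; lra.
  have [_ tE] := vertical_cone_inf t0.
  have tG : Gamma b N' (mk 0 t).
    by split; [rewrite tE /t; lra|rewrite /= normr0 mulr0].
  have := N'P _ tG; rewrite tE => k1.
  have := H (mk 0 t) t0; rewrite mul1r mulr1 /psi ImCB Im_ofR sub0r /= => k2.
  have k3 : - ImC (phi (mk 0 t)) <= cabs (phi (mk 0 t)) by apply: le_trans (ImC_le _); rewrite -normrN ler_norm.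
  have : t <= K * ((2 * K)^-1 * t) by apply: le_trans k2 _; rewrite ler_pM2l//; exact: le_trans k3 k1.
  rewrite (_ : K * _ = t / 2); first lra.
  by field; rewrite gt_eqF.
Qed.

End BoundaryPoint.

(** * Analytic continuation across the real line *)

Section LocalInverse.
Variable R : realType.
Local Notation C := R[i].
Local Notation mk := (@complex.Complex R).
Implicit Types (f g h : C -> C) (a b z w q : C) (e d r : R).

Lemma quotient_cdiff f h b z : (forall w, f w = f b + h w * (w - b)) -> z != b -> cdiff f z -> cdiff h z.
Proof.
move=> fE zb fd; apply: (@cdiff_near _ (fun w => (f w - f b) / (w - b))).
  exists (cabs (z - b)); first by rewrite cabs_gt0 subr_eq0.
  move=> w k; have wb : w != b by apply: contraTneq k => ->; rewrite cabsBC ltxx.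
  by rewrite [f w]fE [X in X / _](_ : _ = h w * (w - b)) ?mulfK ?subr_eq0//; ring.
apply: cdiff_div; rewrite ?subr_eq0//; last exact: cdiff_sub.
by apply: cdiffB; [exact: fd|exact: cdiff_cst].
Qed.

(* Maximum principle for the difference quotient of [f w - h q * w]. *)
Lemma linear_approx f h q (rho e : R) : 0 < rho -> (forall z, cabs (z - q) < rho -> cdiff f z) ->
  ccont h q -> (forall w, f w = f q + h w * (w - q)) -> 0 < e ->
  exists2 d : R, 0 < d & d < rho /\ forall a b, cabs (a - q) < d -> cabs (b - q) < d ->
    cabs (f a - f b - h q * (a - b)) <= e * cabs (a - b).
Proof.
move=> rho0 fd hc fE e0; have e4 : 0 < e / 4 by lra.
have [d1 d10 dP] := hc _ e4.
pose r := Num.min d1 rho / 2.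
have m1 : Num.min d1 rho <= d1 by rewrite ge_min lexx.
have m2 : Num.min d1 rho <= rho by rewrite ge_min lexx orbT.
have m0 : 0 < Num.min d1 rho by rewrite lt_min d10.
have r0 : 0 < r by rewrite /r; lra. have rd : r < d1 by rewrite /r; lra. have rr : r < rho by rewrite /r; lra.
move: r r0 rd rr {m0 m1 m2} => r r0 rd rr.
exists (r / 2); first lra.
split; first lra.
move=> a b aq bq; pose g w := f w - h q * w.
have gE w : g w = g q + (h w - h q) * (w - q) by rewrite /g [f w]fE; ring.
have gd z : cabs (z - q) < rho -> cdiff g z.
  by move=> /fd fz; apply: cdiffB => //; apply: cdiffM; [exact: cdiff_cst|exact: cdiff_id].
have gb w : cabs (w - q) <= r -> cabs (g w - g q) <= e / 4 * r.
  move=> wr; rewrite gE (_ : _ - _ = (h w - h q) * (w - q)); last by ring.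
  by rewrite cabsM; apply: ler_pM; rewrite ?cabs_ge0//; apply/ltW/dP; lra.
have [k [kc kE]] : cdiff g b by apply: gd; lra.
have kd z : cabs (z - q) < rho -> z != b -> cdiff k z.
  by move=> zq zb; apply: (quotient_cdiff kE zb); exact: gd.
have kcz z : cabs (z - q) < rho -> ccont k z.
  by move=> zq; have [->//|zb] := eqVneq z b; apply: cdiff_cont; exact: kd.
have ka : cabs (k a) <= e.
  apply: (@max_principle _ k [set w | cabs (w - q) <= r] [set w | cabs (w - q) < r] (cabs q + r) e).
  - by move=> z /= zq; have := cabsD (z - q) q; rewrite subrK; lra.
  - move=> z H /=; rewrite leNgt; apply/negP => zr.
    have [w /= wq wz] := H (cabs (z - q) - r) ltac:(lra).
    by have := cabs_tri z w q; rewrite [cabs (z - w)]cabsBC; lra.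
  - by move=> z /= zq; apply: kcz; lra.
  - move=> z /= zr.
    (* The disc avoids [b] unless centred there, where [holo_at] only asks for continuity. *)
    pose s := if z == b then r - cabs (z - q) else Num.min (r - cabs (z - q)) (cabs (z - b)).
    have s0 : 0 < s by rewrite /s; case: eqVneq => zb; rewrite ?lt_min ?subr_gt0// zr cabs_gt0 subr_eq0.
    have sr : s <= r - cabs (z - q) by rewrite /s; case: ifP; rewrite ?lexx// ge_min lexx.
    have inn w : cabs (w - z) < s -> cabs (w - q) < r by have := cabs_tri w z q; lra.
    exists s => //; split; last by move=> w /inn /ltW.
    split => w; first by move=> /inn wr; apply: kcz; lra.
    move=> /andP[w0 ws]; apply: kd; first by have := inn _ ws; lra.
    move: ws; rewrite /s; case: eqVneq => [zb _|zb]; first by rewrite -zb -subr_eq0 -cabs_gt0.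
    rewrite lt_min => /andP[_]; apply: contraTneq => ->; by rewrite cabsBC ltxx.
  - move=> z /= zr /negP; rewrite -leNgt => rz.
    have zb : r / 2 <= cabs (z - b) by have := cabs_tri z b q; lra.
    have kz : k z * (z - b) = g z - g b by rewrite [g z]kE; ring.
    have : cabs (k z) * cabs (z - b) <= e / 2 * r.
      rewrite -cabsM kz (_ : g z - g b = (g z - g q) - (g b - g q)); last by ring.
      apply: le_trans (cabsB _ _) _; have := gb _ zr; have := gb b ltac:(lra); lra.
    have kz0 := cabs_ge0 (k z); have : cabs (k z) * (r / 2) <= cabs (k z) * cabs (z - b) by apply: ler_wpM2l.
    move=> h1 h2; rewrite -(@ler_pM2r _ (r / 2)); lra.
  - by rewrite /=; lra.
rewrite (_ : _ - _ = g a - g b); last by rewrite /g; ring.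
rewrite [g a]kE (_ : _ - _ = k a * (a - b)); last by ring.
by rewrite cabsM; apply: ler_wpM2r => //; exact: cabs_ge0.
Qed.

(** [linear_approx] makes [f] expand distances by at least m / 2 near [q]. A preimage of [z] is a
    minimiser of |f a - z| on a closed disc: the expansion keeps it off the boundary, and at an
    interior point with nonzero value [leading_move] towards [z] would decrease the modulus. *)
Lemma local_inverse f h q (rho : R) : 0 < rho -> (forall z, cabs (z - q) < rho -> cdiff f z) ->
  ccont h q -> (forall w, f w = f q + h w * (w - q)) -> h q != 0 ->
  exists2 eta : R, 0 < eta & exists om : C -> C, forall z, cabs (z - f q) < eta ->
    [/\ cabs (om z - q) < rho, f (om z) = z & cdiff om z].
Proof.
move=> rho0 fd hc fE hq; set m := cabs (h q); have m0 : 0 < m by rewrite cabs_gt0.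
have [d d0 [dr lin]] := @linear_approx f h q rho (m / 2) rho0 fd hc fE ltac:(lra).
have lip a b : cabs (a - q) < d -> cabs (b - q) < d -> m / 2 * cabs (a - b) <= cabs (f a - f b).
  move=> ad bd; have := lin _ _ ad bd.
  have := cle_dist (h q * (a - b)) (f a - f b); rewrite cabsM -/m [cabs (_ - (f a - f b))]cabsBC; lra.
pose r := d / 2; have r0 : 0 < r by rewrite /r; lra.
(* On the circle of radius [r] values of [f] are at least m r / 2 away from [f q], hence further
   from [z] than [f q] is. *)
have ex z : cabs (z - f q) < m * r / 4 -> exists a, cabs (a - q) < r /\ f a = z.
  move=> zq.
  have fc a : cabs (a - q) <= r -> ccont f a.
    by move=> ar; apply: cdiff_cont; apply: fd; rewrite /r in ar; lra.
  have [||||a0 /= a0r a0m] := @complex_EVT _ [set a | cabs (a - q) <= r] (fun a => - cabs (f a - z)) (cabs q + r).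
  - by exists q; rewrite /= subrr cabs0 ltW.
  - by move=> a /= aq; have := cabsD (a - q) q; rewrite subrK; lra.
  - move=> a H /=; rewrite leNgt; apply/negP => zr.
    have [w /= wq wz] := H (cabs (a - q) - r) ltac:(lra).
    by have := cabs_tri a w q; rewrite [cabs (a - w)]cabsBC; lra.
  - move=> a /fc ac e /ac[e' e'0 eP]; exists e' => // w _ /eP; apply: le_lt_trans.
    rewrite opprK addrC distrC; apply: le_trans (cabs_dist _ _) _.
    by rewrite (_ : f w - z - (f a - z) = f w - f a)//; ring.
  have min0 : cabs (f a0 - z) <= cabs (f q - z).
    by have := a0m q; rewrite /= subrr cabs0 lerN2; apply; exact: ltW.
  rewrite [cabs (f q - z)]cabsBC in min0.
  have a0i : cabs (a0 - q) < r.
    rewrite lt_neqAle a0r andbT; apply/eqP => aE.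
    have := lip a0 q; rewrite aE subrr cabs0 => /(_ ltac:(rewrite /r; lra) d0) k.
    have := cabs_tri (f a0) z (f q); rewrite /r in k zq *; lra.
  exists a0; split => //; apply/eqP; rewrite -subr_eq0; apply/negPn/negP => ne.
  have s0 : 0 < r - cabs (a0 - q) by lra.
  have inn w : cabs (w - a0) < r - cabs (a0 - q) -> cabs (w - q) < r by have := cabs_tri w a0 q; lra.
  have hol : holo_at f a0 (r - cabs (a0 - q)).
    by apply: holo_cdiff => w /inn wr; apply: fd; rewrite /r in wr; lra.
  have [cst|ld] := const_or_leading s0 hol.
    pose w := a0 + ofR ((r - cabs (a0 - q)) / 2).
    have wa : cabs (w - a0) = (r - cabs (a0 - q)) / 2.
      rewrite /w (_ : _ - a0 = ofR ((r - cabs (a0 - q)) / 2)); last by ring.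
      by rewrite cabs_ofR gtr0_norm//; lra.
    have wi : cabs (w - a0) < r - cabs (a0 - q) by rewrite wa; lra.
    have := lip w a0; rewrite (cst _ wi) subrr cabs0 wa => k.
    have := k ltac:(have := inn _ wi; rewrite /r; lra) ltac:(rewrite /r in a0i; lra).
    rewrite leNgt => /negP; apply; rewrite mulr_gt0; lra.
  have F0 : 0 < cabs (f a0 - z) by rewrite cabs_gt0.
  have ne' : - (f a0 - z) != 0 by rewrite oppr_eq0.
  have [w [t [wr t0 t1 _ H]]] := leading_move ld ne' s0 (ltac:(lra) : 0 < cabs (f a0 - z) / 2).
  have := a0m w (ltW (inn _ wr)); rewrite lerN2 => k.
  have : cabs (f w - z) <= (1 - t) * cabs (f a0 - z) + cabs (f a0 - z) / 2 * t.
    rewrite (_ : f w - z = ofR (1 - t) * (f a0 - z) + (f w - f a0 - ofR t * - (f a0 - z))); last first.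
      by rewrite ofRB (_ : ofR 1 = 1)//; ring.
    apply: le_trans (cabsD _ _) _; rewrite cabsM cabs_ofR ger0_norm; [lra|lra].
  by nra.
have [om omP] : exists om : C -> C, forall z, cabs (z - f q) < m * r / 4 -> cabs (om z - q) < r /\ f (om z) = z.
  have /choice[om omP] : forall z, exists a, cabs (z - f q) < m * r / 4 -> cabs (a - q) < r /\ f a = z.
    move=> z; have [h1|h1] := pselect (cabs (z - f q) < m * r / 4); last by exists 0.
    by have [a aP] := ex _ h1; exists a.
  by exists om.
exists (m * r / 4); first by rewrite divr_gt0// mulr_gt0.
exists om => z zq; have [oz fz] := omP _ zq.
split => //; first by rewrite /r in oz; lra.
have near0 : 0 < m * r / 4 - cabs (z - f q) by lra.
have near w : cabs (w - z) < m * r / 4 - cabs (z - f q) -> cabs (w - f q) < m * r / 4.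
  by have := cabs_tri w z (f q); lra.
have omc : ccont om z.
  move=> e e0; have em : 0 < m / 2 * e by rewrite mulr_gt0//; lra.
  exists (Num.min (m * r / 4 - cabs (z - f q)) (m / 2 * e)); first by rewrite lt_min near0.
  move=> w; rewrite lt_min => /andP[/near /omP[ow fw] we].
  have := lip (om w) (om z); rewrite fw fz => k.
  have mm : 0 < m / 2 by lra.
  rewrite -(ltr_pM2l mm); apply: le_lt_trans we; apply: k; rewrite /r in ow oz; lra.
have [k [kc kE]] : cdiff f (om z) by apply: fd; rewrite /r in oz; lra.
(* A zero derivative would contradict the lower bound [lip] close to [om z]. *)
have k0 : k (om z) != 0.
  apply/eqP => kz; have [d1 d10 d1P] := kc (m / 4) ltac:(lra).
  pose s := Num.min d1 (d - cabs (om z - q)).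
  have sp : 0 < s by rewrite lt_min d10; rewrite /r in oz; lra.
  have s1 : s <= d1 by rewrite ge_min lexx.
  have s2 : s <= d - cabs (om z - q) by rewrite ge_min lexx orbT.
  pose w := om z + ofR (s / 2).
  have wo : w - om z = ofR (s / 2) by rewrite /w; ring.
  have wa : cabs (w - om z) = s / 2 by rewrite wo cabs_ofR gtr0_norm//; lra.
  have := d1P w; rewrite wa kz subr0 => /(_ ltac:(lra)) kw.
  have wd : cabs (w - q) < d by have := cabs_tri w (om z) q; lra.
  have := lip w (om z) wd ltac:(rewrite /r in oz; lra).
  rewrite [f w]kE (_ : f (om z) + k w * (w - om z) - f (om z) = k w * (w - om z)); last by ring.
  rewrite cabsM wa; have : cabs (k w) * (s / 2) <= m / 4 * (s / 2) by rewrite ler_pM2r; lra.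
  by have := mulr_gt0 m0 sp; lra.
(* [om] is an arbitrary choice outside the disc, so its slope 1 / k(om w) is exhibited only
   locally. *)
apply: (@cdiff_near _ (fun w => om z + (k (om w))^-1 * (w - z))).
  have kom : ccont (fun w => k (om w)) z by exact: ccont_comp.
  have [d2 d20 d2P] := ccont_neq0 kom k0.
  exists (Num.min (m * r / 4 - cabs (z - f q)) d2); first by rewrite lt_min near0.
  move=> w; rewrite lt_min => /andP[/near /omP[ow fw] /d2P kw].
  have kn : k (om w) != 0 by rewrite -cabs_gt0; apply: lt_le_trans kw; rewrite divr_gt0// cabs_gt0.
  have wz : w - z = k (om w) * (om w - om z) by rewrite -{1}fw -{1}fz [f (om w)]kE; ring.
  by rewrite wz mulrA mulVf// mul1r addrC subrK.
exists (fun w => (k (om w))^-1); split; last by move=> w; rewrite subrr mulr0 addr0.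
by apply: ccontV => //; exact: ccont_comp.
Qed.

End LocalInverse.

(** * Injectivity of K and continuation of the Cauchy transform *)

Section Extension.
Variables (R : realType) (nu rho : probability R R) (phi : R[i] -> R[i]).
Local Notation C := R[i].
Implicit Types (z u : C) (x : R).
Hypothesis (phd : forall z, UHP z -> cdiff phi z).
Hypothesis (phU : forall z, UHP z -> ImC (phi z) < 0).
Hypothesis (sub : forall z, UHP z -> Ftr nu (z - phi (Ftr rho z)) = Ftr rho z).

(* Left inverse of the subordination function [z |-> z - phi (Ftr rho z)]. *)
Definition omega_inv (q : C) : C := q + phi (Ftr nu q).

Lemma omega_inv_cdiff z : UHP z -> cdiff omega_inv z.
Proof.
move=> zU; apply: (@cdiffD _ id (fun q => phi (Ftr nu q))); first exact: cdiff_id.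
by apply: (@cdiff_comp _ phi); [exact: cdiff_Ftr|apply: phd; exact: Ftr_UHP].
Qed.

Lemma omega_inv_omega z : UHP z -> omega_inv (z - phi (Ftr rho z)) = z.
Proof. by move=> zU; rewrite /omega_inv sub// subrK. Qed.

Lemma omega_UHP z : UHP z -> UHP (z - phi (Ftr rho z)).
Proof. by move=> zU; rewrite /UHP ImCB; have := phU (Ftr_UHP rho zU); move: zU; rewrite /UHP; lra. Qed.

(** Schwarz-Pick for q - K(q) = - phi(F_nu(q)), a self-map of the half-plane even where K leaves
    it. *)
Lemma omega_inv_Schwarz_Pick (a b : C) : UHP a -> UHP b ->
  cabs ((a - omega_inv a) - (b - omega_inv b)) ^+ 2 * (ImC a * ImC b) <=
  cabs (a - b) ^+ 2 * ((ImC a - ImC (omega_inv a)) * (ImC b - ImC (omega_inv b))).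
Proof.
move=> aU bU; rewrite -!ImCB; apply: (@Schwarz_Pick _ (fun q => q - omega_inv q)) => //.
  by move=> z zU; apply: cdiffB; [exact: cdiff_id|exact: omega_inv_cdiff].
move=> z zU; rewrite (_ : z - omega_inv z = - phi (Ftr nu z)); last by rewrite /omega_inv; ring.
by rewrite ImCN oppr_ge0 ltW// phU//; exact: Ftr_UHP.
Qed.

(** For K(a) = K(b) = z the squared distances cancel, leaving Im a Im b <= (Im a - Im z)(Im b - Im
    z), which is false when 0 < Im z < Im a, Im b. *)
Lemma omega_inv_inj (a b : C) : UHP a -> UHP b -> UHP (omega_inv a) -> omega_inv a = omega_inv b -> a = b.
Proof.
move=> aU bU; set z := omega_inv a => zU zE; have := omega_inv_Schwarz_Pick aU bU; rewrite -zE -/z.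
rewrite (_ : a - z - (b - z) = a - b); last by ring.
move=> h; apply/eqP; rewrite -subr_eq0 -cabs_eq0; apply/negPn/negP => ne.
have X0 : 0 < cabs (a - b) ^+ 2 by rewrite exprn_gt0// lt_def ne cabs_ge0.
have az : ImC z < ImC a by rewrite /z /omega_inv ImCD gtrDl phU//; exact: Ftr_UHP.
have bz : ImC z < ImC b by rewrite zE /omega_inv ImCD gtrDl phU//; exact: Ftr_UHP.
rewrite ler_pM2l// in h; move: zU aU bU h az bz; rewrite /UHP; nra.
Qed.

(** As Im K(q) = 0, Schwarz-Pick between [w] and [q] reduces to |1 - h(w)|^2 Im w <= Im w - Im K(w).
    If h(q) = 0, [w] can be chosen near [q] with h(w) close to - t: the left side gains at least t
    Im w, the right side at most (3 t / 2) |w - q|. *)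
Lemma omega_inv_deriv_neq0 (q : C) (h : C -> C) : UHP q -> ImC (omega_inv q) = 0 -> ccont h q ->
  (forall w, omega_inv w = omega_inv q + h w * (w - q)) -> h q != 0.
Proof.
move=> qU qR hc hE; apply/eqP => hq.
have hol : holo_at h q (ImC q).
  have hd z : cabs (z - q) < ImC q -> z != q -> cdiff h z.
    by move=> zq zn; apply: (quotient_cdiff hE zn); apply: omega_inv_cdiff; exact: UHP_disc zq.
  split => z; last by move=> /andP[z0 zq]; apply: hd => //; rewrite -subr_eq0 -cabs_gt0.
  by move=> zq; have [->//|zn] := eqVneq z q; apply: cdiff_cont; exact: hd.
(* A constant [h] would be zero and K constant, with the real value K(q); but K(omega(i)) = i. *)
have [cst|ld] := const_or_leading qU hol.
  have z0 w : UHP w -> omega_inv w - omega_inv q = 0.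
    apply: (@identity_UHP _ (fun w => omega_inv w - omega_inv q) q (ImC q)) => //.
      by move=> z zU; apply: cdiffB; [exact: omega_inv_cdiff|exact: cdiff_cst].
    by move=> w' /cst k; rewrite hE k hq mul0r addr0 subrr.
  have iU : UHP (ic R) by rewrite /UHP /= ltr01.
  have := z0 _ (omega_UHP iU); rewrite omega_inv_omega// => /(congr1 (@ImC R)).
  by rewrite ImCB qR /= subr0 => /eqP; rewrite oner_eq0.
have q0 : 0 < ImC q by [].
(* Radius Im q / 4 gives Im w > 3 Im q / 4, while the right-hand gain is at most 3 t Im q / 8. *)
have [w [t [wq t0 _ wn H]]] := leading_move ld (ltac:(by rewrite oppr_eq0 oner_eq0) : (-1 : C) != 0)
  (ltac:(lra) : 0 < ImC q / 4) (ltac:(lra) : (0 : R) < 2^-1).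
rewrite hq subr0 mulrN mulr1 opprK in H.
have wU : UHP w by apply: (UHP_disc qU); lra.
have wI : 3 * (ImC q / 4) < ImC w.
  by have := le_lt_trans (ImC_le _) wq; rewrite ImCB ltr_norml; lra.
have D1 : ReC (h w) <= - t / 2.
  have := le_trans (ReC_le _) H; rewrite ReCD Re_ofR ler_norml; lra.
have D2 : cabs (h w) <= 3 * t / 2.
  by have := cle_dist (h w) (- ofR t); rewrite opprK cabsN cabs_ofR gtr0_norm//; lra.
have := omega_inv_Schwarz_Pick wU qU; rewrite qR subr0.
have -> : w - omega_inv w - (q - omega_inv q) = (w - q) * (1 - h w) by rewrite [omega_inv w]hE; ring.
have -> : ImC (omega_inv w) = ImC (h w * (w - q)) by rewrite [omega_inv w]hE ImCD qR add0r.
rewrite cabsM exprMn -mulrA ler_pM2l; last by rewrite exprn_gt0// cabs_gt0 subr_eq0.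
rewrite mulrA ler_pM2r// => K1.
have K2 : ImC w - ImC (h w * (w - q)) <= ImC w + cabs (h w) * cabs (w - q).
  by rewrite lerD2l -cabsM; apply: le_trans (ImC_le _); rewrite -normrN ler_norm.
have K3 : 1 + t <= cabs (1 - h w) ^+ 2.
  rewrite cabs_sqr ReCB ImCB /=.
  have := sqr_ge0 (0 - ImC (h w)); have : 1 + t / 2 <= 1 - ReC (h w) by lra.
  by nra.
have w0 : 0 < ImC w by [].
have K4 : (1 + t) * ImC w <= cabs (1 - h w) ^+ 2 * ImC w by rewrite ler_pM2r.
have K5 : cabs (h w) * cabs (w - q) <= 3 * t / 2 * (ImC q / 4).
  by apply: ler_pM; rewrite ?cabs_ge0// ltW.
have K6 : t * (3 * (ImC q / 4)) < t * ImC w by rewrite ltr_pM2l.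
have := mulr_gt0 t0 q0; rewrite mulrDl mul1r in K4; lra.
Qed.

(** The continuation is G_nu composed with the local inverse of K. In the half-plane this inverse is
    omega by [omega_inv_inj], and at [x] it takes an interior value, where Im G_nu < 0. *)
Lemma cauchy_extension x (q : C) : UHP q -> omega_inv q = ofR x ->
  exists2 eta : R, 0 < eta & exists Gh : C -> C, [/\
    forall z, cabs (z - ofR x) < eta -> cdiff Gh z,
    forall z, UHP z -> cabs (z - ofR x) < eta -> Defs.cauchy rho z = Gh z &
    ImC (Gh (ofR x)) < 0].
Proof.
move=> qU qE; have [h [hc hE]] := omega_inv_cdiff qU.
have h0 : h q != 0 by apply: omega_inv_deriv_neq0 hE => //; rewrite qE.
have [eta eta0 [om omP]] := @local_inverse _ omega_inv h q (ImC q) qU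
  (fun z zq => omega_inv_cdiff (UHP_disc qU zq)) hc hE h0.
rewrite qE in omP.
have omU z : cabs (z - ofR x) < eta -> UHP (om z) by move=> /omP[k _ _]; exact: UHP_disc k.
exists eta => //; exists (fun z => Defs.cauchy nu (om z)); split.
- move=> z zx; have [_ _ od] := omP _ zx.
  by apply: cdiff_comp => //; apply: cdiff_cauchy; exact: omU.
- move=> z zU zx; have [_ oE _] := omP _ zx.
  have -> : om z = z - phi (Ftr rho z).
    apply: omega_inv_inj; [exact: omU|exact: omega_UHP|by rewrite oE|by rewrite oE omega_inv_omega].
  by have := sub zU; rewrite /Ftr => /(congr1 GRing.inv); rewrite !invrK.
- by apply: Im_cauchy_lt0; apply: omU; rewrite subrr cabs0.
Qed.

End Extension.

(** * Stieltjes inversion *)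

Section Stieltjes.
Variables (R : realType) (rho : probability R R).
Local Notation C := R[i].
Local Notation mk := (@complex.Complex R).
Implicit Types (a b x y t s e d h : R).

Lemma Im_cauchy_poisson t y : 0 < y ->
  - ImC (Defs.cauchy rho (mk t y)) = mexp rho (fun s => y / ((t - s) ^+ 2 + y ^+ 2)).
Proof.
move=> y0; have yU : UHP (mk t y) by [].
have [_ bI] := cbmeas_kernel yU.
have -> : ImC (Defs.cauchy rho (mk t y)) = mexp rho (fun s => ImC ((mk t y - ofR s)^-1)) by [].
rewrite -mulN1r -mexpZ//.
congr mexp; apply/funext => s.
by rewrite ImCV cabs_sqr ReCB ImCB /= subr0 mulN1r mulNr opprK.
Qed.

Lemma atan_MVT (u h : R) : exists2 xi : R, `|xi - u| <= `|h| & atan (u + h) - atan u = h / (1 + xi ^+ 2).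
Proof.
have atc (c d : R) : {within `[c, d], continuous (@atan R)}.
  apply: derivable_within_continuous => x _; have := is_derive1_atan x => -[]; exact.
have [h0|h0] := leP 0 h.
  have [||xi] := @MVT_segment R atan (fun x => (1 + x ^+ 2)^-1) u (u + h).
  - by rewrite lerDl.
  - exact: atc.
  rewrite in_itv /= => /andP[k1 k2] E; exists xi; first by rewrite !ger0_norm; lra.
  by rewrite E addrAC subrr add0r mulrC.
have [||xi] := @MVT_segment R atan (fun x => (1 + x ^+ 2)^-1) (u + h) u.
- by rewrite gerDl ltW.
- exact: atc.
rewrite in_itv /= => /andP[k1 k2] E; exists xi; first by rewrite ler0_norm ?ltr0_norm; lra.
by rewrite -opprB E opprD addrA subrr add0r mulrN opprK mulrC.
Qed.

(** The error is uniform in [u], so the derivative passes under the expectation in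
    [is_derive_smooth_cdf] without a convergence theorem. *)
Lemma atan_quad (u h : R) : `|atan (u + h) - atan u - h / (1 + u ^+ 2)| <= h ^+ 2.
Proof.
have [xi xu ->] := atan_MVT u h.
have d1 : 0 < 1 + xi ^+ 2 by rewrite ltr_pwDl// sqr_ge0.
have d2 : 0 < 1 + u ^+ 2 by rewrite ltr_pwDl// sqr_ge0.
have -> : h / (1 + xi ^+ 2) - h / (1 + u ^+ 2) =
    h * ((u - xi) * ((u + xi) / ((1 + xi ^+ 2) * (1 + u ^+ 2)))).
  by field; rewrite !gt_eqF.
rewrite !normrM -[leRHS]ger0_norm ?sqr_ge0// [h ^+ 2]expr2 normrM.
apply: ler_wpM2l => //; rewrite -[leRHS]mulr1 distrC; apply: ler_pM => //.
have D : 1 + xi ^+ 2 + u ^+ 2 <= (1 + xi ^+ 2) * (1 + u ^+ 2).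
  by have := mulr_ge0 (sqr_ge0 xi) (sqr_ge0 u); rewrite mulrDl mul1r mulrDr mulr1; lra.
have s1 := sqr_ge0 (u - 1); have s2 := sqr_ge0 (u + 1).
have s3 := sqr_ge0 (xi - 1); have s4 := sqr_ge0 (xi + 1).
rewrite -normrM ler_norml; apply/andP; split.
  have e1 : - (1 + xi ^+ 2 + u ^+ 2) <= u + xi by nra.
  by rewrite ler_pdivlMr ?mulr_gt0// mulN1r; lra.
have e1 : u + xi <= 1 + xi ^+ 2 + u ^+ 2 by nra.
by rewrite ler_pdivrMr ?mulr_gt0// mul1r; lra.
Qed.

Lemma is_derive_eps (f : R -> R) x (l : R) :
  (forall e, 0 < e -> exists2 d : R, 0 < d & forall h, h != 0 -> `|h| < d ->
     `|f (x + h) - f x - l * h| <= e * `|h|) -> is_derive x 1 f l.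
Proof.
move=> H.
have lim : h^-1 *: ((f \o shift x) (h *: (1 : R)) - f x) @[h --> 0^'] --> l.
  apply/cvgrPdist_le => /= e /H[d d0 dP]; apply/nbhs_normP; exists d => //= h; rewrite /ball_ /= sub0r normrN => hd h0.
  have := dP h h0 hd; rewrite (addrC x h) => k; rewrite /shift /GRing.scale /= mulr1.
  rewrite distrC (_ : h^-1 * (f (h + x) - f x) - l = (f (h + x) - f x - l * h) / h); last by field.
  rewrite normrM normfV ler_pdivrMr ?normr_gt0//.
apply: DeriveDef; first by apply: cvgP lim.
by apply: cvg_lim.
Qed.

(** Equals pi (F - 1/2), with F the distribution function of the convolution of [rho] with the
    Cauchy law of scale [y]. *)
Definition smooth_cdf y t := mexp rho (fun s => atan ((t - s) / y)).

Lemma atan_bmeas y t : bmeas (fun s => atan ((t - s) / y)).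
Proof.
apply: bmeas_cont.
  move=> s; apply: continuous_comp; last exact: continuous_atan.
  by apply: cvgM; [apply: cvgB; [exact: cvg_cst|exact: cvg_id]|exact: cvg_cst].
exists (pi / 2) => s; rewrite ler_norml; apply/andP; split; apply: ltW.
  exact: atan_gtNpi2.
exact: atan_ltpi2.
Qed.

Lemma poisson_bmeas y t : 0 < y -> bmeas (fun s => y / ((t - s) ^+ 2 + y ^+ 2)).
Proof.
move=> y0; have [_ bI] := cbmeas_kernel (y0 : UHP (mk t y)).
apply: bmeas_eq (bmeasZ (-1) bI) => s.
by rewrite ImCV cabs_sqr ReCB ImCB /= subr0 mulN1r mulNr opprK.
Qed.

Lemma is_derive_smooth_cdf y t : 0 < y ->
  is_derive t 1 (smooth_cdf y) (- ImC (Defs.cauchy rho (mk t y))).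
Proof.
move=> y0; apply: is_derive_eps => e e0; exists (e * y ^+ 2); first by rewrite mulr_gt0// exprn_gt0.
move=> h h0 he; rewrite Im_cauchy_poisson// /smooth_cdf.
have b1 := atan_bmeas y (t + h); have b2 := atan_bmeas y t; have b3 := poisson_bmeas t y0.
set A := (fun s => atan ((t + h - s) / y)) in b1 *; set B := (fun s => atan ((t - s) / y)) in b2 *.
set P := (fun s => y / ((t - s) ^+ 2 + y ^+ 2)) in b3 *.
have -> : mexp rho A - mexp rho B - mexp rho P * h = mexp rho (fun s => (A s + (-1) * B s) + (- h) * P s).
  rewrite mexpD; [|by apply: bmeasD => //; exact: bmeasZ|exact: bmeasZ].
  by rewrite mexpD//; [rewrite (mexpZ rho (-1) b2) (mexpZ rho (- h) b3); ring|exact: bmeasZ].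
apply: (@le_trans _ _ (mexp rho (fun=> (h / y) ^+ 2))).
  apply: mexp_bound; [|exact: bmeas_cst|].
    by apply: bmeasD; [apply: bmeasD => //; exact: bmeasZ|exact: bmeasZ].
  move=> s; rewrite /A /B /P; have := atan_quad ((t - s) / y) (h / y).
  rewrite -mulrDl (_ : t - s + h = t + h - s); last by ring.
  rewrite (_ : h / y / (1 + ((t - s) / y) ^+ 2) = h * (y / ((t - s) ^+ 2 + y ^+ 2))); last first.
    have : 0 < (t - s) ^+ 2 + y ^+ 2 by rewrite ltr_wpDl ?sqr_ge0// exprn_gt0.
    move=> k; field; rewrite !gt_eqF//= addrC.
  by rewrite mulN1r mulNr.
rewrite mexp_cst expr_div_n ler_pdivrMr ?exprn_gt0// -real_normK ?num_real// expr2.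
by rewrite mulrAC; apply: ler_wpM2r => //; exact: ltW.
Qed.

Lemma smooth_cdf_MVT y a b : 0 < y -> a <= b -> exists2 c : R, a <= c <= b &
  smooth_cdf y b - smooth_cdf y a = - ImC (Defs.cauchy rho (mk c y)) * (b - a).
Proof.
move=> y0 ab; have [||c] := @MVT_segment R (smooth_cdf y) (fun c => - ImC (Defs.cauchy rho (mk c y))) a b ab.
- by move=> x _; exact: is_derive_smooth_cdf.
- by apply: derivable_within_continuous => x _; have [] := is_derive_smooth_cdf x y0.
- by rewrite in_itv; exists c.
Qed.

Lemma mexp_indic (k : R) (A : set R) : measurable A -> mexp rho (fun s => k * \1_A s) = k * fine (rho A).
Proof.
move=> mA; rewrite mexpZ.
  by congr (_ * _); rewrite /mexp /Rintegral integral_indic// setIT.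
by split; [exact: measurable_indic|exists 1 => t; rewrite indicE; case: (_ \in _); rewrite ?normr1 ?normr0].
Qed.

Lemma indic_bmeas (k : R) (A : set R) : measurable A -> bmeas (fun s => k * \1_A s).
Proof.
move=> mA; apply: bmeasZ.
by split; [exact: measurable_indic|exists 1 => t; rewrite indicE; case: (_ \in _); rewrite ?normr1 ?normr0].
Qed.

Lemma atan_near_pihalf e (kap d : R) : 0 < e -> 0 < kap -> 0 < d ->
  exists y, [/\ 0 < y, y < d & pi / 2 - e < atan (kap / y)].
Proof.
move=> e0 k0 d0; have /cvgrPdist_lt /(_ _ e0) [X [_ XP]] := @cvgy_atan R.
pose Y := `|X| + 1; have Y0 : 0 < Y by rewrite ltr_wpDl.
exists (Num.min (d / 2) (kap / Y)).
have m0 : 0 < Num.min (d / 2) (kap / Y) by rewrite lt_min !divr_gt0.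
have m1 : Num.min (d / 2) (kap / Y) <= d / 2 by rewrite ge_min lexx.
have m2 : Num.min (d / 2) (kap / Y) <= kap / Y by rewrite ge_min lexx orbT.
move: (Num.min _ _) m0 m1 m2 => y y0 yd yk; split => //; first lra.
have : X < kap / y.
  rewrite ltr_pdivlMr//; rewrite ler_pdivlMr// in yk; apply: lt_le_trans yk.
  by rewrite mulrC ltr_pM2l// /Y; have := ler_norm X; lra.
by move=> /XP; rewrite ltr_norml => /andP[_]; lra.
Qed.

Lemma smooth_cdfB y a b : smooth_cdf y b - smooth_cdf y a =
  mexp rho (fun s => atan ((b - s) / y) + (-1) * atan ((a - s) / y)).
Proof.
have b1 := atan_bmeas y b; have b2 := atan_bmeas y a.
by rewrite mexpD//; [rewrite mexpZ// mulN1r|exact: bmeasZ].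
Qed.

Lemma fine_prob_le1 (A : set R) : measurable A -> 0 <= fine (rho A) <= 1.
Proof.
move=> mA; rewrite fine_ge0 ?measure_ge0//= -lee_fin fineK; first exact: probability_le1.
exact: fin_num_measure.
Qed.

(** The mean value theorem bounds the increment of [smooth_cdf], whose integrand is at least 2 atan
    (kap / y) on the shrunken interval; this tends to pi as y tends to 0. *)
Lemma interval_upper a b (hi d kap : R) : a <= b -> 0 < d -> 0 < kap ->
  (forall t y, a <= t <= b -> 0 < y < d -> - ImC (Defs.cauchy rho (mk t y)) <= hi) ->
  pi * fine (rho `[a + kap, b - kap]%classic) <= hi * (b - a).
Proof.
move=> ab d0 k0 H; set A := `[_, _]%classic; have mA : measurable A by exact: measurable_itv.
have /andP[r0 r1] := fine_prob_le1 mA; set r := fine _ in r0 r1 *.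
rewrite leNgt; apply/negP => lt.
pose e := (pi * r - hi * (b - a)) / 4; have e0 : 0 < e by rewrite /e; lra.
have [y [y0 yd ye]] := atan_near_pihalf e0 k0 d0.
have [c cab cE] := smooth_cdf_MVT y0 ab.
have k1 : smooth_cdf y b - smooth_cdf y a <= hi * (b - a).
  by rewrite cE; apply: ler_wpM2r; [lra|apply: H => //; rewrite y0].
have k2 : 2 * atan (kap / y) * r <= smooth_cdf y b - smooth_cdf y a.
  rewrite /r -mexp_indic// smooth_cdfB; apply: mexp_le; first exact: indic_bmeas.
    by apply: bmeasD; [exact: atan_bmeas|apply: bmeasZ; exact: atan_bmeas].
  move=> s; rewrite indicE; case: (boolP (s \in A)) => sA.
    move: sA; rewrite inE /A /= in_itv /= => /andP[s1 s2].
    have h1 : atan (kap / y) <= atan ((b - s) / y) by apply: le_atan; rewrite ler_pM2r ?invr_gt0//; lra.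
    have h2 : atan ((a - s) / y) <= - atan (kap / y).
      by rewrite -atanN; apply: le_atan; rewrite -mulNr ler_pM2r ?invr_gt0//; lra.
    by rewrite mulr1; lra.
  rewrite mulr0; have : atan ((a - s) / y) <= atan ((b - s) / y); last lra.
  by apply: le_atan; rewrite ler_pM2r ?invr_gt0//; lra.
have k3 : 2 * (pi / 2 - e) * r <= 2 * atan (kap / y) * r by apply: ler_wpM2r => //; lra.
have k4 : e * r <= e by rewrite -[leRHS]mulr1 ler_pM2l.
rewrite /e in k3 k4 *; lra.
Qed.

(** Here the integrand is at most pi, and outside the enlarged interval the two arctangents nearly
    cancel. *)
Lemma interval_lower a b (lo d kap : R) : a <= b -> 0 < d -> 0 < kap ->
  (forall t y, a <= t <= b -> 0 < y < d -> lo <= - ImC (Defs.cauchy rho (mk t y))) ->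
  lo * (b - a) <= pi * fine (rho `[a - kap, b + kap]%classic).
Proof.
move=> ab d0 k0 H; set A := `[_, _]%classic; have mA : measurable A by exact: measurable_itv.
have /andP[r0 r1] := fine_prob_le1 mA; set r := fine _ in r0 r1 *.
rewrite leNgt; apply/negP => lt.
pose e := (lo * (b - a) - pi * r) / 4; have e0 : 0 < e by rewrite /e; lra.
have [y [y0 yd ye]] := atan_near_pihalf e0 k0 d0.
have [c cab cE] := smooth_cdf_MVT y0 ab.
have k1 : lo * (b - a) <= smooth_cdf y b - smooth_cdf y a.
  by rewrite cE; apply: ler_wpM2r; [lra|apply: H => //; rewrite y0].
have k2 : smooth_cdf y b - smooth_cdf y a <= pi * r + e.
  have -> : pi * r + e = mexp rho (fun s => pi * \1_A s + e).
    by rewrite mexpD; [rewrite mexp_indic// mexp_cst|exact: indic_bmeas|exact: bmeas_cst].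
  rewrite smooth_cdfB; apply: mexp_le.
  - by apply: bmeasD; [exact: atan_bmeas|apply: bmeasZ; exact: atan_bmeas].
  - by apply: bmeasD; [exact: indic_bmeas|exact: bmeas_cst].
  move=> s; have u1 := atan_ltpi2 ((b - s) / y); have u2 := atan_gtNpi2 ((a - s) / y).
  rewrite indicE; case: (boolP (s \in A)) => sA; first by rewrite mulr1; lra.
  rewrite mulr0 add0r; move: sA; rewrite notin_setE /A /= in_itv /= => /negP; rewrite negb_and -!ltNge.
  case/orP => hs.
    have : atan (kap / y) <= atan ((a - s) / y); last lra.
    by apply: le_atan; rewrite ler_pM2r ?invr_gt0//; lra.
  have : atan ((b - s) / y) <= - atan (kap / y); last lra.
  by rewrite -atanN; apply: le_atan; rewrite -mulNr ler_pM2r ?invr_gt0//; lra.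
rewrite /e in k2; lra.
Qed.

Lemma interval_bounds x (m e d : R) : 0 < d -> 0 < e -> 0 <= m ->
  (forall t y, `|t - x| < d -> 0 < y < d -> `|- ImC (Defs.cauchy rho (mk t y)) - pi * m| <= pi * e) ->
  forall a b, x - d < a -> a <= b -> b < x + d ->
    (m - e) * (b - a) <= fine (rho `[a, b]%classic) <= (m + e) * (b - a).
Proof.
move=> d0 e0 m0 H a b xa ab bx; have p0 := pi_gt0 R.
have Hb t y : x - d < t -> t < x + d -> 0 < y < d ->
    pi * (m - e) <= - ImC (Defs.cauchy rho (mk t y)) <= pi * (m + e).
  move=> t1 t2 yd; have := H t y; rewrite ltr_norml ler_norml => k.
  have := k ltac:(apply/andP; split; lra) yd; rewrite mulrBr mulrDr => /andP[k1 k2].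
  by apply/andP; split; lra.
have mA : measurable (`[a, b]%classic : set R) by exact: measurable_itv.
have /andP[r0 r1] := fine_prob_le1 mA; set r := fine _ in r0 r1 *.
apply/andP; split; rewrite leNgt; apply/negP => lt.
  have ab' : a < b.
    rewrite lt_neqAle ab andbT; apply/eqP => E; move: lt; rewrite E subrr mulr0; lra.
  have me : 0 < m - e.
    rewrite ltNge; apply/negP => me.
    have k : (m - e) * (b - a) <= 0 by apply: mulr_le0_ge0; lra.
    lra.
  (* The margin costs 2 kap (m - e), at most half of the supposed gap. *)
  pose kap := Num.min ((b - a) / 4) (((m - e) * (b - a) - r) / (4 * (m - e))).
  have k0 : 0 < kap by rewrite lt_min !divr_gt0 ?mulr_gt0//; lra.
  have k1 : kap <= (b - a) / 4 by rewrite ge_min lexx.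
  have k2 : kap * (4 * (m - e)) <= (m - e) * (b - a) - r.
    by rewrite -ler_pdivlMr ?mulr_gt0// ge_min lexx orbT.
  have := @interval_lower (a + kap) (b - kap) (pi * (m - e)) d kap ltac:(lra) d0 k0.
  rewrite addrK subrK -/r => /(_ _) h.
  have {h} := h (fun t y tab yd => (andP (Hb t y ltac:(case/andP: tab; lra) ltac:(case/andP: tab; lra) yd)).1).
  rewrite -mulrA ler_pM2l// => h; lra.
pose kap := Num.min (Num.min ((a - (x - d)) / 2) ((x + d - b) / 2)) ((r - (m + e) * (b - a)) / (4 * (m + e))).
have me : 0 < m + e by lra.
have k0 : 0 < kap by rewrite !lt_min !divr_gt0 ?mulr_gt0//; lra.
have k1 : kap <= (a - (x - d)) / 2 by rewrite !ge_min lexx.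
have k1' : kap <= (x + d - b) / 2 by rewrite !ge_min lexx orbT.
have k2 : kap * (4 * (m + e)) <= r - (m + e) * (b - a).
  by rewrite -ler_pdivlMr ?mulr_gt0// ge_min lexx orbT.
have := @interval_upper (a - kap) (b + kap) (pi * (m + e)) d kap ltac:(lra) d0 k0.
rewrite addrK subrK -/r => /(_ _) h.
have {h} := h (fun t y tab yd => (andP (Hb t y ltac:(case/andP: tab; lra) ltac:(case/andP: tab; lra) yd)).2).
rewrite -mulrA ler_pM2l// => h; lra.
Qed.

Definition rcdf t := fine (rho `]-oo, t]%classic).

Lemma rcdfB a b : a <= b -> rcdf b - rcdf a = fine (rho `]a, b]%classic).
Proof.
move=> ab; have : `]a, b]%classic = `]-oo, b] `\` `]-oo, a] :> set R.
  by rewrite -[RHS]setCK setCD setCitvl setUC -[LHS]setCK setCitv.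
move=> ->; rewrite measureD ?setIidr//=; [|by apply: subset_itvl; rewrite bnd_simp|].
  by rewrite fineB ?fin_num_measure.
by rewrite -ge0_fin_numE// fin_num_measure.
Qed.

Lemma prob_itvcc a b : a <= b -> fine (rho `[a, b]%classic) = fine (rho `[a, a]%classic) + fine (rho `]a, b]%classic).
Proof.
move=> ab; rewrite set_itv1 -(@setU1itv _ _ (BRight b) a false) ?bnd_simp//.
rewrite measureU//; first by rewrite fineD ?fin_num_measure.
by apply/seteqP; split => // t [->] /=; rewrite in_itv /= ltxx.
Qed.

Lemma is_derive_rcdf x (m : R) : 0 <= m ->
  (forall e, 0 < e -> exists2 d : R, 0 < d & forall t y, `|t - x| < d -> 0 < y < d ->
     `|- ImC (Defs.cauchy rho (mk t y)) - pi * m| <= pi * e) ->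
  is_derive x 1 rcdf m.
Proof.
move=> m0 H; apply: is_derive_eps => e e0; have [d d0 dP] := H _ e0.
have B := interval_bounds d0 e0 m0 dP.
(* Taking a = b in the bounds excludes atoms, so closed and half-open intervals have the same
   mass. *)
have sg a : x - d < a -> a < x + d -> fine (rho `[a, a]%classic) = 0.
  move=> h1 h2; have := B a a h1 (lexx _) h2; rewrite subrr !mulr0 => /andP[k1 k2].
  by apply/eqP; rewrite eq_le k1 k2.
have E a b : x - d < a -> a <= b -> b < x + d ->
    (m - e) * (b - a) <= rcdf b - rcdf a <= (m + e) * (b - a).
  move=> h1 h2 h3; rewrite rcdfB//; have := B a b h1 h2 h3; rewrite prob_itvcc// sg ?add0r//; lra.
exists d => // h h0 hd; move: hd; rewrite ltr_norml => /andP[hd1 hd2].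
have [hp|hn] := leP 0 h.
  have := E x (x + h) ltac:(lra) ltac:(lra) ltac:(lra).
  rewrite (_ : x + h - x = h); last by ring.
  by rewrite (ger0_norm hp) mulrBl mulrDl => /andP[k1 k2]; rewrite ler_norml; apply/andP; split; lra.
have := E (x + h) x ltac:(lra) ltac:(lra) ltac:(lra).
rewrite (_ : x - (x + h) = - h); last by ring.
by rewrite (ltr0_norm hn) mulrBl mulrDl => /andP[k1 k2]; rewrite ler_norml; apply/andP; split; lra.
Qed.

End Stieltjes.

(** * The density *)

Section Density.
Variables (R : realType) (rho : probability R R).
Local Notation C := R[i].
Local Notation mk := (@complex.Complex R).
Local Notation leb := (@lebesgue_measure R).
Implicit Types (a b x y t e d : R).

(** Half-open intervals are stable under intersection and generate the Borel sets, so they determine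
    a measure. *)
Lemma measure_density (p : R -> R) : measurable_fun setT p -> (forall x, 0 <= p x) ->
  (forall a b, a < b -> rho `]a, b]%classic = (\int[leb]_(x in `]a, b]) (p x)%:E)%E) ->
  forall A : set R, measurable A -> rho A = (\int[leb]_(x in A) (p x)%:E)%E.
Proof.
move=> mp p0 H.
pose dens (A : set R) := (\int[leb]_(x in A) (p x)%:E)%E.
have d0 : dens set0 = 0%E by rewrite /dens integral_set0.
have dge0 A : (0 <= dens A)%E by apply: integral_ge0 => x _; rewrite lee_fin.
have dsig : semi_sigma_additive dens.
  move=> F mF tF mUF; rewrite /dens; apply: cvg_toP.
    apply: ereal_nondecreasing_is_cvgn => m n mn.
    by apply: lee_sum_nneg_natr => // k _ _; exact: dge0.
  rewrite ge0_integral_bigcup//=.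
    by apply/measurable_funTS/measurable_EFinP.
  by move=> x _; rewrite lee_fin.
pose M : {measure set R -> \bar R} := HB.pack dens (isMeasure.Build _ _ _ dens d0 dge0 dsig).
move=> A mA; rewrite -[RHS]/(M A).
apply: (@measure_unique _ _ _ (@ocitv R) (fun n => `](- n%:R), n%:R]%classic)) => //.
- exact: ocitvI.
- by move=> i; exact: is_ocitv.
- apply/seteqP; split => // x _; exists (Num.truncn `|x|).+1 => //=.
  have := truncnS_gt `|x|; rewrite ltr_norml => /andP[k1 k2].
  by rewrite in_itv /= k1 ltW.
- move=> _ [[a b] _ <-] /=; have [ab|ba] := ltP a b; first exact: H.
  by rewrite set_itv_ge ?measure0// bnd_simp -leNgt.
- by move=> n; rewrite -ge0_fin_numE ?measure_ge0//; exact: fin_num_measure.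
Qed.

Hypothesis ext : forall x, exists2 eta : R, 0 < eta & exists Gh : C -> C, [/\
    forall z, cabs (z - ofR x) < eta -> cdiff Gh z,
    forall z, UHP z -> cabs (z - ofR x) < eta -> Defs.cauchy rho z = Gh z &
    ImC (Gh (ofR x)) < 0].

Lemma analytic_density : exists p : R -> R,
      [/\ measurable_fun setT p,
          forall x, 0 < p x,
          real_analytic p
        & forall A : set R, measurable A ->
            rho A = (\int[leb]_(x in A) (p x)%:E)%E].
Proof.
have /choice[E EP] : forall x, exists E : R * (C -> C), 0 < E.1 /\ [/\
    forall z, cabs (z - ofR x) < E.1 -> cdiff E.2 z,
    forall z, UHP z -> cabs (z - ofR x) < E.1 -> Defs.cauchy rho z = E.2 z &
    ImC (E.2 (ofR x)) < 0].
  by move=> x; have [eta eta0 [Gh GhP]] := ext x; exists (eta, Gh).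
pose eta x := (E x).1; pose Gh x := (E x).2.
have eta0 x : 0 < eta x by have [] := EP x.
have Gd x z : cabs (z - ofR x) < eta x -> cdiff (Gh x) z by have [_ [+ _ _]] := EP x; apply.
have GE x z : UHP z -> cabs (z - ofR x) < eta x -> Defs.cauchy rho z = Gh x z by have [_ [_ + _]] := EP x; apply.
have Gneg x : ImC (Gh x (ofR x)) < 0 by have [_ []] := EP x.
(* Both continuations are the vertical limit of the same Cauchy transform at [t]; hence [p], defined
   from a different continuation at each point, is locally given by a single one. *)
have agree x t : `|t - x| < eta x -> Gh x (ofR t) = Gh t (ofR t).
  move=> tx; apply/eqP; rewrite -subr_eq0; apply/eqP/cabs_le_eps => e e0.
  have c1 : ccont (Gh x) (ofR t) by apply: cdiff_cont; apply: Gd; rewrite -ofRB cabs_ofR.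
  have c2 : ccont (Gh t) (ofR t) by apply: cdiff_cont; apply: Gd; rewrite subrr cabs0.
  have [d1 d10 h1] := c1 (e / 2) ltac:(lra); have [d2 d20 h2] := c2 (e / 2) ltac:(lra).
  pose m := Num.min (Num.min d1 d2) (Num.min (eta t) (eta x - `|t - x|)).
  have m0 : 0 < m by rewrite !lt_min d10 d20 eta0 subr_gt0.
  have m1 : m <= d1 by rewrite !ge_min lexx.
  have m2 : m <= d2 by rewrite !ge_min lexx orbT.
  have m3 : m <= eta t by rewrite !ge_min lexx orbT.
  have m4 : m <= eta x - `|t - x| by rewrite !ge_min lexx !orbT.
  have y0 : 0 < m / 2 by lra.
  have [[zU _] zd] := vertical_cone t y0; set z := mk t (m / 2) in zU zd.
  have k1 := h1 z ltac:(lra); have k2 := h2 z ltac:(lra).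
  have zx : cabs (z - ofR x) < eta x.
    by have := cabs_tri z (ofR t) (ofR x); rewrite -ofRB cabs_ofR; lra.
  rewrite -(GE _ _ zU zx) in k1; rewrite -(GE t _ zU) in k2; last lra.
  have := cabs_tri (Gh x (ofR t)) (Defs.cauchy rho z) (Gh t (ofR t)).
  by rewrite [cabs (Gh x _ - Defs.cauchy rho z)]cabsBC; lra.
pose p x := - ImC (Gh x (ofR x)) / pi.
have p0 x : 0 < p x by rewrite divr_gt0 ?pi_gt0// oppr_gt0.
have pE x t : `|t - x| < eta x -> p t = - ImC (Gh x (ofR t)) / pi by move=> /agree k; rewrite /p k.
have pcont x : {for x, continuous p}.
  apply/cvgrPdist_lt => e e0; have p1 := pi_gt0 R.
  have c1 : ccont (Gh x) (ofR x) by apply: cdiff_cont; apply: Gd; rewrite subrr cabs0.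
  have [d d0 dP] := c1 (e * pi) (mulr_gt0 e0 p1).
  apply/nbhs_normP; exists (Num.min d (eta x)); first by rewrite /= lt_min d0 eta0.
  move=> t /=; rewrite lt_min distrC => /andP[td te].
  rewrite (pE _ _ te) (pE x x) ?subrr ?normr0// -mulrBl normrM normfV (gtr0_norm p1).
  rewrite ltr_pdivrMr// opprK addrC -ImCB; apply: le_lt_trans (ImC_le _) _.
  by apply: dP; rewrite -ofRB cabs_ofR.
have pmeas : measurable_fun setT p by exact: continuous_measurable_fun.
have pder x : is_derive x 1 (rcdf rho) (p x).
  apply: is_derive_rcdf; first exact: ltW.
  move=> e e0; have p1 := pi_gt0 R.
  have c1 : ccont (Gh x) (ofR x) by apply: cdiff_cont; apply: Gd; rewrite subrr cabs0.
  have [d d0 dP] := c1 (pi * e) (mulr_gt0 p1 e0).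
  pose m := Num.min d (eta x) / 2.
  have mm : 0 < Num.min d (eta x) by rewrite lt_min d0 eta0.
  have m1 : Num.min d (eta x) <= d by rewrite ge_min lexx.
  have m2 : Num.min d (eta x) <= eta x by rewrite ge_min lexx orbT.
  exists m; first by rewrite /m; lra.
  move=> t y tx /andP[y0 ym].
  have [[zU _] zd] := vertical_cone t y0.
  have zx : cabs (mk t y - ofR x) < Num.min d (eta x).
    by have := cabs_tri (mk t y) (ofR t) (ofR x); rewrite -ofRB cabs_ofR zd; rewrite /m in tx ym; lra.
  rewrite (GE x) //; last lra.
  have -> : pi * p x = - ImC (Gh x (ofR x)) by rewrite /p mulrC divfK ?gt_eqF.
  rewrite opprK addrC distrC -normrN opprB -ImCB.
  apply: le_trans (ImC_le _) _; rewrite cabsBC; apply/ltW/dP; lra.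
exists p; split => //.
- move=> x0; exists (eta x0 / 2); split; first by have := eta0 x0; lra.
  have h : holo_at (Gh x0) (ofR x0) (eta x0) by apply: holo_cdiff => z; exact: Gd.
  have e0 := eta0 x0.
  have rr : 0 < eta x0 / 2 < eta x0 by apply/andP; split; lra.
  have [c [B B0 cP]] := Taylor rr h.1 h.2.
  exists (fun k => - ImC (c k) / pi) => x xx.
  have xe : `|x - x0| < eta x0 by lra.
  pose s : R := `|x - x0|; rewrite -/s in xx xe; set r := eta x0 / 2 in cP xx.
  have s0 : 0 <= s by exact: normr_ge0.
  have r0 : 0 < r by rewrite /r; lra.
  have q1 : s / r < 1 by rewrite ltr_pdivrMr// mul1r.
  have q0 : 0 <= s / r by rewrite divr_ge0// ltW.
  have p1 := pi_gt0 R.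
  (* Powers of x - x0 are real, so imaginary parts can be taken coefficientwise. *)
  have SE n : \sum_(0 <= k < n) (- ImC (c k) / pi) * (x - x0) ^+ k =
      - ImC (\sum_(k < n) c k * (ofR x - ofR x0) ^+ k) / pi.
    rewrite big_mkord; elim: n => [|n IH]; first by rewrite !big_ord0 /= oppr0 mul0r.
    rewrite !big_ord_recr /= IH ImCD -ofRB -ofRX ImCM Re_ofR Im_ofR mulr0 add0r.
    by rewrite opprD mulrDl; congr (_ + _); rewrite !mulNr; congr (- _); rewrite mulrAC.
  pose K := B * (r / (r - s)) / pi.
  have rs : 0 < r - s by rewrite subr_gt0.
  have K0 : 0 <= K by rewrite divr_ge0 ?(ltW p1)// mulr_ge0// divr_ge0 ?(ltW r0) ?(ltW rs).
  have bnd n : `|p x - \sum_(0 <= k < n) (- ImC (c k) / pi) * (x - x0) ^+ k| <= K * (s / r) ^+ n.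
    rewrite SE (pE x0) // -mulrBl normrM normfV (gtr0_norm p1) ler_pdivrMr//.
    rewrite opprK addrC -ImCB -normrN -ImCN; apply: le_trans (ImC_le _) _; rewrite opprB.
    have := cP (ofR x) n; rewrite -ofRB cabs_ofR -/s => /(_ xx) /le_trans; apply.
    rewrite /K (_ : B * (r / (r - s)) / pi * _ * pi = B * (s / r) ^+ n * (r / (r - s)))//.
    by rewrite [_ / pi * _]mulrAC divfK ?gt_eqF// mulrAC.
  apply/cvgrPdist_le => e e1.
  have /cvgrPdist_le /(_ (e / (K + 1))) : (fun n => (s / r) ^+ n) @ \oo --> (0 : R).
    by apply: cvg_expr; rewrite ger0_norm.
  have KK : 0 < K + 1 by lra.
  move=> /(_ ltac:(by rewrite divr_gt0)) [N _ NP]; exists N => // n /= /NP /=.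
  rewrite sub0r normrN ger0_norm ?exprn_ge0// => k.
  apply: le_trans (bnd n) _.
  apply: (@le_trans _ _ ((K + 1) * (s / r) ^+ n)); first by rewrite ler_wpM2r ?exprn_ge0//; lra.
  by rewrite mulrC -ler_pdivlMr.
- apply: measure_density => // [x|a b ab]; first exact: ltW.
  rewrite -[LHS]fineK; last exact: fin_num_measure.
  rewrite -rcdfB ?(ltW ab)// integral_itv_obnd_cbnd; last first.
    by apply/measurable_funTS/measurable_EFinP.
  have cdfc x : {for x, continuous (rcdf rho)}.
    by apply: differentiable_continuous; apply/derivable1_diffP; have [] := pder x.
  rewrite (@continuous_FTC2 _ p (rcdf rho)) ?EFinB//.
  + by apply: continuous_subspaceT => x; exact: pcont.
  + split => [x _||]; first by have [] := pder x.
      by apply: cvg_at_right_filter; exact: cdfc.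
    by apply: cvg_at_left_filter; exact: cdfc.
  + by move=> x _; rewrite derive1E; have [_ ->] := pder x.
Qed.

End Density.

Theorem mainTheorem1 (R : realType) (mu : probability R R) (phi : R[i] -> R[i])
  (Hid : free_inf_div mu)
  (Hphi_ext : exists a M b N : R, voiculescu_on mu phi a M b N)
  (Hphi_holo : holomorphic_UHP phi)
  (Hphi_val : forall z, UHP z -> ImC (phi z) <= 0)
  (H1 : forall x : R,
      (exists L, ntlim_at phi x L /\ ImC L < 0) \/
      ((~ exists L, ntlim_at phi x L) /\ ~ ntlim_at_infty phi x))
  (H2 : ntlim_inf_infty phi \/
        (exists L, ntlim_inf phi L /\ ImC L < 0) \/
        (exists w1 w2, w1 <> w2 /\ nt_cluster_inf phi w1 /\ nt_cluster_inf phi w2)) :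
  forall nu rho : probability R R, free_conv mu nu rho ->
    exists p : R -> R,
      [/\ measurable_fun setT p,
          forall x, 0 < p x,
          real_analytic p
        & forall A : set R, measurable A ->
            rho A = (\int[lebesgue_measure]_(x in A) (p x)%:E)%E].
Proof.
move=> nu rho conv.
have phd z : UHP z -> cdiff phi z by move=> /Hphi_holo /cdiffP.
have phU z : UHP z -> ImC (phi z) < 0.
  (* Assumption 1 at the point 0 forbids a real limit. *)
  apply: Im_lt0_of_ntlim => // -[L [L0 Ll]].
  have [[L' [Ll' L'0]]|[no _]] := H1 0; last by apply: no; exists L.
  by move: L'0; rewrite (ntlim_at_unique Ll' Ll) L0 ltxx.
have sub := subordination Hphi_ext conv phd Hphi_val.
apply: analytic_density => x.
have [q qU qE] := boundary_fixpoint Hphi_ext phd phU H1 H2 sub x.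
exact: (cauchy_extension phd phU sub qU qE).
Qed.
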